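(* Let $X_1,X_2$ be complex Banach spaces and let $\mathcal{A}_1\subseteq\mathcal{B}(X_1)$, $\mathcal{A}_2\subseteq\mathcal{B}(X_2)$ be standard operator algebras. Fix an integer $k\geq 2$ and a finite sequence $(i_1,\ldots,i_m)$ with $\{i_1,\ldots,i_m\}=\{1,\ldots,k\}$ such that some term $i_p$ satisfies $i_p\neq i_q$ for all $q\neq p$, and let $T_1*\cdots*T_k=T_{i_1}T_{i_2}\cdots T_{i_m}$ be the associated generalized product of width $m$. Let $\Phi:\mathcal{A}_1\to\mathcal{A}_2$ be a map (no linearity or additivity assumed) whose range contains every operator in $\mathcal{B}(X_2)$ of rank at most two. Then $$\sigma_\pi(\Phi(A_1)*\cdots*\Phi(A_k))=\sigma_\pi(A_1*\cdots*A_k)\quad\text{for all }A_1,\ldots,A_k\in\mathcal{A}_1$$ holds if and only if one of the following holds: (1) there exist $\lambda\in\mathbb{C}$ with $\lambda^m=1$ and an invertible operator $T\in\mathcal{B}(X_1,X_2)$ such that $\Phi(A)=\lambda TAT^{-1}$ for all $A\in\mathcal{A}_1$; (2) $X_1$ and $X_2$ are reflexive, the generalized product is a generalized quasi-semi Jordan product, and there exist $\lambda\in\mathbb{C}$ with $\lambda^m=1$ and an invertible operator $T\in\mathcal{B}(X_1^*,X_2)$ such that $\Phi(A)=\lambda TA^*T^{-1}$ for all $A\in\mathcal{A}_1$ (here $A^*\in\mathcal{B}(X_1^* )$ is the Banach-space adjoint).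
   Context: A standard operator algebra on a complex Banach space $X$ is a subalgebra of $\mathcal{B}(X)$ (the algebra of bounded linear operators on $X$) containing all finite rank operators; it is not assumed to be closed or to contain the identity. For $T\in\mathcal{B}(X)$, $\sigma(T)$ is the spectrum, $r(T)$ the spectral radius, and the peripheral spectrum is $\sigma_\pi(T)=\{z\in\sigma(T):|z|=r(T)\}$. The generalized product $T_1*\cdots*T_k=T_{i_1}\cdots T_{i_m}$ is called a generalized quasi-semi Jordan product if, with $p$ the position of the term appearing exactly once, $$(i_{p+1},i_{p+2},\ldots,i_m,i_1,i_2,\ldots,i_{p-1})=(i_{p-1},i_{p-2},\ldots,i_1,i_m,i_{m-1},\ldots,i_{p+1}).$$ *)

(* Defs.v *)
From Stdlib Require Import Reals List.
Import ListNotations.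
Open Scope R_scope.

Definition Cplx := (R * R)%type.
Definition Czero : Cplx := (0, 0).
Definition Cone : Cplx := (1, 0).
Definition Cadd (a b : Cplx) : Cplx := (fst a + fst b, snd a + snd b).
Definition Cmul (a b : Cplx) : Cplx :=
  (fst a * fst b - snd a * snd b, fst a * snd b + snd a * fst b).
Definition Copp (a : Cplx) : Cplx := (- fst a, - snd a).
Definition Cmod (a : Cplx) : R := sqrt (fst a * fst a + snd a * snd a).
Fixpoint Cpow (a : Cplx) (n : nat) : Cplx :=
  match n with O => Cone | S n => Cmul a (Cpow a n) end.

Record CBanach := {
  car :> Type;
  vzero : car;
  vadd : car -> car -> car;
  vopp : car -> car;
  vscal : Cplx -> car -> car;
  vnorm : car -> R;
  vadd_assoc : forall x y z, vadd x (vadd y z) = vadd (vadd x y) z;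
  vadd_comm : forall x y, vadd x y = vadd y x;
  vadd_zero : forall x, vadd x vzero = x;
  vadd_opp : forall x, vadd x (vopp x) = vzero;
  vscal_one : forall x, vscal Cone x = x;
  vscal_assoc : forall a b x, vscal a (vscal b x) = vscal (Cmul a b) x;
  vscal_distr_v : forall a x y, vscal a (vadd x y) = vadd (vscal a x) (vscal a y);
  vscal_distr_s : forall a b x, vscal (Cadd a b) x = vadd (vscal a x) (vscal b x);
  vnorm_nonneg : forall x, 0 <= vnorm x;
  vnorm_eq0 : forall x, vnorm x = 0 -> x = vzero;
  vnorm_scal : forall a x, vnorm (vscal a x) = Cmod a * vnorm x;
  vnorm_triangle : forall x y, vnorm (vadd x y) <= vnorm x + vnorm y;
  vcomplete : forall u : nat -> car,
    (forall eps, 0 < eps -> exists N, forall n p, (N <= n)%nat -> (N <= p)%nat ->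
        vnorm (vadd (u n) (vopp (u p))) < eps) ->
    exists l, forall eps, 0 < eps -> exists N, forall n, (N <= n)%nat ->
        vnorm (vadd (u n) (vopp l)) < eps
}.

Arguments vzero {c}. Arguments vadd {c}. Arguments vopp {c}.
Arguments vscal {c}. Arguments vnorm {c}.

Definition is_linear {X Y : CBanach} (f : X -> Y) : Prop :=
  (forall x y, f (vadd x y) = vadd (f x) (f y)) /\
  (forall a x, f (vscal a x) = vscal a (f x)).

Definition is_bounded {X Y : CBanach} (f : X -> Y) : Prop :=
  exists M, forall x, vnorm (f x) <= M * vnorm x.

Definition bounded_op {X Y : CBanach} (f : X -> Y) : Prop :=
  is_linear f /\ is_bounded f.

Fixpoint lin_comb {Y : CBanach} (l : list Y) (cs : list Cplx) : Y :=
  match l, cs with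
  | v :: l', c :: cs' => vadd (vscal c v) (lin_comb l' cs')
  | _, _ => vzero
  end.

Definition rank_le {X Y : CBanach} (n : nat) (f : X -> Y) : Prop :=
  exists l : list Y, length l = n /\
    forall x, exists cs : list Cplx, f x = lin_comb l cs.

Definition finite_rank {X Y : CBanach} (f : X -> Y) : Prop :=
  exists n, rank_le n f.

(* standard operator algebra: subalgebra of B(X) containing all finite rank
   operators (not assumed closed nor unital) *)
Definition standard_operator_algebra {X : CBanach} (A : (X -> X) -> Prop) : Prop :=
  (forall T, A T -> bounded_op T) /\
  (forall S T, A S -> A T -> A (fun x => vadd (S x) (T x))) /\
  (forall a T, A T -> A (fun x => vscal a (T x))) /\
  (forall S T, A S -> A T -> A (fun x => S (T x))) /\
  (forall F, bounded_op F -> finite_rank F -> A F).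

Definition spectrum {X : CBanach} (T : X -> X) (z : Cplx) : Prop :=
  ~ exists S : X -> X, bounded_op S /\
      (forall x, S (vadd (T x) (vopp (vscal z x))) = x) /\
      (forall x, vadd (T (S x)) (vopp (vscal z (S x))) = x).

Definition peripheral_spectrum {X : CBanach} (T : X -> X) (z : Cplx) : Prop :=
  spectrum T z /\
  (forall w, spectrum T w -> Cmod w <= Cmod z).

Definition gprod {X : CBanach} (s : list nat) (T : nat -> X -> X) : X -> X :=
  fold_right (fun i acc => fun x => T i (acc x)) (fun x => x) s.

Definition count_occ_nat (s : list nat) (j : nat) : nat :=
  length (filter (fun i => Nat.eqb i j) s).

Definition gen_product_seq (k : nat) (s : list nat) : Prop :=
  (forall i, In i s -> (1 <= i <= k)%nat) /\
  (forall j, (1 <= j <= k)%nat -> In j s) /\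
  (exists p, (p < length s)%nat /\ count_occ_nat s (nth p s 0%nat) = 1%nat).

(* generalized quasi-semi Jordan product: with p (0-based) the position of the
   term appearing exactly once, (i_{p+1},...,i_m,i_1,...,i_{p-1}) is a palindrome *)
Definition quasi_semi_jordan (s : list nat) : Prop :=
  exists p, (p < length s)%nat /\ count_occ_nat s (nth p s 0%nat) = 1%nat /\
    let t := skipn (S p) s ++ firstn p s in t = rev t.

Definition is_functional {X : CBanach} (f : X -> Cplx) : Prop :=
  (forall x y, f (vadd x y) = Cadd (f x) (f y)) /\
  (forall a x, f (vscal a x) = Cmul a (f x)) /\
  (exists M, forall x, Cmod (f x) <= M * vnorm x).

Definition dual_norm_le {X : CBanach} (f : X -> Cplx) (M : R) : Prop :=
  forall x, Cmod (f x) <= M * vnorm x.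

Definition reflexive (X : CBanach) : Prop :=
  forall F : (X -> Cplx) -> Cplx,
    (forall f g, is_functional f -> is_functional g ->
       F (fun x => Cadd (f x) (g x)) = Cadd (F f) (F g)) ->
    (forall a f, is_functional f -> F (fun x => Cmul a (f x)) = Cmul a (F f)) ->
    (exists M, forall f N, is_functional f -> dual_norm_le f N ->
       Cmod (F f) <= M * N) ->
    exists x : X, forall f, is_functional f -> F f = f x.

Definition invertible_from_dual {X1 X2 : CBanach}
    (T : (X1 -> Cplx) -> X2) (Tinv : X2 -> (X1 -> Cplx)) : Prop :=
  (forall f g, is_functional f -> is_functional g ->
     T (fun x => Cadd (f x) (g x)) = vadd (T f) (T g)) /\
  (forall a f, is_functional f -> T (fun x => Cmul a (f x)) = vscal a (T f)) /\
  (exists M, forall f N, is_functional f -> dual_norm_le f N ->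
     vnorm (T f) <= M * N) /\
  (forall y, is_functional (Tinv y)) /\
  (forall y1 y2, Tinv (vadd y1 y2) = (fun x => Cadd (Tinv y1 x) (Tinv y2 x))) /\
  (forall a y, Tinv (vscal a y) = (fun x => Cmul a (Tinv y x))) /\
  (exists M, forall y, dual_norm_le (Tinv y) (M * vnorm y)) /\
  (forall y, T (Tinv y) = y) /\
  (forall f, is_functional f -> Tinv (T f) = f).

Definition invertible_op {X1 X2 : CBanach} (T : X1 -> X2) (Tinv : X2 -> X1) : Prop :=
  bounded_op T /\ bounded_op Tinv /\
  (forall x, Tinv (T x) = x) /\ (forall y, T (Tinv y) = y).

(* Main.v *)
Require Import Defs.
From Stdlib Require Import Reals List Lra Lia Classical ClassicalEpsilon.
From Stdlib Require Import FunctionalExtensionality ProofIrrelevance.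
From Coquelicot Require Complex Compactness.
From mathcomp Require boolp classical_sets.
Open Scope R_scope.

(* Rotating cyclically changes no peripheral spectrum (nonzero spectra of [S T] and
   [T S] agree and spectra are not empty), so the hypothesis, applied with one
   operator [A] in the distinguished slot and one operator [B] in all others, says
   that [A B^(m-1)] and [Phi A (Phi B)^(m-1)] have the same peripheral spectrum.
   Operators [A] of rank at most one are those for which this set is a singleton
   for every [B], so [Phi] respects them in both directions.  For [B] of rank one
   the peripheral spectrum of [A B^(m-1)] is the single number
   [tr (A B) (tr B)^(m-2)]; such numbers separate operators and this forces [Phi]
   to be linear.  A linear map preserving rank one operators sends [x (x) f] to
   [T x (x) S f] or to [S f (x) T x].  Comparing traces, the pairing of [T x] and
   [S f] is [lam f(x)] with [lam^m = 1]; then [Phi A] intertwines [T] with [A], or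
   [S] with the adjoint of [A], and the uniform boundedness principle yields
   continuity.  In the second case surjectivity gives reflexivity, and testing on
   operators generating a free monoid shows that the word is a palindrome. *)

(** * Scalars and vectors *)

(** All test operators have rank at most two, since the range hypothesis supplies no others on the
    side of [X2]. Rank two is also enough to recognise an operator [A] of rank greater than one: a
    suitable [B] living on a plane gives [A B^(m-1)] the eigenvalues [c] and [-c], two peripheral
    points of equal modulus. With [B] of rank one the obstacle is the factor [(tr B)^(m-2)], which
    hides all information when the trace vanishes and [m > 2]; the identities are therefore obtained
    for pairs [x], [f] with [f x <> 0] and extended to all pairs by additivity. The traces alone
    determine the pairing of [T x] and [S f] only up to an [m]-th root of unity depending on the
    pair, and bilinearity is what makes this root constant. The zero space, where every spectrum is
    empty, has to be split off throughout. Operators and functionals are plain functions with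
    predicates; the dual is made into a [CBanach] so that the uniform boundedness principle applies
    to a map defined on functionals. *)

Definition Csub (a b : Cplx) : Cplx := Cadd a (Copp b).
Definition Cinv (a : Cplx) : Cplx :=
  (fst a / (fst a * fst a + snd a * snd a),
   - snd a / (fst a * fst a + snd a * snd a)).
Definition Cdiv (a b : Cplx) : Cplx := Cmul a (Cinv b).
Definition Creal (r : R) : Cplx := (r, 0).

Lemma Cplx_eq (a b : Cplx) : fst a = fst b -> snd a = snd b -> a = b.
Proof. destruct a, b; simpl; intros -> ->; reflexivity. Qed.

Lemma Cnorm2_neq0 (a : Cplx) : a <> Czero -> fst a * fst a + snd a * snd a <> 0.
Proof. intros H E; apply H; apply Cplx_eq; simpl; nra. Qed.

Lemma Cplx_field_theory :
  field_theory Czero Cone Cadd Cmul Csub Copp Cdiv Cinv (@eq Cplx).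
Proof.
constructor; [constructor | | |].
1-9: intros; unfold Csub; apply Cplx_eq; simpl; ring.
- intros E; injection E; lra.
- reflexivity.
- intros p Hp; apply Cnorm2_neq0 in Hp; apply Cplx_eq; simpl; field; exact Hp.
Qed.

Add Field Cplx_field : Cplx_field_theory.

Lemma Cmod_Complex (a : Cplx) : Cmod a = Complex.Cmod a.
Proof. unfold Cmod, Complex.Cmod; f_equal; ring. Qed.

Lemma Cmod_nonneg (a : Cplx) : 0 <= Cmod a.
Proof. apply sqrt_pos. Qed.

Lemma Cmod_mul (a b : Cplx) : Cmod (Cmul a b) = Cmod a * Cmod b.
Proof. rewrite !Cmod_Complex; exact (Complex.Cmod_mult a b). Qed.

Lemma Cmod_add (a b : Cplx) : Cmod (Cadd a b) <= Cmod a + Cmod b.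
Proof. rewrite !Cmod_Complex; exact (Complex.Cmod_triangle a b). Qed.

Lemma Cmod_opp (a : Cplx) : Cmod (Copp a) = Cmod a.
Proof. unfold Cmod; f_equal; simpl; ring. Qed.

Lemma Cmod_eq0 (a : Cplx) : Cmod a = 0 -> a = Czero.
Proof. rewrite Cmod_Complex; exact (Complex.Cmod_eq_0 a). Qed.

Lemma Cmod_Creal (r : R) : Cmod (Creal r) = Rabs r.
Proof.
unfold Cmod; simpl; rewrite <- sqrt_Rsqr_abs; f_equal; unfold Rsqr; ring.
Qed.

Lemma Cmod_zero : Cmod Czero = 0.
Proof. change Czero with (Creal 0); rewrite Cmod_Creal; apply Rabs_R0. Qed.

Lemma Cmod_one : Cmod Cone = 1.
Proof. change Cone with (Creal 1); rewrite Cmod_Creal; apply Rabs_R1. Qed.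

Lemma Cmod_pos (a : Cplx) : a <> Czero -> 0 < Cmod a.
Proof.
intros H; destruct (Cmod_nonneg a) as [|E]; [assumption|].
exfalso; apply H, Cmod_eq0; auto.
Qed.

Lemma Cmod_inv (a : Cplx) : a <> Czero -> Cmod (Cinv a) = / Cmod a.
Proof.
intros H; apply (Rmult_eq_reg_l (Cmod a)); [|apply Rgt_not_eq, Cmod_pos, H].
rewrite <- Cmod_mul, Rinv_r by (apply Rgt_not_eq, Cmod_pos, H).
replace (Cmul a (Cinv a)) with Cone by (field; exact H); apply Cmod_one.
Qed.

Lemma Cmod_pow (a : Cplx) (n : nat) : Cmod (Cpow a n) = Cmod a ^ n.
Proof.
induction n as [|n IH]; simpl; [apply Cmod_one|].
rewrite Cmod_mul, IH; reflexivity.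
Qed.

Lemma fst_le_Cmod (a : Cplx) : fst a <= Cmod a.
Proof.
unfold Cmod; apply Rle_trans with (Rabs (fst a)); [apply Rle_abs|].
rewrite <- sqrt_Rsqr_abs; apply sqrt_le_1_alt; unfold Rsqr; nra.
Qed.

Lemma abs_fst_le_Cmod (a : Cplx) : Rabs (fst a) <= Cmod a.
Proof.
unfold Cmod; rewrite <- sqrt_Rsqr_abs; apply sqrt_le_1_alt; unfold Rsqr; nra.
Qed.

Lemma snd_le_Cmod (a : Cplx) : Rabs (snd a) <= Cmod a.
Proof.
unfold Cmod; rewrite <- sqrt_Rsqr_abs; apply sqrt_le_1_alt; unfold Rsqr; nra.
Qed.

Lemma Cmod_le_abs (a : Cplx) : Cmod a <= Rabs (fst a) + Rabs (snd a).
Proof.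
replace a with (Cadd (Creal (fst a)) (Cmul (0, 1) (Creal (snd a)))) at 1
  by (apply Cplx_eq; simpl; ring).
eapply Rle_trans; [apply Cmod_add|]; rewrite Cmod_mul, !Cmod_Creal.
replace (Cmod (0, 1)) with 1; [lra|].
unfold Cmod; simpl; replace (0 * 0 + 1 * 1) with 1 by ring.
symmetry; apply sqrt_1.
Qed.

Lemma Cmul_eq0 (a b : Cplx) : Cmul a b = Czero -> a = Czero \/ b = Czero.
Proof.
intros H; destruct (classic (a = Czero)) as [|Ha]; [auto|right].
replace b with (Cmul (Cinv a) (Cmul a b)) by (field; exact Ha).
rewrite H; ring.
Qed.

Lemma Cone_neq0 : Cone <> Czero.
Proof. intros H; injection H; lra. Qed.

Lemma Csub_eq0 (a b : Cplx) : Cadd a (Copp b) = Czero -> a = b.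
Proof.
intros H; replace a with (Cadd (Cadd a (Copp b)) b) by ring; rewrite H; ring.
Qed.

Lemma Cpow_eq0 (a : Cplx) (n : nat) : Cpow a n = Czero -> a = Czero.
Proof.
induction n as [|n IH]; simpl; intros H; [destruct (Cone_neq0 H)|].
destruct (Cmul_eq0 _ _ H); auto.
Qed.

Lemma Cpow_mul (a b : Cplx) (n : nat) :
  Cpow (Cmul a b) n = Cmul (Cpow a n) (Cpow b n).
Proof. induction n as [|n IH]; simpl; [ring | rewrite IH; ring]. Qed.

Lemma Cpow_one (n : nat) : Cpow Cone n = Cone.
Proof. induction n as [|n IH]; simpl; [reflexivity | rewrite IH; ring]. Qed.

Lemma Cpow_zero (n : nat) : Cpow Czero (S n) = Czero.
Proof. simpl; ring. Qed.

Lemma Cpow_add (a : Cplx) (n p : nat) : Cpow a (n + p) = Cmul (Cpow a n) (Cpow a p).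
Proof. induction n as [|n IH]; simpl; [ring | rewrite IH; ring]. Qed.

Lemma Cpow_cis (t : R) (n : nat) :
  Cpow (cos t, sin t) n = (cos (INR n * t), sin (INR n * t)).
Proof.
induction n as [|n IH].
- simpl; rewrite Rmult_0_l, cos_0, sin_0; reflexivity.
- cbn [Cpow]; rewrite IH, S_INR, Rmult_plus_distr_r, Rmult_1_l, cos_plus, sin_plus.
  apply Cplx_eq; simpl; ring.
Qed.

Lemma Cpow_Creal (r : R) (n : nat) : Cpow (Creal r) n = Creal (r ^ n).
Proof.
induction n as [|n IH]; simpl; [reflexivity|].
rewrite IH; apply Cplx_eq; simpl; ring.
Qed.

Lemma unit_circle_angle (a b : R) :
  a * a + b * b = 1 -> exists t, cos t = a /\ sin t = b.
Proof.
intros H; assert (Ha : -1 <= a <= 1) by nra.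
assert (E : sin (acos a) = Rabs b).
{ rewrite sin_acos by exact Ha; rewrite <- sqrt_Rsqr_abs.
  f_equal; unfold Rsqr; lra. }
destruct (Rle_dec 0 b) as [Hb|Hb].
- exists (acos a); rewrite cos_acos, E, Rabs_right by lra; auto.
- exists (- acos a); rewrite cos_neg, sin_neg, cos_acos, E, Rabs_left by lra.
  split; ring.
Qed.

Lemma Croot (z : Cplx) (n : nat) : exists w, Cpow w (S n) = z.
Proof.
destruct (classic (z = Czero)) as [->|Hz].
{ exists Czero; apply Cpow_zero. }
pose proof (Cmod_pos z Hz) as Hr.
assert (Hr2 : Cmod z * Cmod z = fst z * fst z + snd z * snd z).
{ unfold Cmod; apply sqrt_sqrt; nra. }
destruct (unit_circle_angle (fst z / Cmod z) (snd z / Cmod z)) as [t [Hc Hs]].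
{ replace (_ + _) with ((fst z * fst z + snd z * snd z) / (Cmod z * Cmod z)).
  - rewrite <- Hr2; field; lra.
  - field; lra. }
exists (Cmul (Creal (Rpower (Cmod z) (/ INR (S n)))) (cos (t / INR (S n)), sin (t / INR (S n)))).
assert (Hn : INR (S n) <> 0) by (apply not_0_INR; discriminate).
rewrite Cpow_mul, Cpow_cis, Cpow_Creal, <- Rpower_pow by apply exp_pos.
rewrite Rpower_mult, Rinv_l, Rpower_1 by auto.
replace (INR (S n) * (t / INR (S n))) with t by (field; exact Hn).
rewrite Hc, Hs; apply Cplx_eq; simpl; field; lra.
Qed.

Notation "x +v y" := (vadd x y) (at level 50, left associativity).
Notation "x -v y" := (vadd x (vopp y)) (at level 50, left associativity).
Notation "a *v x" := (vscal a x) (at level 40, left associativity).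
Notation "a +c b" := (Cadd a b) (at level 50, left associativity).
Notation "a -c b" := (Cadd a (Copp b)) (at level 50, left associativity).
Notation "a *c b" := (Cmul a b) (at level 40, left associativity).

Lemma vadd_0l {X : CBanach} (x : X) : vzero +v x = x.
Proof. rewrite vadd_comm; apply vadd_zero. Qed.

Lemma vadd_reg_l {X : CBanach} (x y z : X) : x +v y = x +v z -> y = z.
Proof.
intros H; rewrite <- (vadd_0l y), <- (vadd_0l z), <- (vadd_opp _ x), (vadd_comm _ x).
rewrite <- !vadd_assoc, H; reflexivity.
Qed.

Lemma vscal_0l {X : CBanach} (x : X) : Czero *v x = vzero.
Proof.
apply (vadd_reg_l (Czero *v x)); rewrite <- vscal_distr_s, vadd_zero.
f_equal; ring.
Qed.

Lemma vscal_0r {X : CBanach} (a : Cplx) : a *v (@vzero X) = vzero.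
Proof.
apply (vadd_reg_l (a *v vzero)); rewrite <- vscal_distr_v, !vadd_zero; reflexivity.
Qed.

Lemma vopp_scal {X : CBanach} (x : X) : vopp x = Copp Cone *v x.
Proof.
apply (vadd_reg_l x); rewrite vadd_opp.
transitivity ((Cone +c Copp Cone) *v x).
- rewrite <- (vscal_0l x); f_equal; ring.
- rewrite vscal_distr_s, vscal_one; reflexivity.
Qed.

(* A reflexive normalisation: a vector expression is the linear combination of
   its atoms with the coefficients [vcoef], so that an identity between vectors
   reduces to ring identities between scalars. *)
Inductive vexp :=
  | VAtom (n : nat) | VZero | VAdd (a b : vexp) | VOpp (a : vexp)
  | VScal (c : Cplx) (a : vexp).

Fixpoint veval {X : CBanach} (env : list X) (e : vexp) : X :=
  match e with
  | VAtom n => nth n env vzero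
  | VZero => vzero
  | VAdd a b => veval env a +v veval env b
  | VOpp a => vopp (veval env a)
  | VScal c a => c *v veval env a
  end.

Fixpoint vcoef (e : vexp) (n : nat) : Cplx :=
  match e with
  | VAtom m => if Nat.eqb m n then Cone else Czero
  | VZero => Czero
  | VAdd a b => vcoef a n +c vcoef b n
  | VOpp a => Copp (vcoef a n)
  | VScal c a => c *c vcoef a n
  end.

Fixpoint vsum {X : CBanach} (env : list X) (f : nat -> Cplx) : X :=
  match env with
  | nil => vzero
  | x :: r => f O *v x +v vsum r (fun n => f (S n))
  end.

Fixpoint vagree (n : nat) (e1 e2 : vexp) : Prop :=
  match n with
  | O => True
  | S p => vcoef e1 p = vcoef e2 p /\ vagree p e1 e2
  end.

Lemma vsum_ext {X : CBanach} (env : list X) (f g : nat -> Cplx) :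
  (forall n, (n < length env)%nat -> f n = g n) -> vsum env f = vsum env g.
Proof.
revert f g; induction env as [|x r IH]; intros f g H; simpl in *; [reflexivity|].
rewrite (H O) by lia; f_equal; apply IH; intros n Hn; apply H; lia.
Qed.

Lemma vsum_zero {X : CBanach} (env : list X) : vsum env (fun _ => Czero) = vzero.
Proof.
induction env as [|x r IH]; simpl; [reflexivity|].
rewrite IH, vscal_0l, vadd_zero; reflexivity.
Qed.

Lemma vadd_swap {X : CBanach} (a b c d : X) :
  (a +v b) +v (c +v d) = (a +v c) +v (b +v d).
Proof.
rewrite <- !vadd_assoc; f_equal; rewrite !vadd_assoc; f_equal; apply vadd_comm.
Qed.

Lemma vsum_add {X : CBanach} (env : list X) (f g : nat -> Cplx) :
  vsum env f +v vsum env g = vsum env (fun n => f n +c g n).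
Proof.
revert f g; induction env as [|x r IH]; intros f g; simpl; [apply vadd_zero|].
rewrite vadd_swap, <- vscal_distr_s, IH; reflexivity.
Qed.

Lemma vsum_scal {X : CBanach} (env : list X) (c : Cplx) (f : nat -> Cplx) :
  c *v vsum env f = vsum env (fun n => c *c f n).
Proof.
revert f; induction env as [|x r IH]; intros f; simpl; [apply vscal_0r|].
rewrite vscal_distr_v, vscal_assoc, IH; reflexivity.
Qed.

Lemma vsum_atom {X : CBanach} (env : list X) (m : nat) :
  vsum env (fun n => if Nat.eqb m n then Cone else Czero) = nth m env vzero.
Proof.
revert m; induction env as [|x r IH]; intros [|m]; simpl; try reflexivity.
- rewrite vsum_zero, vscal_one; apply vadd_zero.
- rewrite vscal_0l, vadd_0l; apply IH.
Qed.

Lemma veval_vsum {X : CBanach} (env : list X) (e : vexp) :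
  veval env e = vsum env (vcoef e).
Proof.
induction e as [n| |a IHa b IHb|a IHa|c a IHa]; simpl.
- symmetry; apply vsum_atom.
- symmetry; apply vsum_zero.
- rewrite IHa, IHb; apply vsum_add.
- rewrite IHa, vopp_scal, vsum_scal; apply vsum_ext; intros; ring.
- rewrite IHa; apply vsum_scal.
Qed.

Lemma veval_agree {X : CBanach} (env : list X) (e1 e2 : vexp) :
  vagree (length env) e1 e2 -> veval env e1 = veval env e2.
Proof.
intros H; rewrite !veval_vsum; apply vsum_ext.
revert H; generalize (length env); intros n; induction n as [|n IH]; simpl; intros H p Hp;
  [lia|].
destruct H as [H1 H2]; destruct (Nat.eq_dec p n) as [->|]; [exact H1|].
apply IH; [exact H2|lia].
Qed.

Ltac vatom x env :=
  match env with
  | nil => constr:(x :: nil)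
  | x :: _ => env
  | ?y :: ?r => let r' := vatom x r in constr:(y :: r')
  end.

Ltac vatoms e env :=
  match e with
  | vadd ?a ?b => let env' := vatoms a env in vatoms b env'
  | vopp ?a => vatoms a env
  | vscal _ ?a => vatoms a env
  | vzero => env
  | _ => vatom e env
  end.

Ltac vindex x env :=
  match env with
  | x :: _ => constr:(O)
  | _ :: ?r => let n := vindex x r in constr:(S n)
  end.

Ltac vreify e env :=
  match e with
  | vadd ?a ?b =>
      let a' := vreify a env in let b' := vreify b env in constr:(VAdd a' b')
  | vopp ?a => let a' := vreify a env in constr:(VOpp a')
  | vscal ?c ?a => let a' := vreify a env in constr:(VScal c a')
  | vzero => constr:(VZero)
  | _ => let n := vindex e env in constr:(VAtom n)
  end.

Ltac vec_coefs :=
  match goal with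
  | |- @eq (car ?X) ?a ?b =>
      let env0 := vatoms a (@nil (car X)) in
      let env := vatoms b env0 in
      let ea := vreify a env in
      let eb := vreify b env in
      change (veval env ea = veval env eb);
      apply veval_agree;
      cbn [length vagree vcoef Nat.eqb];
      repeat apply conj; try exact I
  end.

Ltac vec := vec_coefs; ring.

Lemma lin_add {X Y : CBanach} {f : X -> Y} (H : is_linear f) (x y : X) :
  f (x +v y) = f x +v f y.
Proof. apply H. Qed.

Lemma lin_scal {X Y : CBanach} {f : X -> Y} (H : is_linear f) (a : Cplx) (x : X) :
  f (a *v x) = a *v f x.
Proof. apply H. Qed.

Lemma lin_zero {X Y : CBanach} {f : X -> Y} (H : is_linear f) : f vzero = vzero.
Proof. rewrite <- (vscal_0l vzero), (lin_scal H); apply vscal_0l. Qed.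

Lemma lin_opp {X Y : CBanach} {f : X -> Y} (H : is_linear f) (x : X) :
  f (vopp x) = vopp (f x).
Proof. rewrite !vopp_scal; apply (lin_scal H). Qed.

Lemma fun_add {X : CBanach} {f : X -> Cplx} (H : is_functional f) (x y : X) :
  f (x +v y) = f x +c f y.
Proof. apply H. Qed.

Lemma fun_scal {X : CBanach} {f : X -> Cplx} (H : is_functional f) (a : Cplx) (x : X) :
  f (a *v x) = a *c f x.
Proof. apply H. Qed.

Lemma fun_zero {X : CBanach} {f : X -> Cplx} (H : is_functional f) : f vzero = Czero.
Proof. rewrite <- (vscal_0l vzero), (fun_scal H); ring. Qed.

Lemma fun_opp {X : CBanach} {f : X -> Cplx} (H : is_functional f) (x : X) :
  f (vopp x) = Copp (f x).
Proof. rewrite vopp_scal, (fun_scal H); ring. Qed.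

Ltac linpush :=
  repeat match goal with
  | H : is_linear ?f |- context [?f (vadd ?a ?b)] => rewrite (lin_add H a b)
  | H : is_linear ?f |- context [?f (vscal ?a ?b)] => rewrite (lin_scal H a b)
  | H : is_linear ?f |- context [?f (vopp ?a)] => rewrite (lin_opp H a)
  | H : is_linear ?f |- context [?f vzero] => rewrite (lin_zero H)
  | H : bounded_op ?f |- context [?f (vadd ?a ?b)] => rewrite (lin_add (proj1 H) a b)
  | H : bounded_op ?f |- context [?f (vscal ?a ?b)] => rewrite (lin_scal (proj1 H) a b)
  | H : bounded_op ?f |- context [?f (vopp ?a)] => rewrite (lin_opp (proj1 H) a)
  | H : bounded_op ?f |- context [?f vzero] => rewrite (lin_zero (proj1 H))
  | H : is_functional ?f |- context [?f (vadd ?a ?b)] => rewrite (fun_add H a b)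
  | H : is_functional ?f |- context [?f (vscal ?a ?b)] => rewrite (fun_scal H a b)
  | H : is_functional ?f |- context [?f (vopp ?a)] => rewrite (fun_opp H a)
  | H : is_functional ?f |- context [?f vzero] => rewrite (fun_zero H)
  end.

Lemma vsub_eq0 {X : CBanach} (x y : X) : x -v y = vzero -> x = y.
Proof. intros H; replace x with ((x -v y) +v y) by vec; rewrite H; vec. Qed.

Lemma vnorm_zero {X : CBanach} : vnorm (@vzero X) = 0.
Proof. rewrite <- (vscal_0l vzero), vnorm_scal, Cmod_zero; ring. Qed.

Lemma vnorm_opp {X : CBanach} (x : X) : vnorm (vopp x) = vnorm x.
Proof. rewrite vopp_scal, vnorm_scal, Cmod_opp, Cmod_one; ring. Qed.

Lemma vnorm_sub_sym {X : CBanach} (x y : X) : vnorm (x -v y) = vnorm (y -v x).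
Proof. rewrite <- vnorm_opp; f_equal; vec. Qed.

Lemma vnorm_sub_le {X : CBanach} (x y : X) : vnorm (x -v y) <= vnorm x + vnorm y.
Proof. rewrite <- (vnorm_opp y); apply vnorm_triangle. Qed.

Lemma vnorm_pos {X : CBanach} (x : X) : x <> vzero -> 0 < vnorm x.
Proof.
intros H; destruct (vnorm_nonneg _ x) as [|E]; [assumption|].
exfalso; apply H, vnorm_eq0; auto.
Qed.

Lemma vscal_eq0 {X : CBanach} (a : Cplx) (x : X) :
  a *v x = vzero -> a = Czero \/ x = vzero.
Proof.
intros H; destruct (classic (a = Czero)) as [|Ha]; [auto|right].
replace x with (Cinv a *v (a *v x)); [rewrite H; apply vscal_0r|].
vec_coefs; field; exact Ha.
Qed.

(** * Hahn-Banach and uniform boundedness *)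

(** Chosen by [epsilon] to be total, so that infima can enter definitions without proofs that the
    set is nonempty and bounded below. Only [Rinf_spec] gives it meaning. *)
Definition Rinf (E : R -> Prop) : R :=
  epsilon (inhabits 0)
    (fun m => (forall e, E e -> m <= e) /\
              (forall b, (forall e, E e -> b <= e) -> b <= m)).

Lemma Rinf_spec (E : R -> Prop) (e0 b0 : R) :
  E e0 -> (forall e, E e -> b0 <= e) ->
  (forall e, E e -> Rinf E <= e) /\
  (forall b, (forall e, E e -> b <= e) -> b <= Rinf E).
Proof.
intros He Hb; unfold Rinf; apply epsilon_spec.
destruct (completeness (fun x => E (- x))) as [m [Hm1 Hm2]].
- exists (- b0); intros x Hx; specialize (Hb _ Hx); lra.
- exists (- e0); rewrite Ropp_involutive; exact He.
- exists (- m); split.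
  + intros e H; cut (- e <= m); [lra|].
    apply Hm1; rewrite Ropp_involutive; exact H.
  + intros b H; cut (m <= - b); [lra|].
    apply Hm2; intros x Hx; specialize (H _ Hx); lra.
Qed.

(** The space is regarded as a real one here: functionals are first made linear over the reals and
    complexified afterwards. *)
Definition sublinear {X : CBanach} (q : X -> R) : Prop :=
  (forall x y, q (x +v y) <= q x + q y) /\
  (forall t x, 0 <= t -> q (Creal t *v x) = t * q x).

Lemma Creal_scal_zero {X : CBanach} (x : X) : Creal 0 *v x = vzero.
Proof. apply vscal_0l. Qed.

Lemma Creal_scal_one {X : CBanach} (x : X) : Creal 1 *v x = x.
Proof. apply vscal_one. Qed.

Lemma sublinear_zero {X : CBanach} (q : X -> R) : sublinear q -> q vzero = 0.
Proof.
intros [_ H]; rewrite <- (Creal_scal_zero vzero), H by lra; ring.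
Qed.

Lemma sublinear_opp {X : CBanach} (q : X -> R) (x : X) :
  sublinear q -> - q (vopp x) <= q x.
Proof.
intros H; pose proof (proj1 H x (vopp x)) as H1.
rewrite vadd_opp, (sublinear_zero q H) in H1; lra.
Qed.

Lemma sublinear_norm {X : CBanach} : sublinear (@vnorm X).
Proof.
split; [apply vnorm_triangle|].
intros t x Ht; rewrite vnorm_scal, Cmod_Creal, Rabs_right by lra; reflexivity.
Qed.

(* The largest sublinear minorant [s] of [q] with [s (- y) <= - q y]. *)
Definition sublinear_shift {X : CBanach} (q : X -> R) (y x : X) : R :=
  Rinf (fun r => exists t, 0 <= t /\ r = q (x +v Creal t *v y) - t * q y).

Lemma sublinear_shift_spec {X : CBanach} (q : X -> R) (y x : X) :
  sublinear q ->
  (forall t, 0 <= t -> sublinear_shift q y x <= q (x +v Creal t *v y) - t * q y) /\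
  (forall b, (forall t, 0 <= t -> b <= q (x +v Creal t *v y) - t * q y) ->
     b <= sublinear_shift q y x).
Proof.
intros Hq.
destruct (Rinf_spec (fun r => exists t, 0 <= t /\ r = q (x +v Creal t *v y) - t * q y)
            (q (x +v Creal 0 *v y) - 0 * q y) (- q (vopp x))) as [H1 H2].
- exists 0; split; [lra|reflexivity].
- intros e [t [Ht ->]]; rewrite <- (proj2 Hq) by exact Ht.
  pose proof (proj1 Hq (x +v Creal t *v y) (vopp x)) as H.
  replace ((x +v Creal t *v y) +v vopp x) with (Creal t *v y) in H by vec; lra.
- split; [intros t Ht; apply H1; exists t; auto|].
  intros b Hb; apply H2; intros e [t [Ht ->]]; auto.
Qed.

Lemma sublinear_shift_sublinear {X : CBanach} (q : X -> R) (y : X) :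
  sublinear q -> sublinear (sublinear_shift q y).
Proof.
intros Hq; split.
- intros x x'.
  destruct (sublinear_shift_spec q y x Hq) as [A1 A2].
  destruct (sublinear_shift_spec q y x' Hq) as [B1 B2].
  destruct (sublinear_shift_spec q y (x +v x') Hq) as [C1 _].
  cut (sublinear_shift q y (x +v x') - sublinear_shift q y x' <= sublinear_shift q y x);
    [lra|].
  apply A2; intros t Ht.
  cut (sublinear_shift q y (x +v x') - (q (x +v Creal t *v y) - t * q y)
         <= sublinear_shift q y x'); [lra|].
  apply B2; intros t' Ht'.
  specialize (C1 (t + t') ltac:(lra)).
  pose proof (proj1 Hq (x +v Creal t *v y) (x' +v Creal t' *v y)) as H.
  replace ((x +v Creal t *v y) +v (x' +v Creal t' *v y))
    with ((x +v x') +v Creal (t + t') *v y) in H; [lra|].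
  replace (Creal (t + t')) with (Creal t +c Creal t') by (apply Cplx_eq; simpl; ring).
  vec.
- intros s x Hs.
  destruct (sublinear_shift_spec q y x Hq) as [A1 A2].
  destruct (sublinear_shift_spec q y (Creal s *v x) Hq) as [B1 B2].
  destruct (Req_dec s 0) as [->|Hs0].
  + rewrite Rmult_0_l; apply Rle_antisym.
    * specialize (B1 0 ltac:(lra)); rewrite !Creal_scal_zero, vadd_zero in B1.
      rewrite (sublinear_zero q Hq) in B1; rewrite Creal_scal_zero; lra.
    * apply B2; intros t Ht; rewrite Creal_scal_zero, vadd_0l, (proj2 Hq) by exact Ht.
      lra.
  + assert (E : forall t, 0 <= t -> q (Creal s *v x +v Creal (s * t) *v y)
                                    = s * q (x +v Creal t *v y)).
    { intros t Ht; rewrite <- (proj2 Hq) by exact Hs; f_equal.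
      replace (Creal (s * t)) with (Creal s *c Creal t) by (apply Cplx_eq; simpl; ring).
      vec. }
    apply Rle_antisym.
    * apply Rmult_le_reg_l with (/ s); [apply Rinv_0_lt_compat; lra|].
      rewrite <- Rmult_assoc, Rinv_l, Rmult_1_l by exact Hs0.
      apply A2; intros t Ht; apply Rmult_le_reg_l with s; [lra|].
      rewrite <- Rmult_assoc, Rinv_r, Rmult_1_l by exact Hs0.
      specialize (B1 (s * t) ltac:(nra)); rewrite E in B1 by exact Ht; lra.
    * apply B2; intros t Ht.
      assert (Ht' : 0 <= t / s) by (apply Rmult_le_pos; [lra | left; apply Rinv_0_lt_compat; lra]).
      specialize (A1 (t / s) Ht').
      replace t with (s * (t / s)) by (field; exact Hs0); rewrite E by exact Ht'.
      nra.
Qed.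

Lemma sublinear_shift_le {X : CBanach} (q : X -> R) (y x : X) :
  sublinear q -> sublinear_shift q y x <= q x.
Proof.
intros Hq; destruct (sublinear_shift_spec q y x Hq) as [H _].
specialize (H 0 ltac:(lra)); rewrite Creal_scal_zero, vadd_zero in H; lra.
Qed.

(** Zorn's lemma for the reversed pointwise order. A chain is bounded by its pointwise infimum,
    which is finite because a sublinear [q] below [p] satisfies [q x >= - p (- x)]. *)
Lemma minimal_sublinear {X : CBanach} (p : X -> R) :
  sublinear p ->
  exists q, sublinear q /\ (forall x, q x <= p x) /\
    forall q', sublinear q' -> (forall x, q' x <= q x) -> q' = q.
Proof.
intros Hp.
pose (T := {q : X -> R | sublinear q /\ forall x, q x <= p x}).
pose (rel := fun s t : T => boolp.asbool (forall x, proj1_sig t x <= proj1_sig s x)).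
assert (relP : forall s t, is_true (rel s t) <-> forall x, proj1_sig t x <= proj1_sig s x).
{ intros s t; unfold rel; rewrite boolp.asboolE; reflexivity. }
destruct (classical_sets.Zorn (T := T) (R := rel)) as [m Hm].
- intros s; apply relP; intros; lra.
- intros r s t H1 H2; apply relP; intros x.
  apply Rle_trans with (proj1_sig s x); apply relP; assumption.
- intros [s Hs] [t Ht] H1 H2; rewrite relP in H1, H2; simpl in H1, H2.
  assert (E : s = t) by (apply functional_extensionality; intros x; apply Rle_antisym; auto).
  subst t; f_equal; apply proof_irrelevance.
- intros A HA; destruct (classic (exists s, A s)) as [[s0 Hs0]|Hempty].
  2: { exists (exist _ p (conj Hp (fun x => Rle_refl (p x)))).
       intros s Hs; exfalso; apply Hempty; exists s; exact Hs. }
  pose (q := fun x => Rinf (fun r => exists s : T, A s /\ r = proj1_sig s x)).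
  assert (Hq : forall x, (forall s, A s -> q x <= proj1_sig s x) /\
     (forall b, (forall s, A s -> b <= proj1_sig s x) -> b <= q x)).
  { intros x.
    destruct (Rinf_spec (fun r => exists s : T, A s /\ r = proj1_sig s x)
                (proj1_sig s0 x) (- p (vopp x))) as [H1 H2].
    - exists s0; auto.
    - intros e [s [Hs ->]].
      destruct (proj2_sig s) as [Hs1 Hs2].
      pose proof (sublinear_opp _ x Hs1); specialize (Hs2 (vopp x)); lra.
    - split; [intros s Hs; apply H1; exists s; auto|].
      intros b Hb; apply H2; intros e [s [Hs ->]]; auto. }
  assert (Hsub : sublinear q).
  { split.
    - intros x y.
      cut (q (x +v y) - q y <= q x); [lra|]; apply Hq; intros s Hs.
      cut (q (x +v y) - proj1_sig s x <= q y); [lra|]; apply Hq; intros s' Hs'.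
      (* The smaller of the two members of the chain is subadditive and lies below both, which
         bounds [q (x + y)] by [s x + s' y]. *)
      destruct (HA s s' Hs Hs') as [H|H]; rewrite relP in H.
      + pose proof (proj1 (Hq (x +v y)) s' Hs').
        pose proof (proj1 (proj1 (proj2_sig s')) x y); specialize (H x); lra.
      + pose proof (proj1 (Hq (x +v y)) s Hs).
        pose proof (proj1 (proj1 (proj2_sig s)) x y); specialize (H y); lra.
    - intros t x Ht; destruct (Req_dec t 0) as [->|Ht0].
      + rewrite Creal_scal_zero, Rmult_0_l; apply Rle_antisym.
        * rewrite <- (sublinear_zero _ (proj1 (proj2_sig s0))); apply Hq; exact Hs0.
        * apply Hq; intros s Hs; rewrite (sublinear_zero _ (proj1 (proj2_sig s))); lra.
      + apply Rle_antisym.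
        * apply Rmult_le_reg_l with (/ t); [apply Rinv_0_lt_compat; lra|].
          rewrite <- Rmult_assoc, Rinv_l, Rmult_1_l by exact Ht0.
          apply Hq; intros s Hs; apply Rmult_le_reg_l with t; [lra|].
          rewrite <- Rmult_assoc, Rinv_r, Rmult_1_l by exact Ht0.
          rewrite <- (proj2 (proj1 (proj2_sig s))) by exact Ht; apply Hq; exact Hs.
        * apply Hq; intros s Hs; rewrite (proj2 (proj1 (proj2_sig s))) by exact Ht.
          apply Rmult_le_compat_l; [exact Ht|]; apply Hq; exact Hs. }
  assert (Hle : forall x, q x <= p x).
  { intros x; apply Rle_trans with (proj1_sig s0 x); [apply Hq; exact Hs0|].
    apply (proj2_sig s0). }
  exists (exist _ q (conj Hsub Hle)); intros s Hs; apply relP; intros x; apply Hq; exact Hs.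
- exists (proj1_sig m); destruct (proj2_sig m) as [H1 H2]; split; [exact H1|].
  split; [exact H2|]; intros q' Hq' Hle.
  assert (Hle' : forall x, q' x <= p x)
    by (intros x; apply Rle_trans with (proj1_sig m x); auto).
  rewrite <- (Hm (exist _ q' (conj Hq' Hle'))); [reflexivity|].
  apply relP; exact Hle.
Qed.

(* A minimal sublinear functional coincides with all its shifts, hence it is
   superadditive as well. *)
Lemma minimal_sublinear_additive {X : CBanach} (q : X -> R) :
  sublinear q ->
  (forall q', sublinear q' -> (forall x, q' x <= q x) -> q' = q) ->
  (forall x y, q (x +v y) = q x + q y) /\
  (forall t x, q (Creal t *v x) = t * q x).
Proof.
intros Hq Hmin.
assert (Hadd : forall x y, q (x +v y) = q x + q y).
{ intros x y; apply Rle_antisym; [apply Hq|].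
  assert (E : sublinear_shift q y = q).
  { apply Hmin; [apply sublinear_shift_sublinear, Hq|].
    intros z; apply sublinear_shift_le, Hq. }
  destruct (sublinear_shift_spec q y x Hq) as [H _].
  specialize (H 1 ltac:(lra)); rewrite E, Creal_scal_one in H; lra. }
split; [exact Hadd|]; intros t x.
destruct (Rle_dec 0 t) as [Ht|Ht]; [apply Hq, Ht|].
assert (E : q (Creal t *v x) + q (Creal (- t) *v x) = 0).
{ rewrite <- Hadd, <- vscal_distr_s, <- (sublinear_zero q Hq); f_equal.
  rewrite <- (vscal_0l x); f_equal; apply Cplx_eq; simpl; ring. }
rewrite (proj2 Hq (- t)) in E by lra; lra.
Qed.

(** Starting from the shift of the norm at [x0] forces [q (- x0) <= - vnorm x0], so a minimal
    minorant, being additive, attains the norm at [x0]. No functional is extended from a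
    subspace. *)
Theorem hahn_banach {X : CBanach} (x0 : X) :
  exists f : X -> Cplx, is_functional f /\
    (forall x, Cmod (f x) <= vnorm x) /\ vnorm x0 <= Cmod (f x0).
Proof.
destruct (minimal_sublinear (sublinear_shift vnorm x0)
  (sublinear_shift_sublinear _ x0 sublinear_norm)) as [q [Hq [Hle Hmin]]].
destruct (minimal_sublinear_additive q Hq Hmin) as [Hadd Hscal].
assert (Hnorm : forall x, q x <= vnorm x).
{ intros x; apply Rle_trans with (1 := Hle x).
  apply sublinear_shift_le, sublinear_norm. }
assert (Hx0 : vnorm x0 <= q x0).
{ pose proof (proj1 (sublinear_shift_spec vnorm x0 (Creal (-1) *v x0) sublinear_norm) 1
    ltac:(lra)) as H.
  specialize (Hle (Creal (-1) *v x0)); rewrite Hscal in Hle.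
  rewrite <- vscal_distr_s in H.
  replace (Creal (-1) +c Creal 1) with Czero in H by (apply Cplx_eq; simpl; ring).
  rewrite vscal_0l, vnorm_zero in H; lra. }
(* The only complex linear functional whose real part is [q]. *)
pose (f := fun x : X => (q x, - q ((0, 1) *v x)) : Cplx).
assert (Hdec : forall u v x, q ((u, v) *v x) = u * q x + v * q ((0, 1) *v x)).
{ intros u v x; rewrite <- !Hscal, <- Hadd; f_equal.
  replace (u, v) with (Creal u +c Creal v *c (0, 1)) by (apply Cplx_eq; simpl; ring).
  vec. }
assert (Hfs : forall a x, f (a *v x) = a *c f x).
{ intros [u v] x; unfold f; rewrite vscal_assoc.
  replace ((0, 1) *c (u, v)) with (- v, u) by (apply Cplx_eq; simpl; ring).
  rewrite (Hdec u v), (Hdec (- v) u); apply Cplx_eq; simpl; ring. }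
assert (Hf : forall x, Cmod (f x) <= vnorm x).
{ intros x; destruct (classic (f x = Czero)) as [->|Hfx].
  { rewrite Cmod_zero; apply vnorm_nonneg. }
  pose proof (Cmod_pos _ Hfx) as Hpos.
  (* Multiplying [x] by the unimodular [c] makes the value of [f] real without changing the norm,
     and the real part of [f] is already bounded by the norm. *)
  pose (c := Creal (Cmod (f x)) *c Cinv (f x)).
  assert (Hc : Cmod c = 1).
  { unfold c; rewrite Cmod_mul, Cmod_inv, Cmod_Creal by exact Hfx.
    rewrite Rabs_right by lra; field; lra. }
  assert (E : f (c *v x) = Creal (Cmod (f x))).
  { rewrite Hfs; unfold c; field; exact Hfx. }
  apply (f_equal fst) in E; simpl in E; rewrite <- E.
  apply Rle_trans with (1 := Hnorm _); rewrite vnorm_scal, Hc; lra. }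
exists f; split; [split; [|split]|split].
- intros x y; unfold f; rewrite vscal_distr_v, !Hadd; apply Cplx_eq; simpl; ring.
- exact Hfs.
- exists 1; intros x; rewrite Rmult_1_l; apply Hf.
- exact Hf.
- apply Rle_trans with (1 := Hx0); exact (fst_le_Cmod (f x0)).
Qed.

Lemma functional_sep {X : CBanach} (x y : X) :
  (forall f, is_functional f -> f x = f y) -> x = y.
Proof.
intros H; apply vsub_eq0, vnorm_eq0, Rle_antisym; [|apply vnorm_nonneg].
destruct (hahn_banach (x -v y)) as [f [Hf [_ Hle]]].
rewrite (fun_add Hf), (fun_opp Hf), (H f Hf) in Hle.
replace (f y -c f y) with Czero in Hle by ring; rewrite Cmod_zero in Hle; exact Hle.
Qed.

Lemma is_functional_scal {X : CBanach} (a : Cplx) (f : X -> Cplx) :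
  is_functional f -> is_functional (fun x => a *c f x).
Proof.
intros Hf; split; [|split].
- intros x y; linpush; ring.
- intros b x; linpush; ring.
- destruct Hf as [_ [_ [M HM]]]; exists (Cmod a * M); intros x.
  rewrite Cmod_mul, Rmult_assoc; apply Rmult_le_compat_l; [apply Cmod_nonneg|apply HM].
Qed.

Lemma is_functional_add {X : CBanach} (f g : X -> Cplx) :
  is_functional f -> is_functional g -> is_functional (fun x => f x +c g x).
Proof.
intros Hf Hg; split; [|split].
- intros x y; linpush; ring.
- intros b x; linpush; ring.
- destruct Hf as [_ [_ [M HM]]], Hg as [_ [_ [N HN]]]; exists (M + N); intros x.
  apply Rle_trans with (1 := Cmod_add _ _); specialize (HM x); specialize (HN x); lra.
Qed.

Lemma is_functional_zero {X : CBanach} : is_functional (fun _ : X => Czero).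
Proof.
split; [intros; ring|split; [intros; ring|]].
exists 0; intros; rewrite Cmod_zero; lra.
Qed.

Lemma functional_one {X : CBanach} (x : X) :
  x <> vzero -> exists f, is_functional f /\ f x = Cone.
Proof.
intros Hx; destruct (hahn_banach x) as [f [Hf [_ Hle]]].
assert (H : f x <> Czero).
{ intros E; rewrite E, Cmod_zero in Hle; pose proof (vnorm_pos x Hx); lra. }
exists (fun y => Cinv (f x) *c f y); split; [apply is_functional_scal, Hf|].
field; exact H.
Qed.

Lemma functional_bound_norm {X : CBanach} (x : X) (c : R) :
  (forall f, is_functional f -> (forall y, Cmod (f y) <= vnorm y) -> Cmod (f x) <= c) ->
  vnorm x <= c.
Proof.
intros H; destruct (hahn_banach x) as [f [Hf [Hf1 Hle]]].
apply Rle_trans with (1 := Hle); apply H; assumption.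
Qed.

Section UniformBoundedness.
Context {X : CBanach} {I : Type} (F : I -> X -> Cplx).
Hypothesis HF : forall i, is_functional (F i).

Lemma not_bounded_on_ball (x : X) (r C : R) :
  ~ (exists M, forall i y, Cmod (F i y) <= M * vnorm y) -> 0 < r ->
  exists i y, vnorm (y -v x) < r /\ C < Cmod (F i y).
Proof.
intros Hunb Hr; apply NNPP; intros Hno; apply Hunb.
assert (Hb : forall i y, vnorm (y -v x) < r -> Cmod (F i y) <= C).
{ intros i y Hy; apply Rnot_lt_le; intros H; apply Hno; exists i, y; auto. }
(* The values at [x + a y] and at [x] differ by at most [2 * C], where [a * vnorm y = r / 2]. *)
exists (4 * C / r); intros i y; pose proof (HF i) as Hi.
destruct (classic (y = vzero)) as [->|Hy].
{ linpush; rewrite vnorm_zero, Cmod_zero; lra. }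
apply vnorm_pos in Hy.
pose (a := r / (2 * vnorm y)).
assert (Ha : 0 < a) by (apply Rdiv_lt_0_compat; lra).
assert (H1 : Cmod (F i (x +v Creal a *v y)) <= C).
{ apply Hb; replace ((x +v Creal a *v y) -v x) with (Creal a *v y) by vec.
  rewrite vnorm_scal, Cmod_Creal, Rabs_right by lra.
  replace (a * vnorm y) with (r / 2) by (unfold a; field; lra); lra. }
assert (H2 : Cmod (F i x) <= C).
{ apply Hb; rewrite vadd_opp, vnorm_zero; exact Hr. }
assert (H3 : a * Cmod (F i y) <= 2 * C).
{ rewrite <- (Rabs_right a), <- Cmod_Creal, <- Cmod_mul by lra.
  replace (Creal a *c F i y) with (F i (x +v Creal a *v y) -c F i x)
    by (linpush; ring).
  apply Rle_trans with (1 := Cmod_add _ _); rewrite Cmod_opp; lra. }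
apply Rmult_le_reg_l with (1 := Ha); apply Rle_trans with (1 := H3).
right; unfold a; field; lra.
Qed.

(** A value above [C + 1] at a centre stays above [C] on a small ball because [F i] is continuous.
    Halving the radius makes an iteration of this step converge. *)
Lemma large_on_subball (x : X) (r C : R) :
  ~ (exists M, forall i y, Cmod (F i y) <= M * vnorm y) -> 0 < r ->
  exists i y s, 0 < s /\ s <= r / 2 /\ vnorm (y -v x) + s <= r /\
    forall z, vnorm (z -v y) <= s -> C <= Cmod (F i z).
Proof.
intros Hunb Hr; destruct (not_bounded_on_ball x r (C + 1) Hunb Hr) as [i [y [Hy HC]]].
pose proof (HF i) as Hi; destruct (proj2 (proj2 Hi)) as [M HM].
assert (HM' : forall z, Cmod (F i z) <= (Rabs M + 1) * vnorm z).
{ intros z; apply Rle_trans with (1 := HM z); apply Rmult_le_compat_r;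
    [apply vnorm_nonneg|]; pose proof (Rle_abs M); lra. }
pose proof (Rabs_pos M) as HM0.
pose (s := Rmin (r / 2) (Rmin (r - vnorm (y -v x)) (/ (Rabs M + 1)))).
assert (Hs : 0 < s).
{ unfold s; repeat apply Rmin_glb_lt; try lra; apply Rinv_0_lt_compat; lra. }
assert (Hs1 : s <= r - vnorm (y -v x))
  by (unfold s; eapply Rle_trans; [apply Rmin_r|apply Rmin_l]).
assert (Hs2 : s <= / (Rabs M + 1))
  by (unfold s; eapply Rle_trans; [apply Rmin_r|apply Rmin_r]).
exists i, y, s; split; [exact Hs|split; [apply Rmin_l|split; [lra|]]].
intros z Hz.
assert (H : Cmod (F i (z -v y)) <= 1).
{ apply Rle_trans with (1 := HM' _).
  apply Rle_trans with ((Rabs M + 1) * / (Rabs M + 1)); [|right; field; lra].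
  apply Rmult_le_compat_l; lra. }
cut (Cmod (F i y) <= Cmod (F i z) + 1); [lra|].
apply Rle_trans with (Cmod (F i z) + Cmod (F i (z -v y))); [|lra].
replace (F i y) with (F i z -c F i (z -v y)) by (linpush; ring).
rewrite <- (Cmod_opp (F i (z -v y))); apply Cmod_add.
Qed.

(** Nested balls take the place of Baire's theorem: on the closed ball of index [n + 1] some [F i]
    has modulus at least [n], so the family is unbounded at the common point of all the balls. *)
Theorem uniform_boundedness :
  (forall x, exists C, forall i, Cmod (F i x) <= C) ->
  exists M, forall i x, Cmod (F i x) <= M * vnorm x.
Proof.
intros Hpt; apply NNPP; intros Hunb.
(* The condition [0 < snd b] stands inside the existential so that a total successor function on
   pairs can be chosen. *)
assert (Hstep : forall n (b : X * R), exists b' : X * R, 0 < snd b ->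
  0 < snd b' /\ snd b' <= snd b / 2 /\ vnorm (fst b' -v fst b) + snd b' <= snd b /\
  exists i, forall z, vnorm (z -v fst b') <= snd b' -> INR n <= Cmod (F i z)).
{ intros n [x r]; destruct (Rlt_dec 0 r) as [Hr|Hr].
  - destruct (large_on_subball x r (INR n) Hunb Hr) as [i [y [s [H1 [H2 [H3 H4]]]]]].
    exists (y, s); intros _; simpl; repeat split; auto; exists i; exact H4.
  - exists (x, r); simpl; intros; contradiction. }
pose (nxt := fun n b => epsilon (inhabits ((vzero, 0) : X * R)) (fun b' => 0 < snd b ->
  0 < snd b' /\ snd b' <= snd b / 2 /\ vnorm (fst b' -v fst b) + snd b' <= snd b /\
  exists i, forall z, vnorm (z -v fst b') <= snd b' -> INR n <= Cmod (F i z))).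
assert (Hnxt : forall n b, 0 < snd b ->
  0 < snd (nxt n b) /\ snd (nxt n b) <= snd b / 2 /\
  vnorm (fst (nxt n b) -v fst b) + snd (nxt n b) <= snd b /\
  exists i, forall z, vnorm (z -v fst (nxt n b)) <= snd (nxt n b) -> INR n <= Cmod (F i z))
  by (intros n b; unfold nxt; exact (epsilon_spec _ _ (Hstep n b))).
pose (ball := fix ball n := match n with
  | O => ((vzero, 1) : X * R) | S p => nxt p (ball p) end).
assert (Hpos : forall n, 0 < snd (ball n)).
{ induction n; simpl; [lra|apply Hnxt, IHn]. }
assert (Hsmall : forall n, snd (ball n) <= (/ 2) ^ n).
{ induction n; simpl; [lra|].
  destruct (Hnxt n (ball n) (Hpos n)) as [_ [H _]]; lra. }
assert (Hnest : forall n d,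
  vnorm (fst (ball (d + n)%nat) -v fst (ball n)) + snd (ball (d + n)%nat) <= snd (ball n)).
{ intros n; induction d as [|d IH].
  - simpl; rewrite vadd_opp, vnorm_zero; lra.
  - destruct (Hnxt (d + n)%nat (ball (d + n)%nat) (Hpos _)) as [_ [_ [H _]]].
    change (nxt (d + n)%nat (ball (d + n)%nat)) with (ball (S d + n)%nat) in H.
    pose proof (vnorm_triangle _ (fst (ball (S d + n)%nat) -v fst (ball (d + n)%nat))
      (fst (ball (d + n)%nat) -v fst (ball n))) as Ht.
    replace (fst (ball (S d + n)%nat) -v fst (ball n)) with
      ((fst (ball (S d + n)%nat) -v fst (ball (d + n)%nat)) +v
       (fst (ball (d + n)%nat) -v fst (ball n))) by vec.
    lra. }
destruct (vcomplete X (fun n => fst (ball n))) as [l Hl].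
{ intros eps Heps.
  destruct (pow_lt_1_zero (/ 2) ltac:(rewrite Rabs_right; lra) (eps / 2) ltac:(lra))
    as [N HN].
  assert (HNe : snd (ball N) < eps / 2).
  { apply Rle_lt_trans with (1 := Hsmall N); apply Rle_lt_trans with (1 := Rle_abs _).
    apply HN; lia. }
  assert (Hd : forall n, (N <= n)%nat -> vnorm (fst (ball n) -v fst (ball N)) < eps / 2).
  { intros n Hn; pose proof (Hnest N (n - N)%nat) as H.
    replace (n - N + N)%nat with n in H by lia; pose proof (Hpos n); lra. }
  exists N; intros n p Hn Hp.
  replace (fst (ball n) -v fst (ball p)) with
    ((fst (ball n) -v fst (ball N)) -v (fst (ball p) -v fst (ball N))) by vec.
  apply Rle_lt_trans with (1 := vnorm_sub_le _ _).
  pose proof (Hd n Hn); pose proof (Hd p Hp); lra. }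
destruct (Hpt l) as [C HC].
destruct (INR_unbounded C) as [n Hn].
destruct (Hnxt n (ball n) (Hpos n)) as [_ [_ [_ [i Hi]]]].
change (nxt n (ball n)) with (ball (S n)) in Hi.
assert (H : INR n <= Cmod (F i l)); [|specialize (HC i); lra].
apply Hi; apply le_epsilon; intros eps Heps.
destruct (Hl eps Heps) as [N HN].
pose proof (HN (N + S n)%nat ltac:(lia)) as H1; simpl in H1.
pose proof (Hnest (S n) N) as H2; pose proof (Hpos (N + S n)%nat) as H3.
rewrite vnorm_sub_sym in H1.
replace (l -v fst (ball (S n))) with ((l -v fst (ball (N + S n)%nat)) +v
  (fst (ball (N + S n)%nat) -v fst (ball (S n)))) by vec.
pose proof (vnorm_triangle _ (l -v fst (ball (N + S n)%nat))
  (fst (ball (N + S n)%nat) -v fst (ball (S n)))); lra.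
Qed.

End UniformBoundedness.

(** The functionals [g (T x)] with [g] in the unit ball of the dual are bounded at each [x] by
    [vnorm (T x)], hence uniformly, and the norm of [T x] is recovered from them by Hahn-Banach. *)
Lemma weakly_bounded_bounded {X Y : CBanach} (T : X -> Y) :
  is_linear T ->
  (forall g, is_functional g -> is_functional (fun x => g (T x))) ->
  bounded_op T.
Proof.
intros Hlin Hw; split; [exact Hlin|].
destruct (uniform_boundedness
  (fun (g : {g : Y -> Cplx | is_functional g /\ forall y, Cmod (g y) <= vnorm y}) x =>
     proj1_sig g (T x))) as [M HM].
- intros [g [Hg Hg1]]; apply Hw, Hg.
- intros x; exists (vnorm (T x)); intros [g [Hg Hg1]]; apply Hg1.
- exists M; intros x; apply functional_bound_norm; intros g Hg Hg1.
  exact (HM (exist _ g (conj Hg Hg1)) x).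
Qed.

(** * The dual space *)

Lemma Rcauchy_cv (u : nat -> R) :
  (forall eps, 0 < eps -> exists N, forall n p, (N <= n)%nat -> (N <= p)%nat ->
     Rabs (u n - u p) < eps) ->
  exists l, forall eps, 0 < eps -> exists N, forall n, (N <= n)%nat -> Rabs (u n - l) < eps.
Proof.
intros H; destruct (R_complete u) as [l Hl].
- intros eps Heps; destruct (H eps Heps) as [N HN]; exists N; intros n p Hn Hp.
  apply HN; assumption.
- exists l; intros eps Heps; destruct (Hl eps Heps) as [N HN]; exists N; intros n Hn.
  apply HN; exact Hn.
Qed.

Lemma Ccauchy_cv (u : nat -> Cplx) :
  (forall eps, 0 < eps -> exists N, forall n p, (N <= n)%nat -> (N <= p)%nat ->
     Cmod (u n -c u p) < eps) ->
  exists l, forall eps, 0 < eps -> exists N, forall n, (N <= n)%nat -> Cmod (u n -c l) < eps.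
Proof.
intros H.
destruct (Rcauchy_cv (fun n => fst (u n))) as [a Ha].
{ intros eps Heps; destruct (H eps Heps) as [N HN]; exists N; intros n p Hn Hp.
  apply Rle_lt_trans with (2 := HN n p Hn Hp).
  exact (abs_fst_le_Cmod (u n -c u p)). }
destruct (Rcauchy_cv (fun n => snd (u n))) as [b Hb].
{ intros eps Heps; destruct (H eps Heps) as [N HN]; exists N; intros n p Hn Hp.
  apply Rle_lt_trans with (2 := HN n p Hn Hp).
  exact (snd_le_Cmod (u n -c u p)). }
exists (a, b); intros eps Heps.
destruct (Ha (eps / 2) ltac:(lra)) as [N HN], (Hb (eps / 2) ltac:(lra)) as [P HP].
exists (N + P)%nat; intros n Hn; apply Rle_lt_trans with (1 := Cmod_le_abs _).
specialize (HN n ltac:(lia)); specialize (HP n ltac:(lia)).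
change (Rabs (fst (u n) - a) + Rabs (snd (u n) - b) < eps); lra.
Qed.

(** The condition [0 <= M] keeps the set bounded below on the zero space, where every real [M]
    satisfies the inequality. *)
Definition dual_norm {X : CBanach} (f : X -> Cplx) : R :=
  Rinf (fun M => 0 <= M /\ forall x, Cmod (f x) <= M * vnorm x).

Lemma dual_norm_spec {X : CBanach} (f : X -> Cplx) :
  is_functional f ->
  0 <= dual_norm f /\ (forall x, Cmod (f x) <= dual_norm f * vnorm x) /\
  (forall M, 0 <= M -> (forall x, Cmod (f x) <= M * vnorm x) -> dual_norm f <= M).
Proof.
intros Hf; destruct (proj2 (proj2 Hf)) as [M HM].
destruct (Rinf_spec (fun M => 0 <= M /\ forall x, Cmod (f x) <= M * vnorm x)
            (Rabs M) 0) as [H1 H2].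
- split; [apply Rabs_pos|]; intros x; apply Rle_trans with (1 := HM x).
  apply Rmult_le_compat_r; [apply vnorm_nonneg|apply Rle_abs].
- intros e [He _]; exact He.
- fold (dual_norm f) in H1, H2; split; [|split].
  + apply H2; intros e [He _]; exact He.
  + intros x; destruct (classic (x = vzero)) as [->|Hx].
    { linpush; rewrite Cmod_zero, vnorm_zero; lra. }
    apply vnorm_pos in Hx.
    apply Rmult_le_reg_r with (/ vnorm x); [apply Rinv_0_lt_compat, Hx|].
    rewrite Rmult_assoc, Rinv_r, Rmult_1_r by lra.
    apply H2; intros e [He1 He2].
    apply Rmult_le_reg_r with (1 := Hx).
    rewrite Rmult_assoc, Rinv_l, Rmult_1_r by lra; apply He2.
  + intros N HN HN'; apply H1; auto.
Qed.

Lemma dual_eq {X : CBanach} (f g : {f : X -> Cplx | is_functional f}) :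
  (forall x, proj1_sig f x = proj1_sig g x) -> f = g.
Proof.
destruct f as [f Hf], g as [g Hg]; simpl; intros H.
assert (E : f = g) by (apply functional_extensionality, H).
subst g; f_equal; apply proof_irrelevance.
Qed.

Lemma dual_norm_scal_le {X : CBanach} (a : Cplx) (f : X -> Cplx) :
  is_functional f -> dual_norm (fun x => a *c f x) <= Cmod a * dual_norm f.
Proof.
intros Hf; destruct (dual_norm_spec f Hf) as [H1 [H2 _]].
apply (dual_norm_spec _ (is_functional_scal a f Hf)).
- apply Rmult_le_pos; [apply Cmod_nonneg|exact H1].
- intros x; rewrite Cmod_mul, Rmult_assoc.
  apply Rmult_le_compat_l; [apply Cmod_nonneg|apply H2].
Qed.

Lemma dual_norm_scal {X : CBanach} (a : Cplx) (f : X -> Cplx) :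
  is_functional f -> dual_norm (fun x => a *c f x) = Cmod a * dual_norm f.
Proof.
intros Hf; apply Rle_antisym; [apply dual_norm_scal_le, Hf|].
destruct (classic (a = Czero)) as [->|Ha].
{ rewrite Cmod_zero, Rmult_0_l; apply dual_norm_spec, is_functional_scal, Hf. }
apply Rmult_le_reg_l with (/ Cmod a); [apply Rinv_0_lt_compat, Cmod_pos, Ha|].
rewrite <- Rmult_assoc, Rinv_l, Rmult_1_l by (apply Rgt_not_eq, Cmod_pos, Ha).
rewrite <- Cmod_inv by exact Ha.
replace f with (fun x => Cinv a *c (a *c f x)) at 1.
- apply (dual_norm_scal_le (Cinv a) (fun x => a *c f x)), is_functional_scal, Hf.
- apply functional_extensionality; intros x; field; exact Ha.
Qed.

Lemma dual_complete {X : CBanach} (u : nat -> X -> Cplx) :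
  (forall n, is_functional (u n)) ->
  (forall eps, 0 < eps -> exists N, forall n p, (N <= n)%nat -> (N <= p)%nat ->
     dual_norm (fun x => u n x -c u p x) < eps) ->
  exists l, is_functional l /\
    forall eps, 0 < eps -> exists N, forall n, (N <= n)%nat ->
      dual_norm (fun x => u n x -c l x) < eps.
Proof.
intros Hu Hc.
assert (Hsub : forall f g : X -> Cplx, is_functional f -> is_functional g ->
  is_functional (fun x => f x -c g x)).
{ intros f g Hf Hg.
  replace (fun x => f x -c g x) with (fun x => f x +c Copp Cone *c g x)
    by (apply functional_extensionality; intros x; ring).
  apply is_functional_add; [exact Hf|apply is_functional_scal, Hg]. }
assert (Hptc : forall eps, 0 < eps -> exists N, forall n p, (N <= n)%nat -> (N <= p)%nat ->
  forall x, Cmod (u n x -c u p x) <= eps * vnorm x).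
{ intros eps Heps; destruct (Hc eps Heps) as [N HN]; exists N; intros n p Hn Hp x.
  destruct (dual_norm_spec _ (Hsub _ _ (Hu n) (Hu p))) as [_ [H _]].
  apply Rle_trans with (1 := H x); apply Rmult_le_compat_r; [apply vnorm_nonneg|].
  left; apply HN; assumption. }
assert (Hpt : forall x, exists l, forall eps, 0 < eps -> exists N, forall n, (N <= n)%nat ->
  Cmod (u n x -c l) < eps).
{ intros x; apply Ccauchy_cv; intros eps Heps.
  pose proof (vnorm_nonneg _ x) as Hx.
  destruct (Hptc (eps / (vnorm x + 1))) as [N HN]; [apply Rdiv_lt_0_compat; lra|].
  exists N; intros n p Hn Hp; apply Rle_lt_trans with (1 := HN n p Hn Hp x).
  apply Rlt_le_trans with (eps / (vnorm x + 1) * (vnorm x + 1)); [|right; field; lra].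
  apply Rmult_lt_compat_l; [apply Rdiv_lt_0_compat; lra|lra]. }
destruct (choice _ Hpt) as [l Hl].
(* The second index of the Cauchy estimate tends to infinity separately at each [x], which preserves
   the bound [eps * vnorm x] and with it the uniformity in [x]. *)
assert (Happrox : forall eps, 0 < eps -> exists N, forall n, (N <= n)%nat ->
  forall x, Cmod (u n x -c l x) <= eps * vnorm x).
{ intros eps Heps; destruct (Hptc eps Heps) as [N HN]; exists N; intros n Hn x.
  apply le_epsilon; intros e He; destruct (Hl x e He) as [P HP].
  specialize (HN n (N + P)%nat Hn ltac:(lia) x); specialize (HP (N + P)%nat ltac:(lia)).
  replace (u n x -c l x) with ((u n x -c u (N + P)%nat x) +c (u (N + P)%nat x -c l x)) by ring.
  apply Rle_trans with (1 := Cmod_add _ _); lra. }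
assert (Hzero : forall c K, 0 <= K -> (forall eps, 0 < eps -> Cmod c <= eps * K) -> c = Czero).
{ intros c K HK H; apply Cmod_eq0, Rle_antisym; [|apply Cmod_nonneg].
  apply le_epsilon; intros e He; rewrite Rplus_0_l.
  apply Rle_trans with (e / (K + 1) * K); [apply H, Rdiv_lt_0_compat; lra|].
  apply Rle_trans with (e / (K + 1) * (K + 1)); [|right; field; lra].
  apply Rmult_le_compat_l; [left; apply Rdiv_lt_0_compat; lra|lra]. }
assert (Hlf : is_functional l).
{ split; [|split].
  - intros x y; apply Csub_eq0.
    pose proof (vnorm_nonneg _ x) as H1; pose proof (vnorm_nonneg _ y) as H2.
    pose proof (vnorm_nonneg _ (x +v y)) as H3.
    apply (Hzero _ (vnorm (x +v y) + (vnorm x + vnorm y))); [lra|].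
    intros eps Heps; destruct (Happrox eps Heps) as [N HN].
    pose proof (HN N (le_n N)) as H; pose proof (Hu N) as HuN.
    replace (l (x +v y) -c (l x +c l y)) with
      (Copp (u N (x +v y) -c l (x +v y)) +c ((u N x -c l x) +c (u N y -c l y)))
      by (linpush; ring).
    apply Rle_trans with (1 := Cmod_add _ _); rewrite Cmod_opp.
    pose proof (Cmod_add (u N x -c l x) (u N y -c l y)).
    pose proof (H x); pose proof (H y); pose proof (H (x +v y)); lra.
  - intros a x; apply Csub_eq0.
    pose proof (vnorm_nonneg _ x) as H1; pose proof (vnorm_nonneg _ (a *v x)) as H3.
    pose proof (Cmod_nonneg a) as H2.
    apply (Hzero _ (vnorm (a *v x) + Cmod a * vnorm x)); [nra|].
    intros eps Heps; destruct (Happrox eps Heps) as [N HN].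
    pose proof (HN N (le_n N)) as H; pose proof (Hu N) as HuN.
    replace (l (a *v x) -c a *c l x) with
      (Copp (u N (a *v x) -c l (a *v x)) +c a *c (u N x -c l x)) by (linpush; ring).
    apply Rle_trans with (1 := Cmod_add _ _); rewrite Cmod_opp, Cmod_mul.
    pose proof (H x); pose proof (H (a *v x)); nra.
  - destruct (Happrox 1 Rlt_0_1) as [N HN].
    destruct (proj2 (proj2 (Hu N))) as [M HM]; exists (M + 1); intros x.
    replace (l x) with (u N x +c Copp (u N x -c l x)) by ring.
    apply Rle_trans with (1 := Cmod_add _ _); rewrite Cmod_opp.
    specialize (HM x); specialize (HN N (le_n N) x); lra. }
exists l; split; [exact Hlf|]; intros eps Heps.
destruct (Happrox (eps / 2) ltac:(lra)) as [N HN]; exists N; intros n Hn.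
apply Rle_lt_trans with (eps / 2); [|lra].
apply (dual_norm_spec _ (Hsub _ _ (Hu n) Hlf)); [lra|apply HN, Hn].
Qed.

(** Serves as the domain in [weakly_bounded_bounded] for a map that sends functionals to vectors. *)
Definition dual (X : CBanach) : CBanach.
Proof.
refine {|
  car := {f : X -> Cplx | is_functional f};
  vzero := exist _ (fun _ => Czero) is_functional_zero;
  vadd := fun f g => exist _ (fun x => proj1_sig f x +c proj1_sig g x)
    (is_functional_add _ _ (proj2_sig f) (proj2_sig g));
  vopp := fun f => exist _ (fun x => Copp Cone *c proj1_sig f x)
    (is_functional_scal _ _ (proj2_sig f));
  vscal := fun a f => exist _ (fun x => a *c proj1_sig f x)
    (is_functional_scal _ _ (proj2_sig f));
  vnorm := fun f => dual_norm (proj1_sig f)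
|}.
1-8: intros; apply dual_eq; intros; simpl; ring.
- intros [f Hf]; apply dual_norm_spec, Hf.
- intros [f Hf] E; simpl in E; apply dual_eq; intros x; simpl.
  apply Cmod_eq0, Rle_antisym; [|apply Cmod_nonneg].
  apply Rle_trans with (1 := proj1 (proj2 (dual_norm_spec f Hf)) x); rewrite E; lra.
- intros a [f Hf]; apply dual_norm_scal, Hf.
- intros [f Hf] [g Hg]; simpl.
  destruct (dual_norm_spec f Hf) as [Hf0 [Hf1 _]], (dual_norm_spec g Hg) as [Hg0 [Hg1 _]].
  apply (dual_norm_spec _ (is_functional_add f g Hf Hg)); [lra|].
  intros x; apply Rle_trans with (1 := Cmod_add _ _).
  specialize (Hf1 x); specialize (Hg1 x); lra.
- intros u Hu.
  assert (E : forall f g : X -> Cplx,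
    (fun x => f x +c Copp Cone *c g x) = (fun x => f x -c g x)).
  { intros f g; apply functional_extensionality; intros x; ring. }
  destruct (dual_complete (fun n => proj1_sig (u n))) as [l [Hl H]].
  + intros n; apply proj2_sig.
  + intros eps Heps; destruct (Hu eps Heps) as [N HN]; exists N; intros n p Hn Hp.
    rewrite <- E; apply HN; assumption.
  + exists (exist _ l Hl); intros eps Heps; destruct (H eps Heps) as [N HN].
    exists N; intros n Hn; simpl; rewrite E; apply HN, Hn.
Defined.

Lemma dual_apply_bound {X : CBanach} (f : dual X) (x : X) :
  Cmod (proj1_sig f x) <= vnorm f * vnorm x.
Proof. apply dual_norm_spec, proj2_sig. Qed.

Lemma dual_norm_le_vnorm {X : CBanach} (f : dual X) (M : R) :
  0 <= M -> dual_norm_le (proj1_sig f) M -> vnorm f <= M.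
Proof. intros HM H; apply dual_norm_spec; [apply proj2_sig|exact HM|exact H]. Qed.

(** * Non-emptiness of the spectrum *)

Lemma bounded_op_id {X : CBanach} : bounded_op (fun x : X => x).
Proof. repeat split; exists 1; intros; lra. Qed.

Lemma bounded_op_bound {X Y : CBanach} (T : X -> Y) :
  bounded_op T -> exists M, 1 <= M /\ forall x, vnorm (T x) <= M * vnorm x.
Proof.
intros [_ [M HM]]; exists (Rmax 1 M); split; [apply Rmax_l|]; intros x.
apply Rle_trans with (1 := HM x); apply Rmult_le_compat_r;
  [apply vnorm_nonneg|apply Rmax_r].
Qed.

Lemma bounded_op_comp {X Y Z : CBanach} (S : Y -> Z) (T : X -> Y) :
  bounded_op S -> bounded_op T -> bounded_op (fun x => S (T x)).
Proof.
intros HS HT; split; [split; intros; linpush; reflexivity|].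
destruct (bounded_op_bound S HS) as [M [HM1 HM]], (bounded_op_bound T HT) as [N [_ HN]].
exists (M * N); intros x; apply Rle_trans with (1 := HM _).
rewrite Rmult_assoc; apply Rmult_le_compat_l; [lra|apply HN].
Qed.

Lemma bounded_op_add {X Y : CBanach} (S T : X -> Y) :
  bounded_op S -> bounded_op T -> bounded_op (fun x => S x +v T x).
Proof.
intros HS HT; split; [split; intros; linpush; vec|].
destruct HS as [_ [M HM]], HT as [_ [N HN]]; exists (M + N); intros x.
apply Rle_trans with (1 := vnorm_triangle _ _ _); specialize (HM x); specialize (HN x); lra.
Qed.

Lemma bounded_op_scal {X Y : CBanach} (a : Cplx) (T : X -> Y) :
  bounded_op T -> bounded_op (fun x => a *v T x).
Proof.
intros HT; split; [split; intros; linpush; vec|].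
destruct HT as [_ [M HM]]; exists (Cmod a * M); intros x.
rewrite vnorm_scal, Rmult_assoc; apply Rmult_le_compat_l; [apply Cmod_nonneg|apply HM].
Qed.

Lemma bounded_op_opp {X Y : CBanach} (T : X -> Y) :
  bounded_op T -> bounded_op (fun x => vopp (T x)).
Proof.
intros HT; replace (fun x => vopp (T x)) with (fun x => Copp Cone *v T x).
- apply bounded_op_scal, HT.
- apply functional_extensionality; intros x; symmetry; apply vopp_scal.
Qed.

Lemma bounded_op_rank1 {X Y : CBanach} (f : X -> Cplx) (y : Y) :
  is_functional f -> bounded_op (fun x => f x *v y).
Proof.
intros Hf; split; [split; intros; linpush; vec|].
destruct Hf as [_ [_ [M HM]]]; exists (M * vnorm y); intros x.
rewrite vnorm_scal; specialize (HM x); pose proof (vnorm_nonneg _ y); nra.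
Qed.

Lemma is_functional_comp {X Y : CBanach} (g : Y -> Cplx) (T : X -> Y) :
  is_functional g -> bounded_op T -> is_functional (fun x => g (T x)).
Proof.
intros Hg HT; split; [|split].
- intros; linpush; reflexivity.
- intros; linpush; reflexivity.
- destruct Hg as [_ [_ [M HM]]], HT as [_ [N HN]].
  exists (Rabs M * N); intros x; apply Rle_trans with (1 := HM _).
  apply Rle_trans with (Rabs M * vnorm (T x)).
  + apply Rmult_le_compat_r; [apply vnorm_nonneg|apply Rle_abs].
  + rewrite Rmult_assoc; apply Rmult_le_compat_l; [apply Rabs_pos|apply HN].
Qed.

Lemma pow_double (a : R) (j : nat) : a ^ (2 ^ S j) = a ^ (2 ^ j) * a ^ (2 ^ j).
Proof. rewrite <- pow_add; f_equal; simpl; lia. Qed.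

Lemma Cpow_double (a : Cplx) (j : nat) :
  Cpow a (2 ^ S j) = Cpow a (2 ^ j) *c Cpow a (2 ^ j).
Proof. rewrite <- Cpow_add; f_equal; simpl; lia. Qed.

(* Rickart's elementary proof that the spectrum is not empty.  If it were, then
   [G w], the inverse of [1 - w T], would exist for every [w], and so would the
   inverse [Gs j w] of [1 - (w T)^(2^j)], which is an average of values of [G] on
   the circle of radius [|w|].  As these averages depend on the radius uniformly
   continuously in [j], boundedness of the operators [(r T)^(2^j)] propagates past
   the supremum of all [r] for which it holds. *)
Section SpectrumNonempty.
Context {X : CBanach} (T : X -> X) (x0 : X).
Hypothesis HT : bounded_op T.
Hypothesis Hx0 : x0 <> vzero.
Context (M : R).
Hypothesis HM1 : 1 <= M.
Hypothesis HM : forall x, vnorm (T x) <= M * vnorm x.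
Context (G : Cplx -> X -> X).
Hypothesis HGb : forall w, bounded_op (G w).
Hypothesis HGl : forall w x, G w (x -v w *v T x) = x.
Hypothesis HGr : forall w x, G w x -v w *v T (G w x) = x.
Context (T' : X -> X) (M' : R).
Hypothesis HT' : forall x, T' (T x) = x.
Hypothesis HM1' : 1 <= M'.
Hypothesis HM' : forall x, vnorm (T' x) <= M' * vnorm x.

(** In [G w' y = G w y + (w' - w) G w (T (G w' y))] the last term is at most half of the left side
    and can be absorbed. *)
Lemma inverse_local_bound (w w' : Cplx) (g : R) :
  0 < g -> (forall x, vnorm (G w x) <= g * vnorm x) ->
  Cmod (w' -c w) * M * g <= / 2 ->
  forall x, vnorm (G w' x) <= 2 * g * vnorm x.
Proof.
intros Hg HG Hw y; pose proof (HGb w) as Hb.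
set (x := G w' y).
assert (E : x = G w y +v (w' -c w) *v G w (T x)).
{ rewrite <- (HGr w' y); fold x.
  replace (x -v w' *v T x) with ((x -v w *v T x) -v (w' -c w) *v T x) by vec.
  rewrite (lin_add (proj1 Hb)), HGl; linpush; vec. }
assert (H : vnorm x <= g * vnorm y + Cmod (w' -c w) * (g * (M * vnorm x))).
{ rewrite E at 1; apply Rle_trans with (1 := vnorm_triangle _ _ _).
  rewrite vnorm_scal; apply Rplus_le_compat; [apply HG|].
  apply Rmult_le_compat_l; [apply Cmod_nonneg|].
  apply Rle_trans with (1 := HG _), Rmult_le_compat_l; [lra|apply HM]. }
pose proof (vnorm_nonneg _ x); nra.
Qed.

Lemma inverse_square_bound (r : R) :
  exists K, 0 < K /\ forall w, Rabs (fst w) <= r -> Rabs (snd w) <= r ->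
    forall x, vnorm (G w x) <= K * vnorm x.
Proof.
destruct (choice (fun w g => 1 <= g /\ forall x, vnorm (G w x) <= g * vnorm x)
  (fun w => bounded_op_bound _ (HGb w))) as [g Hg].
assert (Hd : forall u v, 0 < / (4 * M * g (u, v))).
{ intros u v; apply Rinv_0_lt_compat; pose proof (proj1 (Hg (u, v))); nra. }
(* Within [/ (4 * M * g (u, v))] of [(u, v)] in both coordinates [inverse_local_bound] applies.
   Compactness bounds these radii below by a common [d] at the chosen points, so that
   [g (u, v) <= / (4 * M * d)] there. *)
destruct (Compactness.compactness_value_2d (- r) r (- r) r
  (fun u v => mkposreal _ (Hd u v))) as [d Hcomp].
pose proof (cond_pos d) as Hdpos.
exists (/ (2 * M * d)); split; [apply Rinv_0_lt_compat; nra|].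
intros w Hw1 Hw2.
destruct (NNPP _ (Hcomp (fst w) (snd w) ltac:(split_Rabs; lra) ltac:(split_Rabs; lra)))
  as [u [v [_ [_ [Hu [Hv Hd']]]]]]; simpl in Hu, Hv, Hd'.
destruct (Hg (u, v)) as [Hg1 Hg2].
assert (Hinv : M * g (u, v) * / (4 * M * g (u, v)) = / 4) by (field; lra).
assert (HMg : 0 < M * g (u, v)) by nra.
intros x; apply Rle_trans with (2 * g (u, v) * vnorm x).
- apply (inverse_local_bound (u, v) w); [lra|exact Hg2|].
  pose proof (Cmod_le_abs (w -c (u, v))) as H.
  replace (fst (w -c (u, v))) with (fst w - u) in H by (simpl; ring).
  replace (snd (w -c (u, v))) with (snd w - v) in H by (simpl; ring).
  rewrite Rmult_assoc; nra.
- apply Rmult_le_compat_r; [apply vnorm_nonneg|].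
  apply Rmult_le_reg_r with (2 * M * d); [nra|].
  rewrite Rinv_l by nra; nra.
Qed.

(** Follows from the resolvent identity [G w - G w' = (w - w') G w T G w']. *)
Lemma inverse_lipschitz (r K : R) (w w' : Cplx) :
  0 < K ->
  (forall x, vnorm (G w x) <= K * vnorm x) ->
  (forall x, vnorm (G w' x) <= K * vnorm x) ->
  forall x, vnorm (G w x -v G w' x) <= Cmod (w -c w') * (M * (K * K)) * vnorm x.
Proof.
intros HK H1 H2 x; pose proof (HGb w) as Hb.
assert (E : G w x -v G w' x = (w -c w') *v G w (T (G w' x))).
{ set (y := G w' x).
  replace (G w x) with (G w ((y -v w *v T y) +v (w -c w') *v T y)).
  - rewrite (lin_add (proj1 Hb)), HGl; linpush; vec.
  - f_equal; rewrite <- (HGr w' x) at 1; fold y; vec. }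
rewrite E, vnorm_scal.
rewrite !Rmult_assoc; apply Rmult_le_compat_l; [apply Cmod_nonneg|].
apply Rle_trans with (1 := H1 _).
replace (M * (K * (K * vnorm x))) with (K * (M * (K * vnorm x))) by ring.
apply Rmult_le_compat_l; [lra|]; apply Rle_trans with (1 := HM _).
apply Rmult_le_compat_l; [lra|apply H2].
Qed.

Fixpoint pow2_op (j : nat) : X -> X :=
  match j with O => T | S i => fun x => pow2_op i (pow2_op i x) end.

Lemma pow2_op_bounded (j : nat) : bounded_op (pow2_op j).
Proof. induction j; [exact HT|exact (bounded_op_comp _ _ IHj IHj)]. Qed.

Lemma pow2_op_bound (j : nat) (x : X) : vnorm (pow2_op j x) <= M ^ (2 ^ j) * vnorm x.
Proof.
revert x; induction j as [|j IH]; intros x; [simpl; rewrite Rmult_1_r; apply HM|].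
rewrite pow_double; simpl pow2_op; apply Rle_trans with (1 := IH _).
rewrite Rmult_assoc; apply Rmult_le_compat_l; [apply pow_le; lra|apply IH].
Qed.

Lemma pow2_op_lower_bound (j : nat) (x : X) :
  vnorm x <= M' ^ (2 ^ j) * vnorm (pow2_op j x).
Proof.
revert x; induction j as [|j IH]; intros x.
- simpl; rewrite Rmult_1_r, <- (HT' x) at 1; apply HM'.
- rewrite pow_double; simpl pow2_op; apply Rle_trans with (1 := IH _).
  rewrite Rmult_assoc; apply Rmult_le_compat_l; [apply pow_le; lra|apply IH].
Qed.

Definition half_turn (j : nat) : Cplx :=
  epsilon (inhabits Cone) (fun w => Cpow w (2 ^ j) = Copp Cone).

Lemma half_turn_spec (j : nat) : Cpow (half_turn j) (2 ^ j) = Copp Cone.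
Proof.
unfold half_turn; apply epsilon_spec.
destruct (Croot (Copp Cone) (2 ^ j - 1)) as [w Hw]; exists w; rewrite <- Hw; f_equal.
pose proof (Nat.pow_nonzero 2 j); lia.
Qed.

Lemma half_turn_Cmod (j : nat) : Cmod (half_turn j) = 1.
Proof.
pose proof (f_equal Cmod (half_turn_spec j)) as H.
rewrite Cmod_pow, Cmod_opp, Cmod_one in H.
destruct (pow_R1 _ _ H) as [H1|H1].
- rewrite Rabs_right in H1; [exact H1|apply Rle_ge, Cmod_nonneg].
- pose proof (Nat.pow_nonzero 2 j); lia.
Qed.

(** [(1 - a^2 P^2)^-1] is the mean of [(1 - a P)^-1] and [(1 + a P)^-1]. Here [P] is [pow2_op i] and
    [a = w^(2^i)], whose sign is changed by the factor [half_turn i]. *)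
Fixpoint pow2_inverse (j : nat) (w : Cplx) (x : X) : X :=
  match j with
  | O => G w x
  | S i => Creal (/ 2) *v (pow2_inverse i w x +v pow2_inverse i (half_turn i *c w) x)
  end.

Lemma Creal_half (x : X) : Creal (/ 2) *v (x +v x) = x.
Proof.
replace (x +v x) with (Creal 2 *v x).
- rewrite vscal_assoc, <- vscal_one; f_equal; apply Cplx_eq; simpl; field.
- replace (Creal 2) with (Cone +c Cone) by (apply Cplx_eq; simpl; ring); vec.
Qed.

Lemma pow2_inverse_spec (j : nat) (w : Cplx) (x : X) :
  pow2_inverse j w (x -v Cpow w (2 ^ j) *v pow2_op j x) = x /\
  pow2_inverse j w x -v Cpow w (2 ^ j) *v pow2_op j (pow2_inverse j w x) = x.
Proof.
revert w x; induction j as [|j IH]; intros w x.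
- simpl; replace (w *c Cone) with w by ring; auto.
- pose proof (pow2_op_bounded j) as HP.
  assert (E : Cpow (half_turn j *c w) (2 ^ j) = Copp (Cpow w (2 ^ j))).
  { rewrite Cpow_mul, half_turn_spec; ring. }
  cbn [pow2_inverse pow2_op]; rewrite Cpow_double; set (a := Cpow w (2 ^ j)) in *.
  set (P := pow2_op j) in *; split.
  + replace (x -v a *c a *v P (P x)) with ((x +v a *v P x) -v a *v P (x +v a *v P x)) at 1
      by (linpush; vec).
    rewrite (proj1 (IH w _)).
    replace (x -v a *c a *v P (P x)) with ((x -v a *v P x) -v Copp a *v P (x -v a *v P x))
      by (linpush; vec).
    rewrite <- E, (proj1 (IH (half_turn j *c w) _)).
    replace ((x +v a *v P x) +v (x -v a *v P x)) with (x +v x) by vec.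
    apply Creal_half.
  + pose proof (proj2 (IH w x)) as H1; pose proof (proj2 (IH (half_turn j *c w) x)) as H2.
    rewrite E in H2; fold a P in H1, H2.
    set (y := pow2_inverse j w x) in *; set (z := pow2_inverse j (half_turn j *c w) x) in *.
    transitivity (Creal (/ 2) *v (((y -v a *v P y) +v a *v P (y -v a *v P y)) +v
      ((z -v Copp a *v P z) -v a *v P (z -v Copp a *v P z)))).
    * linpush; vec.
    * rewrite H1, H2; transitivity (Creal (/ 2) *v (x +v x)); [vec|apply Creal_half].
Qed.

(** Averaging does not enlarge a bound, and the unimodular [half_turn] keeps the directions on the
    unit circle; so [L] is the same for all [j], which is what the propagation past the supremum
    rests on. *)
Lemma pow2_inverse_lipschitz (r1 r2 L : R) (j : nat) :
  (forall w, Cmod w = 1 -> forall x,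
     vnorm (G (Creal r2 *c w) x -v G (Creal r1 *c w) x) <= L * vnorm x) ->
  forall w, Cmod w = 1 -> forall x,
    vnorm (pow2_inverse j (Creal r2 *c w) x -v pow2_inverse j (Creal r1 *c w) x)
      <= L * vnorm x.
Proof.
intros H; induction j as [|j IH]; [exact H|]; intros w Hw x; cbn [pow2_inverse].
replace (half_turn j *c (Creal r2 *c w)) with (Creal r2 *c (half_turn j *c w)) by ring.
replace (half_turn j *c (Creal r1 *c w)) with (Creal r1 *c (half_turn j *c w)) by ring.
pose proof (IH w Hw x) as H1.
assert (H2 := IH (half_turn j *c w) ltac:(rewrite Cmod_mul, half_turn_Cmod, Hw; ring) x).
set (a := pow2_inverse j (Creal r2 *c w) x) in *.
set (b := pow2_inverse j (Creal r1 *c w) x) in *.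
set (c := pow2_inverse j (Creal r2 *c (half_turn j *c w)) x) in *.
set (d := pow2_inverse j (Creal r1 *c (half_turn j *c w)) x) in *.
replace (Creal (/ 2) *v (a +v c) -v Creal (/ 2) *v (b +v d))
  with (Creal (/ 2) *v ((a -v b) +v (c -v d))) by vec.
rewrite vnorm_scal, Cmod_Creal, Rabs_right by lra.
pose proof (vnorm_triangle _ (a -v b) (c -v d)); lra.
Qed.

(** The supremum of such [r] is the reciprocal of the limit of [|T^(2^j)|^(1/2^j)], the spectral
    radius of [T] expressed by norms. *)
Definition pow2_bounded (r : R) : Prop :=
  0 <= r /\ exists c, forall j x, r ^ (2 ^ j) * vnorm (pow2_op j x) <= c * vnorm x.

Lemma pow2_bounded_inv_M : pow2_bounded (/ M).
Proof.
split; [left; apply Rinv_0_lt_compat; lra|].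
exists 1; intros j x; rewrite pow_inv.
apply Rmult_le_reg_l with (M ^ (2 ^ j)); [apply pow_lt; lra|].
rewrite <- Rmult_assoc, Rinv_r, Rmult_1_l, Rmult_1_l by (apply pow_nonzero; lra).
apply pow2_op_bound.
Qed.

(** The left inverse [T'], which exists if 0 is outside the spectrum, prevents [T^(2^j) x0] from
    decaying faster than [M'^-(2^j)]; for [r > M'] the powers of [r / M'] would stay bounded. *)
Lemma pow2_bounded_le (r : R) : pow2_bounded r -> r <= M'.
Proof.
intros [Hr [c Hc]]; apply Rnot_lt_le; intros Hlt.
destruct (Pow_x_infinity (r / M')) with (b := c + 1) as [N HN].
{ rewrite Rabs_right.
  - apply Rmult_lt_reg_r with M'; [lra|]; unfold Rdiv; rewrite Rmult_assoc, Rinv_l; lra.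
  - apply Rle_ge, Rmult_le_pos; [lra|left; apply Rinv_0_lt_compat; lra]. }
assert (HN2 : (N <= 2 ^ N)%nat) by (pose proof (Nat.pow_gt_lin_r 2 N); lia).
specialize (HN (2 ^ N)%nat HN2).
rewrite Rabs_right in HN.
2: { apply Rle_ge, pow_le, Rmult_le_pos; [lra|left; apply Rinv_0_lt_compat; lra]. }
unfold Rdiv in HN; rewrite Rpow_mult_distr, pow_inv in HN.
pose proof (Hc N x0) as H1; pose proof (pow2_op_lower_bound N x0) as H2.
pose proof (vnorm_pos x0 Hx0) as H3.
assert (Ha : 0 < M' ^ (2 ^ N)) by (apply pow_lt; lra).
assert (Hb : 0 <= r ^ (2 ^ N)) by (apply pow_le; lra).
set (a := M' ^ (2 ^ N)) in *; set (b := r ^ (2 ^ N)) in *.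
assert (H4 : b * vnorm x0 <= a * c * vnorm x0).
{ apply Rle_trans with (b * (a * vnorm (pow2_op N x0))).
  - apply Rmult_le_compat_l; assumption.
  - replace (b * (a * vnorm (pow2_op N x0))) with (a * (b * vnorm (pow2_op N x0))) by ring.
    rewrite Rmult_assoc; apply Rmult_le_compat_l; lra. }
apply Rmult_le_reg_r in H4; [|exact H3].
assert (H5 : b * / a <= c).
{ apply Rmult_le_reg_r with a; [exact Ha|].
  rewrite Rmult_assoc, Rinv_l by lra; lra. }
lra.
Qed.

Lemma pow2_small_below (r r' : R) (eps : R) :
  0 <= r -> r < r' -> pow2_bounded r' -> 0 < eps ->
  exists J, forall j, (J <= j)%nat -> forall x,
    r ^ (2 ^ j) * vnorm (pow2_op j x) <= eps * vnorm x.
Proof.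
intros Hr Hlt [Hr' [c Hc]] Heps.
assert (Hq : 0 <= r / r').
{ apply Rmult_le_pos; [lra|left; apply Rinv_0_lt_compat; lra]. }
destruct (pow_lt_1_zero (r / r')) with (y := eps / (Rabs c + 1)) as [N HN].
- rewrite Rabs_right by lra; apply Rmult_lt_reg_r with r'; [lra|].
  unfold Rdiv; rewrite Rmult_assoc, Rinv_l; lra.
- apply Rdiv_lt_0_compat; [exact Heps|pose proof (Rabs_pos c); lra].
- exists N; intros j Hj x.
  assert (HN2 : (N <= 2 ^ j)%nat) by (pose proof (Nat.pow_gt_lin_r 2 j); lia).
  specialize (HN _ HN2); rewrite Rabs_right in HN by (apply Rle_ge, pow_le, Hq).
  replace (r ^ (2 ^ j)) with ((r / r') ^ (2 ^ j) * r' ^ (2 ^ j))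
    by (rewrite <- Rpow_mult_distr; f_equal; field; lra).
  rewrite Rmult_assoc; pose proof (vnorm_nonneg _ x) as Hx.
  pose proof (pow_le _ (2 ^ j) Hq) as H0.
  apply Rle_trans with ((r / r') ^ (2 ^ j) * ((Rabs c + 1) * vnorm x)).
  + apply Rmult_le_compat_l; [exact H0|]; apply Rle_trans with (1 := Hc j x).
    apply Rmult_le_compat_r; [exact Hx|pose proof (Rle_abs c); lra].
  + rewrite <- Rmult_assoc; apply Rmult_le_compat_r; [exact Hx|].
    pose proof (Rabs_pos c); apply Rle_trans with (eps / (Rabs c + 1) * (Rabs c + 1));
      [apply Rmult_le_compat_r; lra|right; field; lra].
Qed.

(** If [y] is the image of [x] under the inverse of [1 - b], then [y - x = b y]. So [b] is small
    exactly when the inverse is near the identity: [1/20] for [b] yields [1/19 < 1/10] here, and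
    conversely [1/5] for the inverse yields [1/4] for [b]. The gap between [1/10] and [1/5] is the
    room for changing the radius. *)
Lemma pow2_inverse_near_id (r : R) (j : nat) :
  0 <= r -> (forall x, r ^ (2 ^ j) * vnorm (pow2_op j x) <= / 20 * vnorm x) ->
  forall x, vnorm (pow2_inverse j (Creal r) x -v x) <= / 10 * vnorm x.
Proof.
intros Hr H x; pose proof (proj2 (pow2_inverse_spec j (Creal r) x)) as E.
set (y := pow2_inverse j (Creal r) x) in *; rewrite Cpow_Creal in E.
assert (H1 : vnorm (y -v x) <= / 20 * vnorm y).
{ rewrite <- E.
  replace (y -v (y -v Creal (r ^ (2 ^ j)) *v pow2_op j y))
    with (Creal (r ^ (2 ^ j)) *v pow2_op j y) by vec.
  rewrite vnorm_scal, Cmod_Creal, Rabs_right by (apply Rle_ge, pow_le, Hr); apply H. }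
pose proof (vnorm_triangle _ (y -v x) x) as H2.
replace ((y -v x) +v x) with y in H2 by vec; pose proof (vnorm_nonneg _ x); lra.
Qed.

Lemma pow2_small_of_inverse (r : R) (j : nat) :
  0 <= r -> (forall x, vnorm (pow2_inverse j (Creal r) x -v x) <= / 5 * vnorm x) ->
  forall x, r ^ (2 ^ j) * vnorm (pow2_op j x) <= / 4 * vnorm x.
Proof.
intros Hr H x; pose proof (proj1 (pow2_inverse_spec j (Creal r) x)) as E.
rewrite Cpow_Creal in E.
rewrite <- (Rabs_right (r ^ (2 ^ j))), <- Cmod_Creal, <- vnorm_scal
  by (apply Rle_ge, pow_le, Hr).
set (b := Creal (r ^ (2 ^ j)) *v pow2_op j x) in *.
specialize (H (x -v b)); rewrite E in H.
replace (x -v (x -v b)) with b in H by vec.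
pose proof (vnorm_sub_le x b); lra.
Qed.

Lemma entire_inverse_absurd : False.
Proof.
destruct (completeness pow2_bounded) as [rho [Hub Hlub]].
- exists M'; intros r; apply pow2_bounded_le.
- exists (/ M); apply pow2_bounded_inv_M.
- assert (Hrho : 0 < rho).
  { apply Rlt_le_trans with (/ M); [apply Rinv_0_lt_compat; lra|].
    apply Hub, pow2_bounded_inv_M. }
  destruct (inverse_square_bound (2 * rho)) as [K [HK HGK]].
  pose (L := M * (K * K)).
  assert (HL : 0 < L) by (unfold L; repeat apply Rmult_lt_0_compat; lra).
  (* The first bound keeps the radii [rho - d] and [rho + d] inside [[0, 2 * rho]], where [K] is
     valid; the second makes the averages change by at most [1/10] between them. *)
  pose (d := Rmin (rho / 2) (/ (20 * L))).
  assert (Hd : 0 < d).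
  { apply Rmin_glb_lt; [lra|apply Rinv_0_lt_compat; lra]. }
  assert (Hd1 : d <= rho / 2) by apply Rmin_l.
  assert (HdL : 2 * d * L <= / 10).
  { apply Rle_trans with (2 * / (20 * L) * L); [|right; field; lra].
    apply Rmult_le_compat_r; [lra|]; apply Rmult_le_compat_l; [lra|apply Rmin_r]. }
  assert (Hlip : forall w, Cmod w = 1 -> forall x,
    vnorm (G (Creal (rho + d) *c w) x -v G (Creal (rho - d) *c w) x) <= / 10 * vnorm x).
  { intros w Hw x.
    assert (Hsq : forall r, 0 <= r -> r <= 2 * rho -> forall y,
      vnorm (G (Creal r *c w) y) <= K * vnorm y).
    { intros r Hr1 Hr2.
      assert (Hmod : Cmod (Creal r *c w) = r)
        by (rewrite Cmod_mul, Cmod_Creal, Rabs_right, Hw by lra; ring).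
      apply HGK; [pose proof (abs_fst_le_Cmod (Creal r *c w))
                 |pose proof (snd_le_Cmod (Creal r *c w))]; lra. }
    eapply Rle_trans; [apply (inverse_lipschitz rho K _ _ HK); apply Hsq; lra|].
    apply Rmult_le_compat_r; [apply vnorm_nonneg|].
    replace (Creal (rho + d) *c w -c Creal (rho - d) *c w) with (Creal (2 * d) *c w)
      by (apply Cplx_eq; simpl; ring).
    rewrite Cmod_mul, Cmod_Creal, Hw, Rabs_right by lra; fold L; lra. }
  assert (Hbelow : exists r', rho - d < r' /\ pow2_bounded r').
  { apply NNPP; intros Hno; assert (rho <= rho - d); [|lra].
    apply Hlub; intros r Hr; apply Rnot_lt_le; intros Hlt; apply Hno; exists r; auto. }
  destruct Hbelow as [r' [Hr' Hb']].
  destruct (pow2_small_below (rho - d) r' (/ 20) ltac:(lra) Hr' Hb' ltac:(lra)) as [J HJ].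
  assert (Hup : forall j, (J <= j)%nat -> forall x,
    (rho + d) ^ (2 ^ j) * vnorm (pow2_op j x) <= / 4 * vnorm x).
  { intros j Hj; apply pow2_small_of_inverse; [lra|]; intros x.
    pose proof (pow2_inverse_near_id (rho - d) j ltac:(lra) (HJ j Hj) x) as H1.
    pose proof (pow2_inverse_lipschitz (rho - d) (rho + d) (/ 10) j Hlip Cone Cmod_one x) as H2.
    replace (Creal (rho + d) *c Cone) with (Creal (rho + d)) in H2 by ring.
    replace (Creal (rho - d) *c Cone) with (Creal (rho - d)) in H2 by ring.
    set (y := pow2_inverse j (Creal (rho + d)) x) in *.
    set (z := pow2_inverse j (Creal (rho - d)) x) in *.
    replace (y -v x) with ((y -v z) +v (z -v x)) by vec.
    pose proof (vnorm_triangle _ (y -v z) (z -v x)); lra. }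
  assert (rho + d <= rho); [|lra].
  apply Hub; split; [lra|].
  (* The finitely many [j < J] are covered by the crude estimate
     [((rho + d) * M)^(2^j) <= a^(2^J)]. *)
  pose (a := 1 + (rho + d) * M); assert (Ha : 1 <= a) by (unfold a; nra).
  exists (1 + a ^ (2 ^ J)); intros j x; pose proof (vnorm_nonneg _ x) as Hx.
  pose proof (pow_le a (2 ^ J) ltac:(lra)) as HaJ.
  destruct (Nat.le_gt_cases J j) as [Hj|Hj]; [specialize (Hup j Hj x); nra|].
  apply Rle_trans with ((rho + d) ^ (2 ^ j) * (M ^ (2 ^ j) * vnorm x)).
  { apply Rmult_le_compat_l; [apply pow_le; lra|apply pow2_op_bound]. }
  rewrite <- Rmult_assoc, <- Rpow_mult_distr; apply Rmult_le_compat_r; [exact Hx|].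
  apply Rle_trans with (a ^ (2 ^ j)); [apply pow_incr; unfold a; nra|].
  apply Rle_trans with (a ^ (2 ^ J)); [|lra].
  apply Rle_pow; [exact Ha|]; apply Nat.pow_le_mono_r; lia.
Qed.

End SpectrumNonempty.

Theorem spectrum_nonempty {X : CBanach} (T : X -> X) (x0 : X) :
  bounded_op T -> x0 <> vzero -> exists z, spectrum T z.
Proof.
intros HT Hx0; apply NNPP; intros Hno.
assert (Hinv : forall z, exists S : X -> X, bounded_op S /\
  (forall x, S (T x -v z *v x) = x) /\ (forall x, T (S x) -v z *v S x = x)).
{ intros z; apply NNPP; intros H; apply Hno; exists z; exact H. }
destruct (bounded_op_bound T HT) as [M [HM1 HM]].
assert (HG : forall w, exists G : X -> X, bounded_op G /\
  (forall x, G (x -v w *v T x) = x) /\ (forall x, G x -v w *v T (G x) = x)).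
{ intros w; destruct (classic (w = Czero)) as [->|Hw].
  - exists (fun x => x); split; [apply bounded_op_id|split; intros; vec].
  - destruct (Hinv (Cinv w)) as [S [HS [H1 H2]]].
    (* From [1 - w T = - w (T - 1/w)]. *)
    exists (fun x => Copp (Cinv w) *v S x); split; [apply bounded_op_scal, HS|]; split.
    + intros x; transitivity (S (T x -v Cinv w *v x)); [|apply H1].
      linpush; vec_coefs; field; exact Hw.
    + intros x; linpush; transitivity (T (S x) -v Cinv w *v S x); [|apply H2].
      vec_coefs; field; exact Hw. }
destruct (choice _ HG) as [G HG'].
destruct (Hinv Czero) as [T' [HT' [H1 _]]].
destruct (bounded_op_bound T' HT') as [M' [HM1' HM']].
apply (entire_inverse_absurd T x0 HT Hx0 M HM1 HM G
  (fun w => proj1 (HG' w)) (fun w => proj1 (proj2 (HG' w)))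
  (fun w => proj2 (proj2 (HG' w))) T' M'); try assumption.
intros x; rewrite <- (H1 x) at 2; f_equal; vec.
Qed.

(** * Spectra of products and of adjoints *)

Lemma spectrum_trivial {X : CBanach} (T : X -> X) (z : Cplx) :
  (forall x : X, x = vzero) -> ~ spectrum T z.
Proof.
intros H Hz; apply Hz; exists (fun x => x); split; [apply bounded_op_id|].
split; intros x; etransitivity; [apply H|symmetry; apply H|apply H|symmetry; apply H].
Qed.

(** Jacobson's formula: if [R] inverts [T S - z], then [(S R T - 1) / z] inverts [S T - z]. *)
Lemma spectrum_comp {X Y : CBanach} (S : Y -> X) (T : X -> Y) (z : Cplx) :
  bounded_op S -> bounded_op T -> z <> Czero ->
  spectrum (fun x => S (T x)) z -> spectrum (fun y => T (S y)) z.
Proof.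
intros HS HT Hz Hsp [R [HR [H1 H2]]]; apply Hsp.
exists (fun x => Cinv z *v (S (R (T x)) -v x)); split; [|split].
- apply bounded_op_scal, bounded_op_add; [|apply bounded_op_opp, bounded_op_id].
  apply bounded_op_comp; [exact HS|exact (bounded_op_comp _ _ HR HT)].
- intros x; replace (R (T (S (T x) -v z *v x))) with (T x).
  + vec_coefs; field; exact Hz.
  + rewrite <- (H1 (T x)) at 1; f_equal; linpush; vec.
- intros x.
  transitivity (Cinv z *v (S (T (S (R (T x))) -v z *v R (T x)) -v S (T x) +v z *v x)).
  + linpush; vec_coefs; field; exact Hz.
  + rewrite H2; vec_coefs; field; exact Hz.
Qed.

(** At [z = 0] the spectra of [S T] and [T S] may differ. But then [T S] has no nonzero spectrum
    either, and as its spectrum is not empty, it is [{0}]. *)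
Lemma peripheral_comp_imp {X Y : CBanach} (S : Y -> X) (T : X -> Y) (y0 : Y) (z : Cplx) :
  bounded_op S -> bounded_op T -> y0 <> vzero ->
  peripheral_spectrum (fun x => S (T x)) z -> peripheral_spectrum (fun y => T (S y)) z.
Proof.
intros HS HT Hy0 [Hz Hmax].
assert (Hle : forall w, spectrum (fun y => T (S y)) w -> Cmod w <= Cmod z).
{ intros w Hw; destruct (classic (w = Czero)) as [->|Hw0].
  - rewrite Cmod_zero; apply Cmod_nonneg.
  - apply Hmax; exact (spectrum_comp T S w HT HS Hw0 Hw). }
split; [|exact Hle].
destruct (classic (z = Czero)) as [->|Hz0]; [|exact (spectrum_comp S T z HS HT Hz0 Hz)].
destruct (spectrum_nonempty (fun y => T (S y)) y0 (bounded_op_comp _ _ HT HS) Hy0) as [w Hw].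
replace Czero with w; [exact Hw|].
apply Cmod_eq0, Rle_antisym; [|apply Cmod_nonneg].
rewrite <- Cmod_zero; apply Hle, Hw.
Qed.

Lemma peripheral_comp {X Y : CBanach} (S : Y -> X) (T : X -> Y) (x0 : X) (y0 : Y) (z : Cplx) :
  bounded_op S -> bounded_op T -> x0 <> vzero -> y0 <> vzero ->
  peripheral_spectrum (fun x => S (T x)) z <-> peripheral_spectrum (fun y => T (S y)) z.
Proof.
intros; split; [apply (peripheral_comp_imp S T y0)|apply (peripheral_comp_imp T S x0)];
  assumption.
Qed.

Lemma spectrum_eigenvalue {X : CBanach} (T : X -> X) (z : Cplx) (v : X) :
  v <> vzero -> T v = z *v v -> spectrum T z.
Proof.
intros Hv E [S [HS [H1 _]]]; apply Hv; rewrite <- (H1 v), E, vadd_opp.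
apply (lin_zero (proj1 HS)).
Qed.

Lemma peripheral_rank_one {X : CBanach} (f : X -> Cplx) (x x0 : X) (z : Cplx) :
  is_functional f -> x0 <> vzero ->
  peripheral_spectrum (fun v => f v *v x) z <-> z = f x.
Proof.
intros Hf Hx0.
assert (Hin : spectrum (fun v => f v *v x) (f x)).
{ destruct (classic (x = vzero)) as [->|Hx].
  - apply (spectrum_eigenvalue _ _ x0 Hx0); linpush; vec.
  - exact (spectrum_eigenvalue (fun v => f v *v x) (f x) x Hx eq_refl). }
assert (Hout : forall w, spectrum (fun v => f v *v x) w -> w = Czero \/ w = f x).
{ intros w Hw; apply NNPP; intros H; apply not_or_and in H; destruct H as [H1 H2].
  assert (H3 : w -c f x <> Czero) by (intros E; apply H2, Csub_eq0, E).
  (* The Sherman-Morrison formula for a rank one perturbation of [- w]. *)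
  apply Hw; exists (fun v => Copp (Cinv w) *v (v +v f v *v (Cinv (w -c f x) *v x))).
  split; [|split].
  - apply bounded_op_scal, bounded_op_add; [apply bounded_op_id|apply bounded_op_rank1, Hf].
  - intros v; linpush; vec_coefs; field; auto.
  - intros v; linpush; vec_coefs; field; auto. }
split.
- intros [Hz Hmax]; destruct (Hout z Hz) as [->|E]; [|exact E].
  symmetry; apply Cmod_eq0, Rle_antisym; [|apply Cmod_nonneg].
  rewrite <- Cmod_zero; apply Hmax, Hin.
- intros ->; split; [exact Hin|]; intros w Hw.
  destruct (Hout w Hw) as [->| ->]; [rewrite Cmod_zero; apply Cmod_nonneg|lra].
Qed.

Lemma gprod_app {X : CBanach} (s t : list nat) (A : nat -> X -> X) (x : X) :
  gprod (s ++ t) A x = gprod s A (gprod t A x).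
Proof. induction s as [|i s IH]; simpl; [reflexivity|rewrite IH; reflexivity]. Qed.

Lemma gprod_ext {X : CBanach} (s : list nat) (A B : nat -> X -> X) :
  (forall i, In i s -> A i = B i) -> gprod s A = gprod s B.
Proof.
induction s as [|i s IH]; simpl; intros H; [reflexivity|].
rewrite IH, H by auto; reflexivity.
Qed.

Lemma gprod_bounded {X : CBanach} (s : list nat) (A : nat -> X -> X) :
  (forall i, In i s -> bounded_op (A i)) -> bounded_op (gprod s A).
Proof.
induction s as [|i s IH]; simpl; intros H; [apply bounded_op_id|].
apply (bounded_op_comp (A i) (gprod s A)); auto.
Qed.

Lemma peripheral_gprod_rotate {X : CBanach} (s t : list nat) (A : nat -> X -> X) (x0 : X)
  (z : Cplx) :
  (forall i, In i (s ++ t) -> bounded_op (A i)) -> x0 <> vzero ->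
  peripheral_spectrum (gprod (s ++ t) A) z <-> peripheral_spectrum (gprod (t ++ s) A) z.
Proof.
intros HA Hx0.
replace (gprod (s ++ t) A) with (fun x => gprod s A (gprod t A x))
  by (apply functional_extensionality; intros x; symmetry; apply gprod_app).
replace (gprod (t ++ s) A) with (fun x => gprod t A (gprod s A x))
  by (apply functional_extensionality; intros x; symmetry; apply gprod_app).
apply (peripheral_comp _ _ x0 x0); try assumption;
  apply gprod_bounded; intros i Hi; apply HA, in_or_app; auto.
Qed.

Lemma split_at_nth (s : list nat) (p : nat) :
  (p < length s)%nat -> s = firstn p s ++ nth p s 0%nat :: skipn (S p) s.
Proof.
revert p; induction s as [|i s IH]; intros [|p] H; simpl in *; try lia; [reflexivity|].
f_equal; rewrite (IH p) at 1 by lia; reflexivity.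
Qed.

Lemma gprod_similar {X Y : CBanach} (T : X -> Y) (Tinv : Y -> X) (lam : Cplx)
  (s : list nat) (A : nat -> X -> X) (y : Y) :
  is_linear T -> is_linear Tinv -> (forall x, Tinv (T x) = x) -> (forall y, T (Tinv y) = y) ->
  (forall i, In i s -> is_linear (A i)) ->
  gprod s (fun i y => lam *v T (A i (Tinv y))) y
    = Cpow lam (length s) *v T (gprod s A (Tinv y)).
Proof.
intros HT HTi H1 H2; induction s as [|i s IH]; simpl; intros HA.
- rewrite H2, vscal_one; reflexivity.
- pose proof (HA i (or_introl eq_refl)) as Hi.
  rewrite IH by auto; linpush; rewrite H1; linpush; vec.
Qed.

(** An inverse of [N - z] is transported by taking its adjoint. In the other direction an inverse
    [S] on [Y] has to be the transported adjoint of something: reflexivity represents the bidual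
    element [f |-> Tinv (S (T f)) x] by a vector [R x], and [R] inverts [N - z]. *)
Lemma spectrum_adjoint {X Y : CBanach} (T : (X -> Cplx) -> Y) (Tinv : Y -> X -> Cplx)
  (N : X -> X) (x0 : X) (z : Cplx) :
  reflexive X -> invertible_from_dual T Tinv -> bounded_op N -> x0 <> vzero ->
  spectrum (fun y => T (fun x => Tinv y (N x))) z <-> spectrum N z.
Proof.
intros Hrefl [Tadd [Tscal [[M HM] [Hfun [Tiadd [Tiscal [[L HL] [HTTi HTiT]]]]]]]] HN Hx0.
pose proof (vnorm_pos x0 Hx0) as Hx0p.
assert (HL0 : forall y : Y, 0 <= L * vnorm y).
{ intros y; specialize (HL y x0); pose proof (Cmod_nonneg (Tinv y x0)); nra. }
assert (Tiopp : forall y, Tinv (vopp y) = fun x => Copp (Tinv y x)).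
{ intros y; rewrite vopp_scal, Tiscal; apply functional_extensionality; intros x; ring. }
assert (HNf : forall f, is_functional f -> is_functional (fun x => f (N x)))
  by (intros f Hf; apply is_functional_comp; assumption).
assert (Hadj : forall y, Tinv (T (fun x => Tinv y (N x)) -v z *v y)
                         = fun x => Tinv y (N x -v z *v x)).
{ intros y; pose proof (Hfun y) as Hy.
  rewrite Tiadd, Tiopp, Tiscal, HTiT by (apply HNf, Hfun).
  apply functional_extensionality; intros x; linpush; reflexivity. }
assert (HM0 : 0 <= M).
{ pose proof (HM _ 1 is_functional_zero) as H; rewrite Rmult_1_r in H.
  apply Rle_trans with (2 := H ltac:(intros x; rewrite Cmod_zero, Rmult_1_l; apply vnorm_nonneg)).
  apply vnorm_nonneg. }
split; intros Hsp.
- intros [R [HR [H1 H2]]]; apply Hsp.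
  assert (HRf : forall y, is_functional (fun x => Tinv y (R x)))
    by (intros y; apply is_functional_comp; [apply Hfun|exact HR]).
  exists (fun y => T (fun x => Tinv y (R x))); split; [split; [split|]|split].
  + intros y y'; rewrite Tiadd; apply Tadd; apply HRf.
  + intros a y; rewrite Tiscal; apply Tscal, HRf.
  + destruct (bounded_op_bound R HR) as [K [HK1 HK]].
    exists (M * (L * K)); intros y.
    replace (M * (L * K) * vnorm y) with (M * (L * vnorm y * K)) by ring.
    apply HM; [apply HRf|]; intros x; apply Rle_trans with (1 := HL y (R x)).
    rewrite (Rmult_assoc (L * vnorm y)); apply Rmult_le_compat_l; [apply HL0|apply HK].
  + intros y; rewrite Hadj; transitivity (T (Tinv y)); [f_equal|apply HTTi].
    apply functional_extensionality; intros x; rewrite H2; reflexivity.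
  + intros y; rewrite HTiT by apply HRf.
    pose proof (Hadj (T (fun x => Tinv y (R x)))) as E.
    rewrite HTiT in E by apply HRf.
    rewrite <- (HTTi (_ -v _)), E; transitivity (T (Tinv y)); [f_equal|apply HTTi].
    apply functional_extensionality; intros x; rewrite H1; reflexivity.
- intros [S [HS [H1 H2]]]; apply Hsp.
  destruct (bounded_op_bound S HS) as [K [HK1 HK]].
  assert (Hb : forall f C x, is_functional f -> dual_norm_le f C ->
    Cmod (Tinv (S (T f)) x) <= Rabs L * K * M * vnorm x * C).
  { intros f C x Hf HC; specialize (HM f C Hf HC); specialize (HK (T f)).
    pose proof (vnorm_nonneg _ x) as Hx; pose proof (Rabs_pos L) as HL1.
    apply Rle_trans with (1 := HL _ _).
    apply Rle_trans with (Rabs L * (K * (M * C)) * vnorm x); [|right; ring].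
    apply Rmult_le_compat_r; [exact Hx|].
    apply Rle_trans with (Rabs L * vnorm (S (T f))).
    - apply Rmult_le_compat_r; [apply vnorm_nonneg|apply Rle_abs].
    - apply Rmult_le_compat_l; [exact HL1|]; apply Rle_trans with (1 := HK).
      apply Rmult_le_compat_l; [lra|exact HM]. }
  assert (Hex : forall x, exists r, forall f, is_functional f -> Tinv (S (T f)) x = f r).
  { intros x; apply (Hrefl (fun f => Tinv (S (T f)) x)).
    - intros f g Hf Hg; rewrite Tadd by assumption; linpush; rewrite Tiadd; reflexivity.
    - intros a f Hf; rewrite Tscal by assumption; linpush; rewrite Tiscal; reflexivity.
    - exists (Rabs L * K * M * vnorm x); intros f C Hf HC; apply Hb; assumption. }
  destruct (choice _ Hex) as [R HR].
  exists R; split; [split; [split|]|split].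
  + intros x x'; apply functional_sep; intros f Hf; linpush; rewrite <- !HR by exact Hf.
    pose proof (Hfun (S (T f))) as Hy; linpush; reflexivity.
  + intros a x; apply functional_sep; intros f Hf; linpush; rewrite <- !HR by exact Hf.
    pose proof (Hfun (S (T f))) as Hy; linpush; reflexivity.
  + exists (Rabs L * K * M); intros x; apply functional_bound_norm; intros f Hf Hf1.
    rewrite <- HR by exact Hf; rewrite <- (Rmult_1_r (_ * vnorm x)).
    apply Hb; [exact Hf|]; intros y; rewrite Rmult_1_l; apply Hf1.
  + intros x; apply functional_sep; intros f Hf; rewrite <- HR by exact Hf.
    change (Tinv (S (T f)) (N x -v z *v x))
      with ((fun x => Tinv (S (T f)) (N x -v z *v x)) x).
    rewrite <- Hadj, H2, HTiT by exact Hf; reflexivity.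
  + intros x; apply functional_sep; intros f Hf; linpush.
    rewrite <- (HR x f Hf), <- (HR x (fun x => f (N x)) (HNf f Hf)).
    pose proof (H1 (T f)) as E; rewrite HTiT in E by exact Hf.
    apply (f_equal (fun y => Tinv y x)) in E; rewrite HTiT in E by exact Hf.
    rewrite <- E; linpush; rewrite Tiadd, Tiopp, Tiscal; reflexivity.
Qed.

Lemma gprod_adjoint {X Y : CBanach} (T : (X -> Cplx) -> Y) (Tinv : Y -> X -> Cplx)
  (lam : Cplx) (s : list nat) (A : nat -> X -> X) (y : Y) :
  invertible_from_dual T Tinv -> (forall i, In i s -> bounded_op (A i)) ->
  gprod s (fun i y => lam *v T (fun x => Tinv y (A i x))) y
    = Cpow lam (length s) *v T (fun x => Tinv y (gprod (rev s) A x)).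
Proof.
intros [Tadd [Tscal [_ [Hfun [Tiadd [Tiscal [_ [HTTi HTiT]]]]]]]].
induction s as [|i s IH]; simpl; intros HA.
- rewrite vscal_one; symmetry; apply HTTi.
- rewrite IH by auto.
  assert (HB : bounded_op (gprod (rev s) A))
    by (apply gprod_bounded; intros j Hj; apply HA; right; apply in_rev, Hj).
  assert (H1 : is_functional (fun x => Tinv y (gprod (rev s) A x)))
    by (apply is_functional_comp; [apply Hfun|exact HB]).
  rewrite Tiscal, HTiT by exact H1.
  rewrite (Tscal _ (fun x => Tinv y (gprod (rev s) A (A i x))))
    by exact (is_functional_comp _ (A i) H1 (HA i (or_introl eq_refl))).
  rewrite vscal_assoc; do 2 f_equal; apply functional_extensionality; intros x.
  rewrite gprod_app; reflexivity.
Qed.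

Lemma invertible_from_dual_trivial {X Y : CBanach} (T : (X -> Cplx) -> Y)
  (Tinv : Y -> X -> Cplx) :
  invertible_from_dual T Tinv -> (forall x : X, x = vzero) -> forall y : Y, y = vzero.
Proof.
intros [_ [Tscal [_ [Hfun [_ [_ [_ [HTTi _]]]]]]]] H y.
rewrite <- (HTTi y).
replace (Tinv y) with (fun x : X => Czero *c Tinv y x).
- rewrite Tscal by apply Hfun; apply vscal_0l.
- apply functional_extensionality; intros x; pose proof (Hfun y) as Hy.
  rewrite (H x); linpush; ring.
Qed.

Lemma peripheral_gprod_adjoint {X Y : CBanach} (T : (X -> Cplx) -> Y)
  (Tinv : Y -> X -> Cplx) (lam : Cplx) (s : list nat) (A : nat -> X -> X)
  (B : nat -> Y -> Y) (x0 : X) (z : Cplx) :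
  reflexive X -> invertible_from_dual T Tinv -> Cpow lam (length s) = Cone -> x0 <> vzero ->
  (forall i, In i s -> bounded_op (A i)) ->
  (forall i, In i s -> B i = fun y => lam *v T (fun x => Tinv y (A i x))) ->
  peripheral_spectrum (gprod s B) z <-> peripheral_spectrum (gprod (rev s) A) z.
Proof.
intros Hrefl HT Hlam Hx0 HA HB.
rewrite (gprod_ext s B _ HB).
replace (gprod s (fun i y => lam *v T (fun x => Tinv y (A i x))))
  with (fun y => T (fun x => Tinv y (gprod (rev s) A x))).
- assert (HN : bounded_op (gprod (rev s) A))
    by (apply gprod_bounded; intros j Hj; apply HA, in_rev, Hj).
  assert (E : forall w, spectrum (fun y => T (fun x => Tinv y (gprod (rev s) A x))) w
    <-> spectrum (gprod (rev s) A) w)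
    by (intros w; apply (spectrum_adjoint T Tinv _ x0); assumption).
  unfold peripheral_spectrum; rewrite E; split; intros [H1 H2]; split; try assumption;
    intros w Hw; apply H2, E, Hw.
- apply functional_extensionality; intros y; rewrite gprod_adjoint, Hlam, vscal_one;
    auto.
Qed.

Lemma peripheral_gprod_similar {X Y : CBanach} (T : X -> Y) (Tinv : Y -> X)
  (lam : Cplx) (s : list nat) (A : nat -> X -> X) (B : nat -> Y -> Y) (z : Cplx) :
  invertible_op T Tinv -> Cpow lam (length s) = Cone ->
  (forall i, In i s -> bounded_op (A i)) ->
  (forall i, In i s -> B i = fun y => lam *v T (A i (Tinv y))) ->
  peripheral_spectrum (gprod s B) z <-> peripheral_spectrum (gprod s A) z.
Proof.
intros [HT [HTi [H1 H2]]] Hlam HA HB; rewrite (gprod_ext s B _ HB).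
replace (gprod s (fun i y => lam *v T (A i (Tinv y))))
  with (fun y => T (gprod s A (Tinv y))).
2: { apply functional_extensionality; intros y.
     rewrite (gprod_similar T Tinv), Hlam, vscal_one; try reflexivity; try assumption;
       [apply HT|apply HTi|intros i Hi; apply HA, Hi]. }
destruct (classic (exists x0 : X, x0 <> vzero)) as [[x0 Hx0]|Hno].
- assert (HN : bounded_op (gprod s A)) by (apply gprod_bounded, HA).
  rewrite (peripheral_comp T (fun y => gprod s A (Tinv y)) (T x0) x0).
  + replace (fun x => gprod s A (Tinv (T x))) with (gprod s A); [reflexivity|].
    apply functional_extensionality; intros x; rewrite H1; reflexivity.
  + exact HT.
  + apply bounded_op_comp; assumption.
  + intros E; apply Hx0; rewrite <- (H1 x0), E; apply (lin_zero (proj1 HTi)).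
  + exact Hx0.
- assert (HX : forall x : X, x = vzero)
    by (intros x; apply NNPP; intros Hx; apply Hno; exists x; exact Hx).
  assert (HY : forall y : Y, y = vzero)
    by (intros y; rewrite <- (H2 y), (HX (Tinv y)); apply (lin_zero (proj1 HT))).
  split; intros [Hs _]; exfalso; revert Hs; apply spectrum_trivial; assumption.
Qed.

(** Up to rotation [s] is the distinguished letter followed by the remaining word [l2 ++ l1], and
    [rev s] is the same letter next to the reversal of that word, which is a palindrome. *)
Lemma peripheral_gprod_rev {X : CBanach} (s : list nat) (A : nat -> X -> X) (x0 : X)
  (z : Cplx) :
  quasi_semi_jordan s -> (forall i, In i s -> bounded_op (A i)) -> x0 <> vzero ->
  peripheral_spectrum (gprod (rev s) A) z <-> peripheral_spectrum (gprod s A) z.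
Proof.
intros [p [Hp [_ Ht]]] HA Hx0; cbv zeta in Ht.
rewrite (split_at_nth s p Hp) in HA |- *.
set (i := nth p s 0%nat) in *; set (l1 := firstn p s) in *; set (l2 := skipn (S p) s) in *.
assert (HA' : forall t, (forall j, In j t -> In j (l1 ++ i :: l2)) ->
  forall j, In j t -> bounded_op (A j)) by (intros t H j Hj; apply HA, H, Hj).
rewrite (peripheral_gprod_rotate l1 (i :: l2) A x0 z HA Hx0).
rewrite rev_app_distr, (peripheral_gprod_rotate (rev (i :: l2)) (rev l1) A x0 z), <- rev_app_distr.
- change ((i :: l2) ++ l1) with ((i :: nil) ++ (l2 ++ l1)).
  rewrite rev_app_distr, <- Ht.
  rewrite (peripheral_gprod_rotate (l2 ++ l1) (rev (i :: nil)) A x0 z); [reflexivity| |exact Hx0].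
  apply HA'; intros j; simpl; rewrite !in_app_iff; simpl; tauto.
- apply HA'; intros j; rewrite <- rev_app_distr; intros Hj; apply in_rev; exact Hj.
- exact Hx0.
Qed.

(** Sufficiency of the two forms. The rotations behind the adjoint case need a nonzero vector; on
    zero spaces both spectra are empty. *)
Lemma preservers_preserve {X1 X2 : CBanach} (A1 : (X1 -> X1) -> Prop) (s : list nat)
  (Phi : (X1 -> X1) -> X2 -> X2) (As : nat -> X1 -> X1) (z : Cplx) :
  (forall T, A1 T -> bounded_op T) -> (forall i, In i s -> A1 (As i)) ->
  ((exists (lam : Cplx) (T : X1 -> X2) (Tinv : X2 -> X1),
      Cpow lam (length s) = Cone /\ invertible_op T Tinv /\
      forall A, A1 A -> Phi A = (fun y => vscal lam (T (A (Tinv y)))))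
   \/
   (reflexive X1 /\ reflexive X2 /\ quasi_semi_jordan s /\
    exists (lam : Cplx) (T : (X1 -> Cplx) -> X2) (Tinv : X2 -> (X1 -> Cplx)),
      Cpow lam (length s) = Cone /\ invertible_from_dual T Tinv /\
      forall A, A1 A -> Phi A = (fun y => vscal lam (T (fun x => Tinv y (A x)))))) ->
  peripheral_spectrum (gprod s (fun j => Phi (As j))) z <->
  peripheral_spectrum (gprod s As) z.
Proof.
intros HA1 HAs [[lam [T [Tinv [Hlam [HT HPhi]]]]]
  |[Hr1 [_ [Hqs [lam [T [Tinv [Hlam [HT HPhi]]]]]]]]].
- apply (peripheral_gprod_similar T Tinv lam); auto.
- destruct (classic (exists x0 : X1, x0 <> vzero)) as [[x0 Hx0]|Hno].
  + rewrite (peripheral_gprod_adjoint T Tinv lam s As _ x0) by auto.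
    apply (peripheral_gprod_rev s As x0); auto.
  + assert (HX : forall x : X1, x = vzero)
      by (intros x; apply NNPP; intros Hx; apply Hno; exists x; exact Hx).
    pose proof (invertible_from_dual_trivial T Tinv HT HX) as HY.
    split; intros [Hs _]; exfalso; revert Hs; apply spectrum_trivial; assumption.
Qed.

(** * Operators of rank one *)

Definition tensor {X Y : CBanach} (y : Y) (f : X -> Cplx) : X -> Y := fun x => f x *v y.

Definition rank_le_one {X Y : CBanach} (A : X -> Y) : Prop :=
  exists y f, is_functional f /\ A = tensor y f.

Lemma tensor_bounded {X Y : CBanach} (y : Y) (f : X -> Cplx) :
  is_functional f -> bounded_op (tensor y f).
Proof. apply bounded_op_rank1. Qed.

Lemma rank_le_two_intro {X Y : CBanach} (f1 f2 : X -> Cplx) (u1 u2 : Y) :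
  rank_le 2 (fun x => f1 x *v u1 +v f2 x *v u2).
Proof.
exists (u1 :: u2 :: nil); split; [reflexivity|]; intros x.
exists (f1 x :: f2 x :: nil); simpl; vec.
Qed.

Lemma tensor_rank_le_two {X Y : CBanach} (y : Y) (f : X -> Cplx) : rank_le 2 (tensor y f).
Proof.
(* [rank_le 2] asks for a list of length exactly two, so [y] is listed a second time with
   coefficient zero. *)
replace (tensor y f) with (fun x : X => f x *v y +v Czero *v y).
- exact (rank_le_two_intro f (fun _ => Czero) y y).
- apply functional_extensionality; intros x; unfold tensor; vec.
Qed.

Lemma functional_zero_one {X : CBanach} (x y : X) :
  (forall c, y <> c *v x) -> exists f, is_functional f /\ f x = Czero /\ f y = Cone.
Proof.
intros Hxy; destruct (classic (x = vzero)) as [->|Hx].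
- destruct (functional_one y) as [f [Hf E]].
  + intros E; apply (Hxy Czero); rewrite E; vec.
  + exists f; split; [exact Hf|split; [linpush; reflexivity|exact E]].
- destruct (functional_one x Hx) as [g [Hg Eg]].
  destruct (functional_one (y -v g y *v x)) as [h [Hh Eh]].
  { intros E; apply (Hxy (g y)), vsub_eq0, E. }
  exists (fun v => h v +c Copp (h x) *c g v); split; [|split].
  + apply is_functional_add; [exact Hh|apply is_functional_scal, Hg].
  + rewrite Eg; ring.
  + revert Eh; linpush; intros <-; ring.
Qed.

Lemma functional_one_nonzero {X : CBanach} (x w : X) :
  x <> vzero -> w <> vzero -> exists f, is_functional f /\ f x = Cone /\ f w <> Czero.
Proof.
intros Hx Hw; destruct (functional_one x Hx) as [g [Hg Eg]].
destruct (classic (g w = Czero)) as [E|E]; [|exists g; auto].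
destruct (functional_one w Hw) as [h [Hh Eh]].
destruct (classic (h x = Czero)) as [E'|E'].
- exists (fun v => g v +c h v); split; [apply is_functional_add; assumption|].
  rewrite Eg, Eh, E, E'; split; [ring|].
  replace (Czero +c Cone) with Cone by ring; apply Cone_neq0.
- exists (fun v => Cinv (h x) *c h v); split; [apply is_functional_scal, Hh|].
  rewrite Eh; split; [field; exact E'|]; intros E2; apply Cone_neq0.
  replace Cone with (h x *c (Cinv (h x) *c Cone)) by (field; exact E').
  rewrite E2; ring.
Qed.

Lemma range_in_line {X Y : CBanach} (A : X -> Y) (y : Y) :
  bounded_op A -> (forall x, exists c, A x = c *v y) -> rank_le_one A.
Proof.
intros HA H; destruct (classic (y = vzero)) as [->|Hy].
- exists vzero, (fun _ => Czero); split; [apply is_functional_zero|].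
  apply functional_extensionality; intros x; destruct (H x) as [c ->]; unfold tensor; vec.
- destruct (functional_one y Hy) as [g [Hg E]].
  exists y, (fun x => g (A x)); split; [apply is_functional_comp; assumption|].
  apply functional_extensionality; intros x; unfold tensor.
  destruct (H x) as [c ->]; linpush; rewrite E; vec.
Qed.

Lemma rank_gt_one_independent {X Y : CBanach} (A : X -> Y) :
  bounded_op A -> ~ rank_le_one A ->
  exists x1 x2, A x1 <> vzero /\ forall c, A x2 <> c *v A x1.
Proof.
intros HA Hr; apply NNPP; intros Hno; apply Hr.
destruct (classic (exists x1, A x1 <> vzero)) as [[x1 Hx1]|H0].
- apply (range_in_line A (A x1) HA); intros x2; apply NNPP; intros H.
  apply Hno; exists x1, x2; split; [exact Hx1|]; intros c E; apply H; exists c; exact E.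
- apply (range_in_line A vzero HA); intros x; exists Czero; apply NNPP; intros E.
  apply H0; exists x; intros E'; apply E; rewrite E'; vec.
Qed.

(** The cubic relation confines the spectrum to [0], [c] and [- c], and the last two are eigenvalues
    of the same modulus. *)
Lemma peripheral_cubic {X : CBanach} (N : X -> X) (c : Cplx) (e1 e2 : X) :
  bounded_op N -> c <> Czero -> (forall v, N (N (N v)) = c *c c *v N v) ->
  e1 <> vzero -> N e1 = c *v e1 -> e2 <> vzero -> N e2 = Copp c *v e2 ->
  peripheral_spectrum N c /\ peripheral_spectrum N (Copp c).
Proof.
intros HN Hc Hcub He1 E1 He2 E2.
assert (Hout : forall w, spectrum N w -> Cmod w <= Cmod c).
{ intros w Hw; apply NNPP; intros Hlt; apply Hw.
  assert (Hw0 : w <> Czero).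
  { intros ->; apply Hlt; rewrite Cmod_zero; apply Cmod_nonneg. }
  assert (Hwc : w *c w -c c *c c <> Czero).
  { intros E; destruct (Cmul_eq0 (w -c c) (w +c c)) as [E'|E'].
    - rewrite <- E; ring.
    - apply Hlt; rewrite (Csub_eq0 _ _ E'); lra.
    - apply Hlt; replace w with (Copp c); [rewrite Cmod_opp; lra|].
      symmetry; apply Csub_eq0; rewrite <- E'; ring. }
  (* The cubic relation gives [(N - w) (N^2 + w N + (w^2 - c^2)) = - w (w^2 - c^2)]. *)
  pose (a := Copp (Cinv (w *c (w *c w -c c *c c)))).
  exists (fun v => a *v (N (N v) +v (w *v N v +v (w *c w -c c *c c) *v v))).
  split; [|split].
  - apply bounded_op_scal, bounded_op_add; [apply bounded_op_comp; exact HN|].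
    apply bounded_op_add; apply bounded_op_scal; [exact HN|apply bounded_op_id].
  - intros v; unfold a; linpush; rewrite Hcub; vec_coefs; field; auto.
  - intros v; unfold a; linpush; rewrite Hcub; vec_coefs; field; auto. }
split; (split; [|intros w Hw; rewrite ?Cmod_opp; exact (Hout w Hw)]).
- exact (spectrum_eigenvalue N c e1 He1 E1).
- exact (spectrum_eigenvalue N (Copp c) e2 He2 E2).
Qed.

Lemma iter_diag {X : CBanach} (u1 u2 : X) (f1 f2 : X -> Cplx) (a : Cplx) (n : nat) (v : X) :
  is_functional f1 -> is_functional f2 ->
  f1 u1 = Cone -> f1 u2 = Czero -> f2 u1 = Czero -> f2 u2 = Cone ->
  Nat.iter (S n) (fun v => f1 v *v u1 +v f2 v *v (a *v u2)) v
    = f1 v *v u1 +v (Cpow a (S n) *c f2 v) *v u2.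
Proof.
intros Hf1 Hf2 E11 E12 E21 E22; induction n as [|n IH].
- simpl; vec.
- change (Nat.iter (S (S n)) ?g v) with (g (Nat.iter (S n) g v)); rewrite IH.
  cbn [Cpow]; linpush; rewrite E11, E12, E21, E22; vec.
Qed.

Lemma iter_shear {X : CBanach} (u1 u2 : X) (f1 f2 : X -> Cplx) (a : Cplx) (n : nat) (v : X) :
  is_functional f1 -> is_functional f2 ->
  f1 u1 = Cone -> f1 u2 = Czero -> f2 u1 = Czero -> f2 u2 = Cone ->
  Nat.iter (S n) (fun v => f1 v *v u1 +v f2 v *v (a *v u1 +v u2)) v
    = (f1 v +c Creal (INR (S n)) *c a *c f2 v) *v u1 +v f2 v *v u2.
Proof.
intros Hf1 Hf2 E11 E12 E21 E22; induction n as [|n IH].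
- simpl Nat.iter; change (Creal (INR 1)) with Cone; vec.
- change (Nat.iter (S (S n)) ?g v) with (g (Nat.iter (S n) g v)); rewrite IH.
  replace (Creal (INR (S (S n)))) with (Creal (INR (S n)) +c Cone)
    by (rewrite (S_INR (S n)); apply Cplx_eq; simpl; ring).
  linpush; rewrite E11, E12, E21, E22; vec.
Qed.

Lemma Creal_INR_S_neq0 (n : nat) : Creal (INR (S n)) <> Czero.
Proof.
intros E; apply (f_equal fst) in E; revert E; apply not_0_INR; discriminate.
Qed.

Lemma Csub_swap_neq (c : Cplx) : c <> Czero -> c <> Copp c.
Proof.
intros Hc E; apply Hc; apply (f_equal (Cadd c)) in E.
replace (c +c Copp c) with Czero in E by ring.
apply Cplx_eq; [apply (f_equal fst) in E|apply (f_equal snd) in E]; simpl in *; lra.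
Qed.

Lemma iter_bounded {X : CBanach} (B : X -> X) (n : nat) :
  bounded_op B -> bounded_op (Nat.iter n B).
Proof.
intros HB; induction n as [|n IH]; [apply bounded_op_id|].
exact (bounded_op_comp B (Nat.iter n B) HB IH).
Qed.

(** On independent [u1], [u2] the operator is multiplication by one scalar [c]. If [B] fixes [u1]
    and multiplies [u2] by [a] with [a^(n+1) = -1], then [A B^(n+1)] has the eigenvalues [c] and
    [- c]. *)
Lemma two_peripheral_scalar {X : CBanach} (A : X -> X) (n : nat) :
  bounded_op A -> ~ rank_le_one A -> (forall x, exists c, A x = c *v x) ->
  exists B z1 z2, bounded_op B /\ rank_le 2 B /\ z1 <> z2 /\
    peripheral_spectrum (fun v => A (Nat.iter (S n) B v)) z1 /\
    peripheral_spectrum (fun v => A (Nat.iter (S n) B v)) z2.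
Proof.
intros HA Hr Hs; destruct (rank_gt_one_independent A HA Hr) as [u1 [u2 [H1 H2]]].
destruct (Hs u1) as [c E1], (Hs u2) as [c2 E2], (Hs (u1 +v u2)) as [c3 E3].
assert (Hc : c <> Czero) by (intros ->; apply H1; rewrite E1; vec).
assert (Hu : forall d, u2 <> d *v u1).
{ intros d E; apply (H2 d); rewrite E; linpush; reflexivity. }
destruct (functional_zero_one u1 u2 Hu) as [f2 [Hf2 [E21 E22]]].
destruct (functional_zero_one u2 u1) as [f1 [Hf1 [E12 E11]]].
{ intros d E; destruct (classic (d = Czero)) as [->|Hd].
  - apply H1; rewrite E; linpush; vec.
  - apply (Hu (Cinv d)); rewrite E; vec_coefs; field; exact Hd. }
assert (Ec : c2 = c).
{ rewrite (lin_add (proj1 HA)), E1, E2 in E3.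
  pose proof (f_equal f1 E3) as F1; pose proof (f_equal f2 E3) as F2.
  revert F1 F2; linpush; rewrite E11, E12, E21, E22; intros F1 F2.
  transitivity c3; [|symmetry]; ring [F1 F2]. }
subst c2.
destruct (Croot (Copp Cone) n) as [a Ha].
pose (B := fun v => f1 v *v u1 +v f2 v *v (a *v u2)).
assert (HB : bounded_op B) by (apply bounded_op_add; apply bounded_op_rank1; assumption).
assert (HN : (fun v => A (Nat.iter (S n) B v)) =
  fun v => (c *c f1 v) *v u1 +v (Copp c *c f2 v) *v u2).
{ apply functional_extensionality; intros v; unfold B.
  rewrite iter_diag, Ha by assumption; linpush; rewrite E1, E2; vec. }
assert (Hu1 : u1 <> vzero).
{ intros E; apply Cone_neq0; rewrite <- E11, E; apply fun_zero, Hf1. }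
assert (Hu2 : u2 <> vzero).
{ intros E; apply Cone_neq0; rewrite <- E22, E; apply fun_zero, Hf2. }
exists B, c, (Copp c); split; [exact HB|split; [apply rank_le_two_intro|]].
split; [apply Csub_swap_neq, Hc|]; rewrite HN.
apply (peripheral_cubic _ c u1 u2); try assumption.
- rewrite <- HN; apply bounded_op_comp; [exact HA|apply iter_bounded, HB].
- intros v; linpush; rewrite E11, E12, E21, E22; vec.
- rewrite E11, E21; vec.
- rewrite E12, E22; vec.
Qed.

(** On the plane of [x] and a suitable [u] the compression of [A] has an invertible matrix with rows
    [M11 M12] and [1 M22]. Multiplying it by a shear keeps the determinant and, thanks to the entry
    1, shifts the trace at will. With trace zero its square is the scalar [c^2 = - det]. Shears have
    [n+1]-st roots that are shears, which supplies [B]. *)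
Lemma two_peripheral_nonscalar {X : CBanach} (A : X -> X) (x : X) (n : nat) :
  bounded_op A -> ~ rank_le_one A -> (forall c, A x <> c *v x) ->
  exists B z1 z2, bounded_op B /\ rank_le 2 B /\ z1 <> z2 /\
    peripheral_spectrum (fun v => A (Nat.iter (S n) B v)) z1 /\
    peripheral_spectrum (fun v => A (Nat.iter (S n) B v)) z2.
Proof.
intros HA Hr Hx.
assert (Hx0 : x <> vzero) by (intros E; apply (Hx Czero); rewrite E; linpush; vec).
destruct (functional_zero_one x (A x) Hx) as [f2 [Hf2 [E21 M21]]].
(* Otherwise [A] maps every vector with [f2 = 1] into the line of [A x]. Adding a multiple of [A x]
   brings any vector to [f2 = 1], so all of the range would lie in that line. *)
assert (Hu : exists u, f2 u = Cone /\ forall c, A u <> c *v A x).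
{ apply NNPP; intros Hno; apply Hr.
  assert (Hline : forall u, f2 u = Cone -> exists c, A u = c *v A x).
  { intros u E; apply NNPP; intros H; apply Hno; exists u; split; [exact E|].
    intros c Ec; apply H; exists c; exact Ec. }
  apply (range_in_line A (A x) HA); intros v.
  destruct (Hline (A x) M21) as [c1 Ec1].
  destruct (Hline (v +v (Cone -c f2 v) *v A x)) as [c2 Ec2].
  { linpush; rewrite M21; ring. }
  exists (c2 -c (Cone -c f2 v) *c c1).
  replace (A v) with (A (v +v (Cone -c f2 v) *v A x) -v (Cone -c f2 v) *v A (A x))
    by (linpush; vec).
  rewrite Ec2, Ec1; vec. }
destruct Hu as [u [E22 Hu]].
(* [f2] vanishes at this vector, so [f1] and [h] agree on it, and their value is the determinant of
   the compression. *)
assert (Hw : f2 (A u) *v A x -v A u <> vzero).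
{ intros E; apply (Hu (f2 (A u))); symmetry; apply vsub_eq0, E. }
destruct (functional_one_nonzero x _ Hx0 Hw) as [h [Hh [Eh Ehw]]].
pose (f1 := fun v => h v +c Copp (h u) *c f2 v).
assert (Hf1 : is_functional f1)
  by (apply is_functional_add; [exact Hh|apply is_functional_scal, Hf2]).
assert (E11 : f1 x = Cone) by (unfold f1; rewrite Eh, E21; ring).
assert (E12 : f1 u = Czero) by (unfold f1; rewrite E22; ring).
assert (Hdet : f1 (A x) *c f2 (A u) -c f1 (A u) <> Czero).
{ intros E; apply Ehw; rewrite <- E; unfold f1; linpush; rewrite M21; ring. }
set (M11 := f1 (A x)) in *; set (M12 := f1 (A u)) in *; set (M22 := f2 (A u)) in *.
destruct (Croot (Copp (M11 *c M22 -c M12)) 1) as [c Hc].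
assert (Hc2 : c *c c = M12 -c M11 *c M22).
{ transitivity (Cpow c 2); [simpl; ring|rewrite Hc; ring]. }
assert (Hc0 : c <> Czero).
{ intros E; apply Hdet; rewrite E in Hc2.
  replace (M11 *c M22 -c M12) with (Copp (M12 -c M11 *c M22)) by ring.
  rewrite <- Hc2; ring. }
(* The shear entry of [B^(n+1)] that makes the trace of the product zero. *)
pose (nu := Copp (M11 +c M22)).
pose (a := nu *c Cinv (Creal (INR (S n)))).
assert (Ha : Creal (INR (S n)) *c a = nu) by (unfold a; field; apply Creal_INR_S_neq0).
pose (B := fun v => f1 v *v x +v f2 v *v (a *v x +v u)).
assert (HB : bounded_op B) by (apply bounded_op_add; apply bounded_op_rank1; assumption).
pose proof (iter_bounded B (S n) HB) as HBn.
pose (N := fun v => (f1 (A v) +c nu *c f2 (A v)) *v x +v f2 (A v) *v u).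
assert (HN : (fun v => Nat.iter (S n) B (A v)) = N).
{ apply functional_extensionality; intros v; unfold B, N.
  rewrite iter_shear, Ha by assumption; reflexivity. }
assert (HNb : bounded_op N) by (rewrite <- HN; exact (bounded_op_comp _ A HBn HA)).
assert (HNx : N x = (M11 +c nu) *v x +v u).
{ unfold N; fold M11; rewrite M21; vec. }
assert (HNu : N u = (M12 +c nu *c M22) *v x +v M22 *v u) by reflexivity.
assert (HNNx : N (N x) = c *c c *v x).
{ rewrite HNx; linpush; rewrite HNx, HNu, Hc2; unfold nu; vec. }
assert (HNNu : N (N u) = c *c c *v u).
{ rewrite HNu; linpush; rewrite HNx, HNu, Hc2; unfold nu; vec. }
assert (HNe : forall b, N x +v b *v x <> vzero).
{ intros b E; apply (f_equal f2) in E; revert E; rewrite HNx; linpush; rewrite E21, E22.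
  intros E; apply Cone_neq0; rewrite <- E; ring. }
assert (Hper : peripheral_spectrum N c /\ peripheral_spectrum N (Copp c)).
{ apply (peripheral_cubic N c (N x +v c *v x) (N x +v Copp c *v x)); try assumption.
  - intros v.
    transitivity (N (N ((f1 (A v) +c nu *c f2 (A v)) *v x +v f2 (A v) *v u)));
      [reflexivity|].
    linpush; rewrite HNNx, HNNu; unfold N; vec.
  - apply HNe.
  - linpush; rewrite HNNx; vec.
  - apply HNe.
  - linpush; rewrite HNNx; vec. }
exists B, c, (Copp c); split; [exact HB|split; [apply rank_le_two_intro|]].
split; [apply Csub_swap_neq, Hc0|].
rewrite <- HN in Hper; destruct Hper as [P1 P2].
(* The computation was done for [B^(n+1) A], whose range lies in the plane; rotation passes to
   [A B^(n+1)]. *)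
split; apply (peripheral_comp_imp (Nat.iter (S n) B) A x); assumption.
Qed.

Lemma two_peripheral {X : CBanach} (A : X -> X) (n : nat) :
  bounded_op A -> ~ rank_le_one A ->
  exists B z1 z2, bounded_op B /\ rank_le 2 B /\ z1 <> z2 /\
    peripheral_spectrum (fun v => A (Nat.iter (S n) B v)) z1 /\
    peripheral_spectrum (fun v => A (Nat.iter (S n) B v)) z2.
Proof.
intros HA Hr; destruct (classic (forall x, exists c, A x = c *v x)) as [H|H].
- apply two_peripheral_scalar; assumption.
- apply not_all_ex_not in H; destruct H as [x Hx].
  apply (two_peripheral_nonscalar A x); try assumption.
  intros c E; apply Hx; exists c; exact E.
Qed.

Lemma iter_tensor {X : CBanach} (x : X) (f : X -> Cplx) (n : nat) (v : X) :
  is_functional f -> Nat.iter (S n) (tensor x f) v = (Cpow (f x) n *c f v) *v x.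
Proof.
intros Hf; induction n as [|n IH].
- unfold tensor; simpl; vec.
- change (Nat.iter (S (S n)) (tensor x f) v) with (tensor x f (Nat.iter (S n) (tensor x f) v)).
  rewrite IH; unfold tensor; cbn [Cpow]; linpush; vec.
Qed.

Lemma peripheral_tensor_power {X : CBanach} (A : X -> X) (x x0 : X) (f : X -> Cplx) (n : nat)
  (z : Cplx) :
  bounded_op A -> is_functional f -> x0 <> vzero ->
  peripheral_spectrum (fun v => A (Nat.iter (S n) (tensor x f) v)) z
    <-> z = f (A x) *c Cpow (f x) n.
Proof.
intros HA Hf Hx0.
replace (fun v => A (Nat.iter (S n) (tensor x f) v))
  with (fun v => f v *v (Cpow (f x) n *v A x)).
- rewrite (peripheral_rank_one f _ x0) by assumption; linpush.
  replace (Cpow (f x) n *c f (A x)) with (f (A x) *c Cpow (f x) n) by ring; reflexivity.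
- apply functional_extensionality; intros v; rewrite iter_tensor by exact Hf; linpush; vec.
Qed.

Lemma peripheral_rank_le_one {X : CBanach} (A B : X -> X) (n : nat) (x0 : X) (z1 z2 : Cplx) :
  rank_le_one A -> bounded_op B -> x0 <> vzero ->
  peripheral_spectrum (fun v => A (Nat.iter n B v)) z1 ->
  peripheral_spectrum (fun v => A (Nat.iter n B v)) z2 -> z1 = z2.
Proof.
intros [y [f [Hf ->]]] HB Hx0; unfold tensor.
assert (Hg : is_functional (fun v => f (Nat.iter n B v)))
  by (apply is_functional_comp; [exact Hf|apply iter_bounded, HB]).
rewrite !(peripheral_rank_one _ y x0 _ Hg Hx0); congruence.
Qed.

(** If [f x = 0] but [f y <> 0], then [f] is nonzero at both [x + y] and [y], and [x] is their
    difference. This removes the restriction that comes from the factor [(f x)^n] in the trace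
    identity. *)
Lemma pairing_vanish {X : CBanach} (d : X -> (X -> Cplx) -> Cplx) :
  (forall x y f, is_functional f -> d (x +v y) f = d x f +c d y f) ->
  (forall x, d x (fun _ => Czero) = Czero) ->
  (forall x f, is_functional f -> f x <> Czero -> d x f = Czero) ->
  forall x f, is_functional f -> d x f = Czero.
Proof.
intros Hadd H0 Hd x f Hf; destruct (classic (f x = Czero)) as [E|E]; [|auto].
destruct (classic (exists y, f y <> Czero)) as [[y Hy]|Hno].
- assert (Hxy : f (x +v y) <> Czero).
  { linpush; rewrite E; intros E2; apply Hy; rewrite <- E2; ring. }
  pose proof (Hadd x y f Hf) as H.
  rewrite (Hd _ _ Hf Hxy), (Hd _ _ Hf Hy) in H.
  rewrite H; ring.
- replace f with (fun _ : X => Czero); [apply H0|].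
  apply functional_extensionality; intros y; symmetry; apply NNPP; intros Hy.
  apply Hno; exists y; exact Hy.
Qed.

Lemma op_vanish {X : CBanach} (S : X -> X) :
  is_linear S ->
  (forall x f, is_functional f -> f x <> Czero -> f (S x) = Czero) ->
  forall x, S x = vzero.
Proof.
intros HS H x; apply functional_sep; intros f Hf; linpush.
apply (pairing_vanish (fun x f => f (S x))); auto.
intros y z g Hg; linpush; reflexivity.
Qed.

(* The powers only serve to make [b] vanish wherever the duality pairing does. *)
Lemma pairing_proportional {X : CBanach} (b : X -> (X -> Cplx) -> Cplx) (m : nat)
  (x0 : X) (f0 : X -> Cplx) :
  (forall f, is_functional f -> forall x y, b (x +v y) f = b x f +c b y f) ->
  (forall f, is_functional f -> forall a x, b (a *v x) f = a *c b x f) ->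
  (forall x f g, is_functional f -> is_functional g ->
     b x (fun v => f v +c g v) = b x f +c b x g) ->
  (forall x a f, is_functional f -> b x (fun v => a *c f v) = a *c b x f) ->
  (forall x f, is_functional f -> Cpow (b x f) m = Cpow (f x) m) ->
  (0 < m)%nat -> is_functional f0 -> f0 x0 = Cone ->
  Cpow (b x0 f0) m = Cone /\
  forall x f, is_functional f -> b x f = b x0 f0 *c f x.
Proof.
intros Hax Hsx Haf Hsf Hpow Hm Hf0 E0; split; [rewrite Hpow, E0 by exact Hf0; apply Cpow_one|].
assert (Hvan : forall x f, is_functional f -> f x = Czero -> b x f = Czero).
{ intros x f Hf E; apply (Cpow_eq0 _ m); rewrite Hpow, E by exact Hf.
  destruct m; [lia|apply Cpow_zero]. }
(* [f - f x0 * f0] vanishes at [x0]. *)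
assert (Hrow : forall f, is_functional f -> b x0 f = b x0 f0 *c f x0).
{ intros f Hf.
  assert (Hg : is_functional (fun v => Copp (f x0) *c f0 v)) by (apply is_functional_scal, Hf0).
  pose proof (Haf x0 f _ Hf Hg) as H; rewrite (Hsf x0 _ f0 Hf0) in H.
  rewrite Hvan in H.
  - apply Csub_eq0; rewrite H; ring.
  - apply is_functional_add; assumption.
  - rewrite E0; ring. }
(* [f] vanishes at [f x0 * x - f x * x0]. *)
assert (Hnz : forall x f, is_functional f -> f x0 <> Czero -> b x f = b x0 f0 *c f x).
{ intros x f Hf Hfx.
  pose proof (Hax f Hf (f x0 *v x) (Copp (f x) *v x0)) as H.
  rewrite !(Hsx f Hf), (Hrow f Hf), Hvan in H.
  - replace (b x f) with (Cinv (f x0) *c (f x0 *c b x f)) by (field; exact Hfx).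
    replace (f x0 *c b x f) with (f x0 *c (b x0 f0 *c f x)); [field; exact Hfx|].
    symmetry; apply Csub_eq0; rewrite H; ring.
  - exact Hf.
  - linpush; ring. }
intros x f Hf; destruct (classic (f x0 = Czero)) as [E|E]; [|auto].
(* Both [f + f0] and [f0] take the value 1 at [x0], and [f] is their difference. *)
pose proof (Hnz x (fun v => f v +c f0 v) (is_functional_add _ _ Hf Hf0)) as H.
cbv beta in H; rewrite E, E0, Haf, (Hnz x f0 Hf0) in H by (auto || (rewrite E0; apply Cone_neq0)).
apply Csub_eq0; replace (b x f) with ((b x f +c b x0 f0 *c f0 x) -c b x0 f0 *c f0 x) by ring.
rewrite H; [ring|].
replace (Czero +c Cone) with Cone by ring; apply Cone_neq0.
Qed.

(** * Linear preservers of rank one *)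

Lemma tensor_add_l {X Y : CBanach} (y y' : Y) (f : X -> Cplx) :
  tensor (y +v y') f = fun x => tensor y f x +v tensor y' f x.
Proof. apply functional_extensionality; intros x; unfold tensor; vec. Qed.

Lemma tensor_add_r {X Y : CBanach} (y : Y) (f g : X -> Cplx) :
  tensor y (fun v => f v +c g v) = fun x => tensor y f x +v tensor y g x.
Proof. apply functional_extensionality; intros x; unfold tensor; vec. Qed.

Lemma tensor_scal_l {X Y : CBanach} (a : Cplx) (y : Y) (f : X -> Cplx) :
  tensor (a *v y) f = fun x => a *v tensor y f x.
Proof. apply functional_extensionality; intros x; unfold tensor; vec. Qed.

Lemma tensor_scal_r {X Y : CBanach} (a : Cplx) (y : Y) (f : X -> Cplx) :
  tensor y (fun v => a *c f v) = fun x => a *v tensor y f x.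
Proof. apply functional_extensionality; intros x; unfold tensor; vec. Qed.

Lemma tensor_inj_l {X Y : CBanach} (y y' : Y) (f : X -> Cplx) (v : X) :
  f v = Cone -> tensor y f = tensor y' f -> y = y'.
Proof.
intros E H; apply (f_equal (fun A => A v)) in H; unfold tensor in H.
rewrite E, !vscal_one in H; exact H.
Qed.

Lemma tensor_inj_r {X Y : CBanach} (y : Y) (f g : X -> Cplx) :
  y <> vzero -> tensor y f = tensor y g -> f = g.
Proof.
intros Hy H; apply functional_extensionality; intros x.
apply (f_equal (fun A => A x)) in H; unfold tensor in H.
destruct (vscal_eq0 (f x -c g x) y) as [E|E].
- transitivity (f x *v y -v g x *v y); [vec|]; rewrite H; vec.
- apply Csub_eq0, E.
- destruct (Hy E).
Qed.

(** Adjacency of operators of rank one: if [y] is off the line of [y0], a functional that kills [y0]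
    but not [y] shows that [g] is a multiple of the row [k] of the sum, and then [g0] is one of
    [g]. *)
Lemma rank_le_one_tensor_sum {X Y : CBanach} (y y0 : Y) (g g0 : X -> Cplx) (v0 : X) :
  y0 <> vzero -> g0 v0 <> Czero ->
  rank_le_one (fun v => tensor y g v +v tensor y0 g0 v) ->
  (exists c, y = c *v y0) \/ (exists c, g = fun v => c *c g0 v).
Proof.
intros Hy0 Hg0 [u [k [Hk E]]].
destruct (classic (exists c, y = c *v y0)) as [|Hno]; [auto|right].
assert (E' : forall v, g v *v y +v g0 v *v y0 = k v *v u)
  by (intros v; exact (f_equal (fun A => A v) E)).
destruct (functional_zero_one y0 y) as [h [Hh [Eh0 Eh]]].
{ intros c Ec; apply Hno; exists c; exact Ec. }
assert (E1 : forall v, g v = k v *c h u).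
{ intros v; rewrite <- (fun_scal Hh), <- E'; linpush; rewrite Eh, Eh0; ring. }
destruct (classic (h u = Czero)) as [Hu|Hu].
{ exists Czero; apply functional_extensionality; intros v; rewrite E1, Hu; ring. }
destruct (functional_one y0 Hy0) as [l [Hl El]].
pose (d := Cinv (h u) *c l u -c l y).
assert (E2 : forall v, g0 v = d *c g v).
{ intros v; pose proof (f_equal l (E' v)) as H; revert H; linpush; rewrite El; intros H.
  replace (k v) with (Cinv (h u) *c g v) in H by (rewrite E1; field; exact Hu).
  replace (g0 v) with ((g v *c l y +c g0 v *c Cone) -c g v *c l y) by ring.
  rewrite H; unfold d; ring. }
assert (Hd : d <> Czero) by (intros Hd; apply Hg0; rewrite E2, Hd; ring).
exists (Cinv d); apply functional_extensionality; intros v; rewrite E2; field; exact Hd.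
Qed.

(** The fourth corner of the rectangle with corners [y0 (x) g0], [y1 (x) g0], [y0 (x) g1]. Adjacency
    to the last two leaves only multiples of [y1 (x) g1] or of [y0 (x) g0]; the latter are excluded,
    and the rank of the sum of all four fixes the multiple. *)
Lemma rank_one_completion {X Y : CBanach} (y0 y1 y : Y) (g0 g1 g : X -> Cplx) (v0 v1 : X) :
  y0 <> vzero -> g0 v0 <> Czero -> g1 v1 <> Czero ->
  (forall c, y1 <> c *v y0) -> (forall c, g1 <> fun v => c *c g0 v) ->
  (forall c, tensor y g <> fun v => c *v tensor y0 g0 v) ->
  rank_le_one (fun v => tensor y g v +v tensor y1 g0 v) ->
  rank_le_one (fun v => tensor y g v +v tensor y0 g1 v) ->
  rank_le_one (fun v => tensor y g v +v
     (tensor y1 g0 v +v (tensor y0 g1 v +v tensor y0 g0 v))) ->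
  tensor y g = tensor y1 g1.
Proof.
intros Hy0 Hg0 Hg1 Hy Hg Hne R1 R2 R3.
assert (Hy1 : y1 <> vzero) by (intros E; apply (Hy Czero); rewrite E; vec).
assert (Hy' : forall a b, a *v y1 = b *v y0 -> a = Czero).
{ intros a b E; apply NNPP; intros Ha; apply (Hy (Cinv a *c b)).
  transitivity (Cinv a *v (a *v y1)); [vec_coefs; field; exact Ha|rewrite E; vec]. }
assert (Hz : y <> vzero).
{ intros ->; apply (Hne Czero); apply functional_extensionality; intros v; unfold tensor; vec. }
destruct (rank_le_one_tensor_sum y y1 g g0 v0 Hy1 Hg0 R1) as [[a Ea]|[a Ea]];
destruct (rank_le_one_tensor_sum y y0 g g1 v1 Hy0 Hg1 R2) as [[b Eb]|[b Eb]].
- exfalso; apply Hz; rewrite Ea, (Hy' a b) by congruence; vec.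
- subst y g; clear R1 R2.
  (* The sum of the four is [(a b y1 + y0) (x) g1 + (y0 + y1) (x) g0]. As [g1] is not a multiple of
     [g0], the two vectors are proportional. *)
  assert (E : a *c b = Cone).
  { destruct (rank_le_one_tensor_sum ((a *c b) *v y1 +v y0) (y0 +v y1) g1 g0 v0)
      as [[d Ed]|[d Ed]].
    - intros E; apply (Hy (Copp Cone)); apply vsub_eq0.
      rewrite <- E; vec.
    - exact Hg0.
    - replace (fun v => _) with (fun v => tensor (a *v y1) (fun v => b *c g1 v) v +v
        (tensor y1 g0 v +v (tensor y0 g1 v +v tensor y0 g0 v))); [exact R3|].
      apply functional_extensionality; intros v; unfold tensor; vec.
    - assert (E1 : (a *c b -c d) *v y1 = (d -c Cone) *v y0).
      { apply vsub_eq0; transitivity (((a *c b) *v y1 +v y0) -v d *v (y0 +v y1));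
          [vec|rewrite Ed; vec]. }
      pose proof (Hy' _ _ E1) as E2; rewrite E2, vscal_0l in E1.
      destruct (vscal_eq0 (d -c Cone) y0 (eq_sym E1)) as [E3|E3]; [|destruct (Hy0 E3)].
      rewrite (Csub_eq0 _ _ E2); apply Csub_eq0, E3.
    - destruct (Hg d Ed). }
  apply functional_extensionality; intros v; unfold tensor.
  rewrite vscal_assoc; f_equal; transitivity (a *c b *c g1 v); [ring|rewrite E; ring].
- exfalso; apply (Hne (a *c b)); subst y g; apply functional_extensionality; intros v.
  unfold tensor; vec.
- exfalso; destruct (classic (b = Czero)) as [E|E].
  + apply (Hne Czero); apply functional_extensionality; intros v; unfold tensor.
    rewrite Eb, E; vec.
  + apply (Hg (Cinv b *c a)); apply functional_extensionality; intros v.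
    transitivity (Cinv b *c g v); [rewrite Eb; field; exact E|rewrite Ea; ring].
Qed.

(* The argument by which a vector space is not the union of two proper subspaces. *)
Lemma union_of_two {V : Type} (K P Q : V -> Prop) (add : V -> V -> V) :
  (forall A B, K A -> K B -> K (add A B)) ->
  (forall A, K A -> P A \/ Q A) ->
  (forall A B, K A -> K B -> P (add A B) -> P A -> P B) ->
  (forall A B, K A -> K B -> Q (add A B) -> Q B -> Q A) ->
  (forall A, K A -> P A) \/ (forall A, K A -> Q A).
Proof.
intros Hadd HPQ HP HQ.
destruct (classic (forall A, K A -> P A)) as [|H]; [auto|right].
apply not_all_ex_not in H; destruct H as [B H].
apply imply_to_and in H; destruct H as [HB HnP].
assert (HQB : Q B) by (destruct (HPQ B HB); tauto).
intros A HA; destruct (HPQ A HA) as [HPA|HQA]; [|exact HQA].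
destruct (HPQ _ (Hadd A B HA HB)) as [H|H].
- destruct (HnP (HP A B HA HB H HPA)).
- exact (HQ A B HA HB H HQB).
Qed.

(** * Maps preserving the peripheral spectrum of [A B^(n+1)], where [m = n + 2] *)

Section Preserver.
Context {X1 X2 : CBanach} (A1 : (X1 -> X1) -> Prop) (Phi : (X1 -> X1) -> X2 -> X2) (n : nat)
  (x0 : X1) (w0 : X2).
Hypothesis A1_bounded : forall A, A1 A -> bounded_op A.
Hypothesis A1_add : forall A B, A1 A -> A1 B -> A1 (fun x => A x +v B x).
Hypothesis A1_scal : forall a A, A1 A -> A1 (fun x => a *v A x).
Hypothesis A1_rank2 : forall B, bounded_op B -> rank_le 2 B -> A1 B.
Hypothesis Phi_bounded : forall A, A1 A -> bounded_op (Phi A).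
Hypothesis Phi_range : forall F, bounded_op F -> rank_le 2 F -> exists A, A1 A /\ Phi A = F.
Hypothesis Phi_peripheral : forall A B z, A1 A -> A1 B ->
  peripheral_spectrum (fun y => Phi A (Nat.iter (S n) (Phi B) y)) z <->
  peripheral_spectrum (fun x => A (Nat.iter (S n) B x)) z.
Hypothesis Hx0 : x0 <> vzero.
Hypothesis Hw0 : w0 <> vzero.

Lemma A1_tensor (x : X1) (f : X1 -> Cplx) : is_functional f -> A1 (tensor x f).
Proof. intros Hf; apply A1_rank2; [apply tensor_bounded, Hf|apply tensor_rank_le_two]. Qed.

Lemma Phi_range_tensor (y : X2) (g : X2 -> Cplx) :
  is_functional g -> exists A, A1 A /\ Phi A = tensor y g.
Proof. intros Hg; apply Phi_range; [apply tensor_bounded, Hg|apply tensor_rank_le_two]. Qed.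

(** To see that [Phi A] has rank at most one, the test operator on [X2] must itself be a value of
    [Phi]; as it has rank at most two, the range hypothesis provides it. *)
Lemma Phi_rank_le_one (A : X1 -> X1) : A1 A -> rank_le_one (Phi A) <-> rank_le_one A.
Proof.
intros HA; split; intros Hr; apply NNPP; intros Hn.
- destruct (two_peripheral A n (A1_bounded A HA) Hn) as [B [z1 [z2 [HB [HB2 [Hz [H1 H2]]]]]]].
  assert (HB1 : A1 B) by (apply A1_rank2; assumption).
  rewrite <- (Phi_peripheral A B) in H1, H2 by assumption.
  apply Hz; apply (peripheral_rank_le_one (Phi A) (Phi B) (S n) w0); auto.
- destruct (two_peripheral (Phi A) n (Phi_bounded A HA) Hn)
    as [F [z1 [z2 [HF [HF2 [Hz [H1 H2]]]]]]].
  destruct (Phi_range F HF HF2) as [B [HB <-]].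
  rewrite (Phi_peripheral A B) in H1, H2 by assumption.
  apply Hz; apply (peripheral_rank_le_one A B (S n) x0); auto.
Qed.

Lemma Phi_range_tensor_inv (y : X2) (g : X2 -> Cplx) :
  is_functional g -> exists x f, is_functional f /\ Phi (tensor x f) = tensor y g.
Proof.
intros Hg; destruct (Phi_range_tensor y g Hg) as [A [HA E]].
assert (Hr : rank_le_one A).
{ apply Phi_rank_le_one; [exact HA|]; rewrite E; exists y, g; auto. }
destruct Hr as [x [f [Hf ->]]]; exists x, f; auto.
Qed.

Lemma Phi_trace (A : X1 -> X1) (x : X1) (f : X1 -> Cplx) (y : X2) (g : X2 -> Cplx) :
  A1 A -> is_functional f -> is_functional g -> Phi (tensor x f) = tensor y g ->
  f (A x) *c Cpow (f x) n = g (Phi A y) *c Cpow (g y) n.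
Proof.
intros HA Hf Hg E.
pose proof (Phi_peripheral A (tensor x f) (f (A x) *c Cpow (f x) n) HA (A1_tensor x f Hf)) as H.
rewrite E, (peripheral_tensor_power A x x0), (peripheral_tensor_power (Phi A) y w0) in H
  by auto.
apply H; reflexivity.
Qed.

Lemma Phi_trace_pow (x : X1) (f : X1 -> Cplx) (y : X2) (g : X2 -> Cplx) :
  is_functional f -> is_functional g -> Phi (tensor x f) = tensor y g ->
  Cpow (g y) (S (S n)) = Cpow (f x) (S (S n)).
Proof.
intros Hf Hg E; pose proof (Phi_trace _ x f y g (A1_tensor x f Hf) Hf Hg E) as H.
rewrite E in H; unfold tensor in H; revert H; linpush; intros H; cbn [Cpow].
transitivity (g y *c g y *c Cpow (g y) n); [ring|rewrite <- H; ring].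
Qed.

(** Every operator of rank one on [X2] is the image of one on [X1], so the trace identity tests
    [Phi A] against all [y], [g] with [g y <> 0], and these determine it. The left side of the
    identity is linear in [A], whence the linearity of [Phi]. *)
Lemma Phi_eq_of_trace (A : X1 -> X1) (D : X2 -> X2) :
  A1 A -> bounded_op D ->
  (forall y g x f, is_functional g -> is_functional f -> Phi (tensor x f) = tensor y g ->
     f (A x) *c Cpow (f x) n = g (D y) *c Cpow (g y) n) ->
  Phi A = D.
Proof.
intros HA HD H; apply functional_extensionality; intros v; apply vsub_eq0.
pose proof (Phi_bounded A HA) as HPA.
apply (op_vanish (fun v => Phi A v -v D v)).
- split; intros; linpush; vec.
- intros y g Hg Hgy; destruct (Phi_range_tensor_inv y g Hg) as [x [f [Hf E]]].
  pose proof (H y g x f Hg Hf E) as H1; rewrite (Phi_trace A x f y g HA Hf Hg E) in H1.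
  linpush; destruct (Cmul_eq0 (g (Phi A y) -c g (D y)) (Cpow (g y) n)) as [H2|H2].
  + replace (_ *c _) with (g (Phi A y) *c Cpow (g y) n -c g (D y) *c Cpow (g y) n) by ring.
    rewrite H1; ring.
  + exact H2.
  + destruct (Hgy (Cpow_eq0 _ _ H2)).
Qed.

Lemma Phi_add (A B : X1 -> X1) : A1 A -> A1 B ->
  Phi (fun x => A x +v B x) = fun y => Phi A y +v Phi B y.
Proof.
intros HA HB; apply Phi_eq_of_trace; auto.
- apply bounded_op_add; auto.
- intros y g x f Hg Hf E; linpush.
  transitivity (f (A x) *c Cpow (f x) n +c f (B x) *c Cpow (f x) n); [ring|].
  rewrite (Phi_trace A x f y g), (Phi_trace B x f y g) by assumption; ring.
Qed.

Lemma Phi_scal (a : Cplx) (A : X1 -> X1) : A1 A ->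
  Phi (fun x => a *v A x) = fun y => a *v Phi A y.
Proof.
intros HA; apply Phi_eq_of_trace; auto.
- apply bounded_op_scal; auto.
- intros y g x f Hg Hf E; linpush.
  transitivity (a *c (f (A x) *c Cpow (f x) n)); [ring|].
  rewrite (Phi_trace A x f y g) by assumption; ring.
Qed.

Lemma Phi_eq0 (A : X1 -> X1) : A1 A -> (forall y, Phi A y = vzero) -> forall x, A x = vzero.
Proof.
intros HA H0; apply op_vanish; [apply A1_bounded, HA|]; intros x f Hf Hfx.
assert (Hr : rank_le_one (Phi (tensor x f))).
{ apply Phi_rank_le_one; [apply A1_tensor, Hf|]; exists x, f; auto. }
destruct Hr as [y [g [Hg E]]].
pose proof (Phi_trace A x f y g HA Hf Hg E) as H; rewrite H0 in H.
revert H; linpush; intros H.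
destruct (Cmul_eq0 (f (A x)) (Cpow (f x) n)) as [H1|H1]; [rewrite H; ring|exact H1|].
destruct (Hfx (Cpow_eq0 _ _ H1)).
Qed.

Lemma Phi_inj (A B : X1 -> X1) : A1 A -> A1 B -> Phi A = Phi B -> A = B.
Proof.
intros HA HB E; apply functional_extensionality; intros x; apply vsub_eq0.
transitivity (A x +v Copp Cone *v B x); [vec|].
apply (Phi_eq0 (fun x => A x +v Copp Cone *v B x)); [auto|]; intros y.
rewrite (Phi_add A (fun x => Copp Cone *v B x)), (Phi_scal _ B), E by auto; vec.
Qed.

Lemma Phi_tensor_rank (x : X1) (f : X1 -> Cplx) :
  is_functional f -> exists y g, is_functional g /\ Phi (tensor x f) = tensor y g.
Proof.
intros Hf.
assert (Hr : rank_le_one (Phi (tensor x f))); [|exact Hr].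
apply Phi_rank_le_one; [apply A1_tensor, Hf|]; exists x, f; auto.
Qed.

Context (f0 : X1 -> Cplx) (y0 : X2) (g0 : X2 -> Cplx).
Hypothesis Hf0 : is_functional f0.
Hypothesis Ef0 : f0 x0 = Cone.
Hypothesis Hg0 : is_functional g0.
Hypothesis Phi0 : Phi (tensor x0 f0) = tensor y0 g0.

Lemma g0_y0 : g0 y0 <> Czero.
Proof.
intros E; pose proof (Phi_trace_pow x0 f0 y0 g0 Hf0 Hg0 Phi0) as H.
rewrite E, Ef0, Cpow_one, Cpow_zero in H; exact (Cone_neq0 (eq_sym H)).
Qed.

Lemma y0_neq0 : y0 <> vzero.
Proof. intros E; apply g0_y0; rewrite E; apply fun_zero, Hg0. Qed.

(** Rows and columns are the two maximal linear spaces of operators of rank at most one through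
    [tensor x0 f0]; [row_image] and [col_image] refer to those through its image [tensor y0 g0]. *)
Definition row_op (A : X1 -> X1) : Prop := exists f, is_functional f /\ A = tensor x0 f.
Definition col_op (A : X1 -> X1) : Prop := exists x, A = tensor x f0.
Definition row_image (A : X1 -> X1) : Prop :=
  exists g, is_functional g /\ Phi A = tensor y0 g.
Definition col_image (A : X1 -> X1) : Prop := exists y, Phi A = tensor y g0.

Lemma row_op_A1 (A : X1 -> X1) : row_op A -> A1 A.
Proof. intros [f [Hf ->]]; apply A1_tensor, Hf. Qed.

Lemma col_op_A1 (A : X1 -> X1) : col_op A -> A1 A.
Proof. intros [x ->]; apply A1_tensor, Hf0. Qed.

Lemma adjacent_image (A : X1 -> X1) :
  A1 A -> rank_le_one A -> rank_le_one (fun x => A x +v tensor x0 f0 x) ->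
  row_image A \/ col_image A.
Proof.
intros HA Hr Hs; pose proof (A1_tensor x0 f0 Hf0) as H0.
apply Phi_rank_le_one in Hr; [|exact HA]; destruct Hr as [y [g [Hg E]]].
apply Phi_rank_le_one in Hs; [|apply A1_add; assumption].
rewrite Phi_add, E, Phi0 in Hs by assumption.
destruct (rank_le_one_tensor_sum y y0 g g0 y0 y0_neq0 g0_y0 Hs) as [[c ->]|[c ->]].
- left; exists (fun v => c *c g v); split; [apply is_functional_scal, Hg|].
  rewrite E, tensor_scal_l, tensor_scal_r; reflexivity.
- right; exists (c *v y); rewrite E, tensor_scal_l, tensor_scal_r; reflexivity.
Qed.

Lemma row_op_image (A : X1 -> X1) : row_op A -> row_image A \/ col_image A.
Proof.
intros HA; pose proof (row_op_A1 A HA) as HA1; destruct HA as [f [Hf ->]].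
apply adjacent_image; [exact HA1|exists x0, f; auto|].
rewrite <- tensor_add_r; exists x0, (fun v => f v +c f0 v).
split; [apply is_functional_add; assumption|reflexivity].
Qed.

Lemma col_op_image (A : X1 -> X1) : col_op A -> row_image A \/ col_image A.
Proof.
intros HA; pose proof (col_op_A1 A HA) as HA1; destruct HA as [x ->].
apply adjacent_image; [exact HA1|exists x, f0; auto|].
rewrite <- tensor_add_l; exists (x +v x0), f0; auto.
Qed.

Lemma row_image_sub (A B : X1 -> X1) : A1 A -> A1 B ->
  row_image (fun x => A x +v B x) -> row_image A -> row_image B.
Proof.
intros HA HB [g [Hg E]] [g' [Hg' E']]; rewrite Phi_add, E' in E by assumption.
exists (fun v => g v +c Copp Cone *c g' v); split.
{ apply is_functional_add; [exact Hg|apply is_functional_scal, Hg']. }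
apply functional_extensionality; intros v; apply (f_equal (fun F => F v)) in E.
rewrite tensor_add_r, tensor_scal_r, <- E; vec.
Qed.

Lemma col_image_sub (A B : X1 -> X1) : A1 A -> A1 B ->
  col_image (fun x => A x +v B x) -> col_image B -> col_image A.
Proof.
intros HA HB [y E] [y' E']; rewrite Phi_add, E' in E by assumption.
exists (y -v y'); apply functional_extensionality; intros v.
apply (f_equal (fun F => F v)) in E; unfold tensor in *.
transitivity ((Phi A v +v g0 v *v y') -v g0 v *v y'); [vec|rewrite E; vec].
Qed.

Lemma row_op_image_uniform :
  (forall A, row_op A -> row_image A) \/ (forall A, row_op A -> col_image A).
Proof.
apply (union_of_two row_op row_image col_image (fun A B x => A x +v B x)).
- intros A B [f [Hf ->]] [g [Hg ->]]; exists (fun v => f v +c g v).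
  split; [apply is_functional_add; assumption|rewrite tensor_add_r; reflexivity].
- apply row_op_image.
- intros A B HA HB; apply row_image_sub; apply row_op_A1; assumption.
- intros A B HA HB; apply col_image_sub; apply row_op_A1; assumption.
Qed.

Lemma col_op_image_uniform :
  (forall A, col_op A -> row_image A) \/ (forall A, col_op A -> col_image A).
Proof.
apply (union_of_two col_op row_image col_image (fun A B x => A x +v B x)).
- intros A B [x ->] [y ->]; exists (x +v y); rewrite tensor_add_l; reflexivity.
- apply col_op_image.
- intros A B HA HB; apply row_image_sub; apply col_op_A1; assumption.
- intros A B HA HB; apply col_image_sub; apply col_op_A1; assumption.
Qed.

Lemma adjacent_preimage (A : X1 -> X1) :
  A1 A -> rank_le_one (Phi A) -> rank_le_one (fun y => Phi A y +v tensor y0 g0 y) ->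
  row_op A \/ col_op A.
Proof.
intros HA Hr Hs; pose proof (A1_tensor x0 f0 Hf0) as H0.
apply Phi_rank_le_one in Hr; [|exact HA]; destruct Hr as [x [f [Hf ->]]].
rewrite <- Phi0, <- Phi_add in Hs by assumption.
apply Phi_rank_le_one in Hs; [|apply A1_add; assumption].
assert (Hfx : f0 x0 <> Czero) by (rewrite Ef0; apply Cone_neq0).
destruct (rank_le_one_tensor_sum x x0 f f0 x0 Hx0 Hfx Hs) as [[c ->]|[c ->]].
- left; exists (fun v => c *c f v); split; [apply is_functional_scal, Hf|].
  rewrite tensor_scal_l, tensor_scal_r; reflexivity.
- right; exists (c *v x); rewrite tensor_scal_l, tensor_scal_r; reflexivity.
Qed.

Lemma row_image_eq_col_image_line : (forall y : X2, exists c, y = c *v y0) ->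
  forall A, row_image A -> col_image A.
Proof.
intros H A [g [Hg E]]; exists ((g y0 *c Cinv (g0 y0)) *v y0); rewrite E.
apply functional_extensionality; intros v; destruct (H v) as [c ->]; unfold tensor; linpush.
vec_coefs; field; apply g0_y0.
Qed.

(** If rows and columns were both sent to the same side, then, since every operator adjacent to
    [tensor y0 g0] comes from a row or a column, the other side would be contained in it; this
    forces [X2] to be a line, where the two sides coincide. The vector off the line of [x0] keeps
    the crossed case apart from the straight one, and is needed again to prove the palindrome
    property. *)
Lemma structure_dichotomy :
  ((forall A, row_op A -> row_image A) /\ (forall A, col_op A -> col_image A)) \/
  ((exists x, forall c, x <> c *v x0) /\
   (forall A, row_op A -> col_image A) /\ (forall A, col_op A -> row_image A)).
Proof.
assert (Hg0' : exists v, g0 v = Cone).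
{ exists (Cinv (g0 y0) *v y0); linpush; field; apply g0_y0. }
destruct Hg0' as [v0 Ev0].
destruct row_op_image_uniform as [Hr|Hr], col_op_image_uniform as [Hc|Hc].
- left; split; [exact Hr|]; intros A HA; apply row_image_eq_col_image_line; [|auto].
  intros y; destruct (Phi_range_tensor y g0 Hg0) as [B [HB E]].
  assert (HBi : row_image B).
  { destruct (adjacent_preimage B HB); auto.
    - rewrite E; exists y, g0; auto.
    - rewrite E, <- tensor_add_l; exists (y +v y0), g0; auto. }
  destruct HBi as [g [Hg E']]; exists (g v0).
  rewrite E' in E; apply (f_equal (fun F => F v0)) in E; unfold tensor in E.
  rewrite Ev0, vscal_one in E; symmetry; exact E.
- left; auto.
- destruct (classic (exists x, forall c, x <> c *v x0)) as [Hx|Hx]; [right; auto|].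
  assert (Hline : forall x, exists c, x = c *v x0).
  { intros x; apply NNPP; intros H; apply Hx; exists x; intros c E; apply H; exists c; exact E. }
  assert (H1 : forall A, A1 A -> exists c, A = fun x => c *v tensor x0 f0 x).
  { intros A HA; pose proof (A1_bounded A HA) as HAb.
    destruct (Hline (A x0)) as [c E]; exists c; apply functional_extensionality; intros x.
    destruct (Hline x) as [d ->]; unfold tensor; linpush; rewrite E, Ef0; vec. }
  left; split; intros A HA.
  + destruct (H1 A (row_op_A1 A HA)) as [c ->]; exists (fun v => c *c g0 v).
    split; [apply is_functional_scal, Hg0|].
    rewrite Phi_scal, Phi0, tensor_scal_r by (apply A1_tensor, Hf0); reflexivity.
  + destruct (H1 A (col_op_A1 A HA)) as [c ->]; exists (c *v y0).
    rewrite Phi_scal, Phi0, tensor_scal_l by (apply A1_tensor, Hf0); reflexivity.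
- left; split; [|exact Hc]; intros A HA.
  assert (Hline : forall y, exists c, y = c *v y0).
  { intros y; apply NNPP; intros Hno.
    destruct (functional_zero_one y0 y) as [h [Hh [Eh0 Eh]]].
    { intros c E; apply Hno; exists c; exact E. }
    (* The operator [y0 (x) h] would be some [u (x) g0]. As [h y0 = 0] and [g0 y0 <> 0], this gives
       [u = 0], contradicting [h y = 1]. *)
    destruct (Phi_range_tensor y0 h Hh) as [B [HB E]].
    assert (HBi : col_image B).
    { destruct (adjacent_preimage B HB); auto.
      - rewrite E; exists y0, h; auto.
      - rewrite E, <- tensor_add_r; exists y0, (fun v => h v +c g0 v).
        split; [apply is_functional_add; assumption|reflexivity]. }
    destruct HBi as [u E']; rewrite E' in E.
    pose proof (f_equal (fun F => F y0) E) as E1; pose proof (f_equal (fun F => F y) E) as E2.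
    unfold tensor in E1, E2; rewrite Eh0, vscal_0l in E1; rewrite Eh, vscal_one in E2.
    destruct (vscal_eq0 _ _ E1) as [E3|E3]; [exact (g0_y0 E3)|].
    apply y0_neq0; rewrite <- E2, E3; apply vscal_0r. }
  destruct (Hr A HA) as [u E]; destruct (Hline u) as [c ->].
  exists (fun v => c *c g0 v); split; [apply is_functional_scal, Hg0|].
  rewrite E, tensor_scal_l, tensor_scal_r; reflexivity.
Qed.

Lemma not_parallel_image (x : X1) (f : X1 -> Cplx) (c : Cplx) :
  is_functional f -> x <> vzero -> (exists v, f v <> Czero) ->
  Phi (tensor x f) = (fun v => c *v tensor y0 g0 v) ->
  (exists d, x = d *v x0) /\ (exists d, f = fun v => d *c f0 v).
Proof.
intros Hf Hx [v Hv] E; pose proof (A1_tensor x0 f0 Hf0) as H0.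
rewrite <- Phi0, <- Phi_scal in E by exact H0.
apply Phi_inj in E; [|apply A1_tensor, Hf|apply A1_scal, H0].
assert (E' : forall w, f w *v x = (c *c f0 w) *v x0).
{ intros w; apply (f_equal (fun F => F w)) in E; unfold tensor in E; rewrite E; vec. }
split.
- exists (Cinv (f v) *c (c *c f0 v)).
  transitivity (Cinv (f v) *v (f v *v x)); [vec_coefs; field; exact Hv|rewrite E'; vec].
- destruct (functional_one x Hx) as [h [Hh Eh]].
  exists (c *c h x0); apply functional_extensionality; intros w.
  pose proof (f_equal h (E' w)) as H; revert H; linpush; rewrite Eh; intros H.
  transitivity (f w *c Cone); [ring|rewrite H; ring].
Qed.

(** Carries the rectangle with corners [x0 (x) f0], [x (x) f0], [x0 (x) f], [x (x) f] over to [X2].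
    The names [B] and [C] for the two middle corners, in either order, let one proof serve the
    straight and the crossed case. *)
Lemma Phi_tensor_completion (x : X1) (f : X1 -> Cplx) (y1 : X2) (g1 : X2 -> Cplx)
  (B C : X1 -> X1) :
  is_functional f -> is_functional g1 ->
  (forall c, x <> c *v x0) -> (forall c, f <> fun v => c *c f0 v) ->
  B = tensor x f0 /\ C = tensor x0 f \/ B = tensor x0 f /\ C = tensor x f0 ->
  Phi B = tensor y1 g0 -> Phi C = tensor y0 g1 ->
  Phi (tensor x f) = tensor y1 g1.
Proof.
intros Hf Hg1 Hx Hfn HBC EB EC.
pose proof (A1_tensor x0 f0 Hf0) as H00; pose proof (A1_tensor x f Hf) as Hxf.
pose proof (A1_tensor x0 f Hf) as H0f; pose proof (A1_tensor x f0 Hf0) as Hx0'.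
assert (HB : A1 B) by (destruct HBC as [[-> _]|[-> _]]; assumption).
assert (HC : A1 C) by (destruct HBC as [[_ ->]|[_ ->]]; assumption).
assert (Hxn : x <> vzero) by (intros E; apply (Hx Czero); rewrite E; vec).
assert (Hfv : exists v, f v <> Czero).
{ apply NNPP; intros H; apply (Hfn Czero); apply functional_extensionality; intros v.
  apply NNPP; intros E; apply H; exists v; intros E'; apply E; rewrite E'; ring. }
assert (Hf0v : exists v, f0 v <> Czero) by (exists x0; rewrite Ef0; apply Cone_neq0).
assert (Hnp : forall c D, D = tensor x f0 \/ D = tensor x0 f \/ D = tensor x f ->
  Phi D <> fun v => c *v tensor y0 g0 v).
{ intros c D [->|[->| ->]] E.
  - destruct (not_parallel_image x f0 c Hf0 Hxn Hf0v E) as [[d Ed] _]; exact (Hx d Ed).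
  - destruct (not_parallel_image x0 f c Hf Hx0 Hfv E) as [_ [d Ed]]; exact (Hfn d Ed).
  - destruct (not_parallel_image x f c Hf Hxn Hfv E) as [[d Ed] _]; exact (Hx d Ed). }
assert (HnB : forall c, Phi B <> fun v => c *v tensor y0 g0 v)
  by (intros c; apply Hnp; destruct HBC as [[-> _]|[-> _]]; auto).
assert (HnC : forall c, Phi C <> fun v => c *v tensor y0 g0 v)
  by (intros c; apply Hnp; destruct HBC as [[_ ->]|[_ ->]]; auto).
destruct (Phi_tensor_rank x f Hf) as [y [g [Hg E]]].
assert (HBr : rank_le_one (fun v => tensor x f v +v B v)).
{ destruct HBC as [[-> _]|[-> _]].
  - rewrite <- tensor_add_r; exists x, (fun v => f v +c f0 v).
    split; [apply is_functional_add; assumption|reflexivity].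
  - rewrite <- tensor_add_l; exists (x +v x0), f; auto. }
assert (HCr : rank_le_one (fun v => tensor x f v +v C v)).
{ destruct HBC as [[_ ->]|[_ ->]].
  - rewrite <- tensor_add_l; exists (x +v x0), f; auto.
  - rewrite <- tensor_add_r; exists x, (fun v => f v +c f0 v).
    split; [apply is_functional_add; assumption|reflexivity]. }
assert (HSr : rank_le_one (fun v => tensor x f v +v (B v +v (C v +v tensor x0 f0 v)))).
{ exists (x +v x0), (fun v => f v +c f0 v); split; [apply is_functional_add; assumption|].
  apply functional_extensionality; intros v.
  destruct HBC as [[-> ->]|[-> ->]]; unfold tensor; vec. }
apply Phi_rank_le_one in HBr; [|auto].
apply Phi_rank_le_one in HCr; [|auto].
apply Phi_rank_le_one in HSr; [|auto].
rewrite (Phi_add _ B), E, EB in HBr by auto.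
rewrite (Phi_add _ C), E, EC in HCr by auto.
rewrite (Phi_add _ (fun v => B v +v (C v +v tensor x0 f0 v))),
  (Phi_add B (fun v => C v +v tensor x0 f0 v)), (Phi_add C), E, EB, EC, Phi0 in HSr by auto.
assert (Hg1v : exists v, g1 v <> Czero).
{ apply NNPP; intros H; apply (HnC Czero); rewrite EC.
  apply functional_extensionality; intros v; unfold tensor.
  replace (g1 v) with Czero; [vec|].
  apply NNPP; intros E1; apply H; exists v; auto. }
destruct Hg1v as [v1 Hv1].
rewrite E; apply (rank_one_completion y0 y1 y g0 g1 g y0 v1); try assumption.
- exact y0_neq0.
- exact g0_y0.
- intros c Ec; apply (HnB c); rewrite EB, Ec, tensor_scal_l; reflexivity.
- intros c Ec; apply (HnC c); rewrite EC, Ec, tensor_scal_r; reflexivity.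
- intros c; rewrite <- E; apply Hnp; auto.
Qed.

Lemma Phi_tensor_add_l (x x' : X1) (f : X1 -> Cplx) (y : X2) : is_functional f ->
  Phi (tensor (x +v x') f) y = Phi (tensor x f) y +v Phi (tensor x' f) y.
Proof. intros Hf; rewrite tensor_add_l, Phi_add by (apply A1_tensor, Hf); reflexivity. Qed.

Lemma Phi_tensor_scal_l (a : Cplx) (x : X1) (f : X1 -> Cplx) (y : X2) : is_functional f ->
  Phi (tensor (a *v x) f) y = a *v Phi (tensor x f) y.
Proof. intros Hf; rewrite tensor_scal_l, Phi_scal by (apply A1_tensor, Hf); reflexivity. Qed.

Lemma Phi_tensor_add_r (x : X1) (f g : X1 -> Cplx) (y : X2) :
  is_functional f -> is_functional g ->
  Phi (tensor x (fun v => f v +c g v)) y = Phi (tensor x f) y +v Phi (tensor x g) y.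
Proof.
intros Hf Hg; rewrite tensor_add_r, Phi_add by (apply A1_tensor; assumption); reflexivity.
Qed.

Lemma Phi_tensor_scal_r (a : Cplx) (x : X1) (f : X1 -> Cplx) (y : X2) : is_functional f ->
  Phi (tensor x (fun v => a *c f v)) y = a *v Phi (tensor x f) y.
Proof. intros Hf; rewrite tensor_scal_r, Phi_scal by (apply A1_tensor, Hf); reflexivity. Qed.

(** Evaluating at [v0] or applying [h0] reads off the free factor of the image by a linear formula,
    so that the maps defined through it inherit linearity from [Phi]. *)
Lemma tensor_images (v0 : X2) (h0 : X2 -> Cplx) : g0 v0 = Cone ->
  is_functional h0 -> h0 y0 = Cone ->
  (forall A, col_image A -> Phi A = tensor (Phi A v0) g0) /\
  (forall A, row_image A -> Phi A = tensor y0 (fun v => h0 (Phi A v)) /\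
     is_functional (fun v => h0 (Phi A v))).
Proof.
intros Ev0 Hh0 Eh0; split.
- intros A [y ->]; change (tensor y g0 v0) with (g0 v0 *v y); rewrite Ev0, vscal_one; reflexivity.
- intros A [g [Hg ->]].
  replace (fun v => h0 (tensor y0 g v)) with g; [auto|].
  apply functional_extensionality; intros v; unfold tensor; linpush; rewrite Eh0; ring.
Qed.

Lemma similarity_form :
  (forall A, row_op A -> row_image A) -> (forall A, col_op A -> col_image A) ->
  exists (lam : Cplx) (T : X1 -> X2) (Tinv : X2 -> X1),
    Cpow lam (S (S n)) = Cone /\ invertible_op T Tinv /\
    forall A, A1 A -> Phi A = (fun y => lam *v T (A (Tinv y))).
Proof.
intros Hrow Hcol.
destruct (functional_one y0 y0_neq0) as [h0 [Hh0 Eh0]].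
assert (Ev0 : g0 (Cinv (g0 y0) *v y0) = Cone) by (linpush; field; apply g0_y0).
set (v0 := Cinv (g0 y0) *v y0) in Ev0.
destruct (tensor_images v0 h0 Ev0 Hh0 Eh0) as [Hci Hri].
pose (T := fun x => Phi (tensor x f0) v0).
pose (S := fun f : X1 -> Cplx => fun v => h0 (Phi (tensor x0 f) v)).
assert (ET : forall x, Phi (tensor x f0) = tensor (T x) g0)
  by (intros x; apply Hci, Hcol; exists x; reflexivity).
assert (ES : forall f, is_functional f ->
  Phi (tensor x0 f) = tensor y0 (S f) /\ is_functional (S f))
  by (intros f Hf; apply Hri, Hrow; exists f; auto).
assert (HT : is_linear T).
{ split; intros; unfold T; [apply Phi_tensor_add_l|apply Phi_tensor_scal_l]; exact Hf0. }
assert (HSadd : forall f g, is_functional f -> is_functional g ->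
  S (fun v => f v +c g v) = fun y => S f y +c S g y).
{ intros f g Hf Hg; apply functional_extensionality; intros y; unfold S.
  rewrite Phi_tensor_add_r by assumption; linpush; reflexivity. }
assert (HSscal : forall a f, is_functional f -> S (fun v => a *c f v) = fun y => a *c S f y).
{ intros a f Hf; apply functional_extensionality; intros y; unfold S.
  rewrite Phi_tensor_scal_r by assumption; linpush; reflexivity. }
assert (ET0 : T x0 = y0).
{ apply (tensor_inj_l _ _ g0 v0 Ev0); rewrite <- ET, <- Phi0; reflexivity. }
assert (ES0 : S f0 = g0).
{ apply (tensor_inj_r y0); [exact y0_neq0|]; rewrite <- (proj1 (ES f0 Hf0)); exact Phi0. }
assert (Htens : forall x f, is_functional f -> Phi (tensor x f) = tensor (T x) (S f)).
{ intros x f Hf; destruct (ES f Hf) as [E1 E2].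
  destruct (classic (exists c, x = c *v x0)) as [[c ->]|Hx].
  { rewrite (lin_scal HT), ET0, tensor_scal_l, Phi_scal, E1, tensor_scal_l
      by (apply A1_tensor, Hf); reflexivity. }
  destruct (classic (exists c, f = fun v => c *c f0 v)) as [[c ->]|Hfn].
  { rewrite HSscal, ES0, tensor_scal_r, Phi_scal, ET, tensor_scal_r
      by (assumption || apply A1_tensor, Hf0); reflexivity. }
  apply (Phi_tensor_completion x f (T x) (S f) (tensor x f0) (tensor x0 f)); auto.
  - intros c E; apply Hx; exists c; exact E.
  - intros c E; apply Hfn; exists c; exact E. }
destruct (pairing_proportional (fun x f => S f (T x)) (Datatypes.S (Datatypes.S n)) x0 f0)
  as [Hlam Hb]; try assumption.
{ intros f Hf x x'; destruct (ES f Hf) as [_ HSf]; linpush; reflexivity. }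
{ intros f Hf a x; destruct (ES f Hf) as [_ HSf]; linpush; reflexivity. }
{ intros x f g Hf Hg; rewrite HSadd by assumption; reflexivity. }
{ intros x a f Hf; rewrite HSscal by assumption; reflexivity. }
{ intros x f Hf; apply Phi_trace_pow; [exact Hf|apply ES, Hf|apply Htens, Hf]. }
{ lia. }
cbv beta in Hlam, Hb; rewrite ET0, ES0 in Hlam, Hb; set (lam := g0 y0) in *.
assert (Hlam0 : lam <> Czero) by exact g0_y0.
(* Some [tensor x f] is sent to [tensor y g] with [g y = 1]; evaluation at [y] shows that [y] is the
   multiple [S f y] of [T x]. *)
assert (Hinv : forall y, exists x, T x = y).
{ intros y; destruct (classic (y = vzero)) as [->|Hy]; [exists vzero; linpush; reflexivity|].
  destruct (functional_one y Hy) as [g [Hg Eg]].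
  destruct (Phi_range_tensor_inv y g Hg) as [x [f [Hf E]]].
  exists (S f y *v x); rewrite Htens in E by exact Hf.
  apply (f_equal (fun F => F y)) in E; unfold tensor in E; rewrite Eg, vscal_one in E.
  linpush; exact E. }
assert (HSonto : forall g, is_functional g -> exists f, is_functional f /\ S f = g).
{ intros g Hg; destruct (Phi_range_tensor_inv y0 g Hg) as [x [f [Hf E]]].
  exists (fun v => h0 (T x) *c f v); split; [apply is_functional_scal, Hf|].
  rewrite HSscal by exact Hf; apply functional_extensionality; intros v.
  rewrite Htens in E by exact Hf.
  apply (f_equal (fun F => h0 (F v))) in E; revert E; unfold tensor; linpush; rewrite Eh0.
  intros E; transitivity (S f v *c h0 (T x)); [ring|rewrite E; ring]. }
assert (HTinj : forall x x', T x = T x' -> x = x').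
{ intros x x' E; apply (tensor_inj_l x x' f0 x0 Ef0), Phi_inj;
    try (apply A1_tensor, Hf0); rewrite !ET, E; reflexivity. }
destruct (choice _ Hinv) as [Tinv HTinv].
assert (HTil : is_linear Tinv).
{ split; intros; apply HTinj; linpush; rewrite !HTinv; reflexivity. }
(* Every functional on [X2] is some [S f], and [S f (T x) = lam * f x] is continuous in [x]. The
   same relation, read as [f (Tinv y) = S f y / lam], gives the continuity of [Tinv]. *)
assert (HTb : bounded_op T).
{ apply weakly_bounded_bounded; [exact HT|]; intros g Hg.
  destruct (HSonto g Hg) as [f [Hf <-]].
  replace (fun x => S f (T x)) with (fun x => lam *c f x); [apply is_functional_scal, Hf|].
  apply functional_extensionality; intros x; rewrite Hb by exact Hf; reflexivity. }
assert (HTib : bounded_op Tinv).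
{ apply weakly_bounded_bounded; [exact HTil|]; intros f Hf.
  replace (fun y => f (Tinv y)) with (fun y => Cinv lam *c S f y);
    [apply is_functional_scal, ES, Hf|].
  apply functional_extensionality; intros y; rewrite <- (HTinv y) at 1.
  rewrite Hb by exact Hf; field; exact Hlam0. }
exists lam, T, Tinv; split; [exact Hlam|split].
{ repeat split; try assumption; try apply HTb; try apply HTib.
  intros x; apply HTinj, HTinv. }
intros A HA; apply functional_extensionality; intros y.
pose proof (A1_bounded A HA) as HAb; pose proof (Phi_bounded A HA) as HPb.
(* All vectors of [X2] have the form [T x] and all functionals the form [S f], so
   [S f (Phi A (T x))] is to be compared with [lam * S f (T (A x))]. *)
rewrite <- (HTinv y) at 1; set (x := Tinv y); clearbody x; clear y.
apply functional_sep; intros g Hg; destruct (HSonto g Hg) as [f [Hf <-]].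
apply Csub_eq0; linpush; revert x f Hf Hg.
intros x f Hf _; destruct (ES f Hf) as [_ HSf].
apply (pairing_vanish (fun x f => S f (Phi A (T x)) -c lam *c S f (T (A x)))); try exact Hf.
- intros u v k Hk; destruct (ES k Hk) as [_ HSk]; linpush; ring.
- intros u; assert (E0 : S (fun _ => Czero) = fun _ => Czero).
  { transitivity (S (fun v => Czero *c f0 v));
      [f_equal; apply functional_extensionality; intros; ring|].
    rewrite HSscal by exact Hf0; apply functional_extensionality; intros; ring. }
  rewrite E0; ring.
- intros u k Hk Hku; destruct (ES k Hk) as [_ HSk].
  (* After division by [(k u)^n] this reads [k (A u) = lam^n * S k (Phi A (T u))]; multiplication by
     [lam^2] and [lam^(n+2) = 1] give the claim. *)
  pose proof (Phi_trace A u k (T u) (S k) HA Hk HSk (Htens u k Hk)) as H.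
  rewrite (Hb u k Hk), Cpow_mul in H; rewrite (Hb (A u) k Hk).
  replace (S k (Phi A (T u))) with (lam *c (lam *c Cpow lam n) *c S k (Phi A (T u)))
    by (change (lam *c (lam *c Cpow lam n)) with (Cpow lam (Datatypes.S (Datatypes.S n)));
        rewrite Hlam; ring).
  assert (Hkn : Cpow (k u) n <> Czero) by (intros E; exact (Hku (Cpow_eq0 _ _ E))).
  replace (k (A u)) with (S k (Phi A (T u)) *c Cpow lam n); [ring|].
  transitivity (Cinv (Cpow (k u) n) *c (S k (Phi A (T u)) *c (Cpow lam n *c Cpow (k u) n)));
    [field; exact Hkn|rewrite <- H; field; exact Hkn].
Qed.

(** The [T] of the conclusion is provided by [S], which sends functionals on [X1] to vectors of
    [X2]; inside the proof [T] sends vectors of [X1] to functionals on [X2]. *)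
Lemma adjoint_form :
  (forall A, row_op A -> col_image A) -> (forall A, col_op A -> row_image A) ->
  reflexive X1 /\ reflexive X2 /\
  exists (lam : Cplx) (T : (X1 -> Cplx) -> X2) (Tinv : X2 -> X1 -> Cplx),
    Cpow lam (S (S n)) = Cone /\ invertible_from_dual T Tinv /\
    forall A, A1 A -> Phi A = (fun y => lam *v T (fun x => Tinv y (A x))).
Proof.
intros Hrow Hcol.
destruct (functional_one y0 y0_neq0) as [h0 [Hh0 Eh0]].
assert (Ev0 : g0 (Cinv (g0 y0) *v y0) = Cone) by (linpush; field; apply g0_y0).
set (v0 := Cinv (g0 y0) *v y0) in Ev0.
destruct (tensor_images v0 h0 Ev0 Hh0 Eh0) as [Hci Hri].
pose (S := fun f : X1 -> Cplx => Phi (tensor x0 f) v0).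
pose (T := fun x => fun v => h0 (Phi (tensor x f0) v)).
assert (ES : forall f, is_functional f -> Phi (tensor x0 f) = tensor (S f) g0)
  by (intros f Hf; apply Hci, Hrow; exists f; auto).
assert (ET : forall x, Phi (tensor x f0) = tensor y0 (T x) /\ is_functional (T x))
  by (intros x; apply Hri, Hcol; exists x; auto).
assert (HTf : forall x, is_functional (T x)) by (intros x; apply ET).
assert (HTadd : forall x x', T (x +v x') = fun y => T x y +c T x' y).
{ intros x x'; apply functional_extensionality; intros y; unfold T.
  rewrite Phi_tensor_add_l by exact Hf0; linpush; reflexivity. }
assert (HTscal : forall a x, T (a *v x) = fun y => a *c T x y).
{ intros a x; apply functional_extensionality; intros y; unfold T.
  rewrite Phi_tensor_scal_l by exact Hf0; linpush; reflexivity. }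
assert (HSadd : forall f g, is_functional f -> is_functional g ->
  S (fun v => f v +c g v) = S f +v S g)
  by (intros f g Hf Hg; apply Phi_tensor_add_r; assumption).
assert (HSscal : forall a f, is_functional f -> S (fun v => a *c f v) = a *v S f)
  by (intros a f Hf; apply Phi_tensor_scal_r; assumption).
assert (ES0 : S f0 = y0).
{ apply (tensor_inj_l _ _ g0 v0 Ev0); rewrite <- ES, <- Phi0 by exact Hf0; reflexivity. }
assert (ET0 : T x0 = g0).
{ apply (tensor_inj_r y0); [exact y0_neq0|]; rewrite <- (proj1 (ET x0)); exact Phi0. }
assert (Htens : forall x f, is_functional f -> Phi (tensor x f) = tensor (S f) (T x)).
{ intros x f Hf; destruct (ET x) as [E1 E2].
  destruct (classic (exists c, x = c *v x0)) as [[c ->]|Hx].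
  { rewrite HTscal, ET0, tensor_scal_l, Phi_scal, ES, tensor_scal_r
      by (assumption || apply A1_tensor, Hf); reflexivity. }
  destruct (classic (exists c, f = fun v => c *c f0 v)) as [[c ->]|Hfn].
  { rewrite HSscal, ES0, tensor_scal_r, Phi_scal, E1, tensor_scal_l
      by (assumption || apply A1_tensor, Hf0); reflexivity. }
  apply (Phi_tensor_completion x f (S f) (T x) (tensor x0 f) (tensor x f0)); auto.
  - intros c E; apply Hx; exists c; exact E.
  - intros c E; apply Hfn; exists c; exact E. }
destruct (pairing_proportional (fun x f => T x (S f)) (Datatypes.S (Datatypes.S n)) x0 f0)
  as [Hlam Hb]; try assumption.
{ intros f Hf x x'; rewrite HTadd; reflexivity. }
{ intros f Hf a x; rewrite HTscal; reflexivity. }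
{ intros x f g Hf Hg; pose proof (HTf x); rewrite HSadd by assumption; linpush; reflexivity. }
{ intros x a f Hf; pose proof (HTf x); rewrite HSscal by assumption; linpush; reflexivity. }
{ intros x f Hf; apply Phi_trace_pow; [exact Hf|apply HTf|apply Htens, Hf]. }
{ lia. }
cbv beta in Hlam, Hb; rewrite ET0, ES0 in Hlam, Hb; set (lam := g0 y0) in *.
assert (Hlam0 : lam <> Czero) by exact g0_y0.
assert (HSonto : forall y, exists f, is_functional f /\ S f = y).
{ intros y; destruct (classic (y = vzero)) as [->|Hy].
  { exists (fun v => Czero *c f0 v); split; [apply is_functional_scal, Hf0|].
    rewrite HSscal by exact Hf0; apply vscal_0l. }
  destruct (functional_one y Hy) as [g [Hg Eg]].
  destruct (Phi_range_tensor_inv y g Hg) as [x [f [Hf E]]].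
  exists (fun v => T x y *c f v); split; [apply is_functional_scal, Hf|].
  rewrite HSscal by exact Hf; rewrite Htens in E by exact Hf.
  apply (f_equal (fun F => F y)) in E; unfold tensor in E; rewrite Eg, vscal_one in E.
  exact E. }
assert (HTonto : forall g, is_functional g -> exists x, T x = g).
{ intros g Hg; destruct (Phi_range_tensor_inv y0 g Hg) as [x [f [Hf E]]].
  exists (h0 (S f) *v x); rewrite HTscal; apply functional_extensionality; intros v.
  rewrite Htens in E by exact Hf.
  apply (f_equal (fun F => h0 (F v))) in E; revert E; unfold tensor; linpush; rewrite Eh0.
  intros E; transitivity (T x v *c h0 (S f)); [ring|rewrite E; ring]. }
(* The relation [T x (S f) = lam * f x] makes this a left inverse of [S], and [S] is onto. *)
pose (Tinv := fun y x => Cinv lam *c T x y).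
assert (HTiS : forall f, is_functional f -> Tinv (S f) = f).
{ intros f Hf; apply functional_extensionality; intros x; unfold Tinv.
  rewrite Hb by exact Hf; field; exact Hlam0. }
assert (HTif : forall y, is_functional (Tinv y))
  by (intros y; destruct (HSonto y) as [f [Hf <-]]; rewrite HTiS; exact Hf).
assert (HSTi : forall y, S (Tinv y) = y)
  by (intros y; destruct (HSonto y) as [f [Hf <-]]; rewrite HTiS by exact Hf; reflexivity).
assert (HTiadd : forall y y', Tinv (y +v y') = fun x => Tinv y x +c Tinv y' x).
{ intros y y'; apply functional_extensionality; intros x; unfold Tinv.
  pose proof (HTf x); linpush; ring. }
assert (HTiscal : forall a y, Tinv (a *v y) = fun x => a *c Tinv y x).
{ intros a y; apply functional_extensionality; intros x; unfold Tinv.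
  pose proof (HTf x); linpush; ring. }
(* Division by [vnorm x] makes the family indexed by [x] bounded at each [y]. At [x = 0] the inverse
   of zero is harmless because [Tinv y] vanishes there. *)
assert (HTib : exists M, 0 <= M /\ forall y x, Cmod (Tinv y x) <= M * vnorm y * vnorm x).
{ destruct (uniform_boundedness (fun x y => Creal (/ vnorm x) *c Tinv y x)) as [M HM].
  - intros x; apply is_functional_scal; unfold Tinv; apply is_functional_scal, HTf.
  - intros y; destruct (proj2 (proj2 (HTif y))) as [C HC]; exists (Rabs C); intros x.
    destruct (classic (x = vzero)) as [->|Hx].
    + pose proof (HTif y) as Hy; linpush; replace (_ *c Czero) with Czero by ring.
      rewrite Cmod_zero; apply Rabs_pos.
    + pose proof (vnorm_pos x Hx) as Hxp.
      assert (Hinvp : 0 < / vnorm x) by (apply Rinv_0_lt_compat, Hxp).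
      rewrite Cmod_mul, Cmod_Creal, Rabs_right by lra.
      apply Rmult_le_reg_l with (1 := Hxp).
      rewrite <- Rmult_assoc, Rinv_r, Rmult_1_l by lra.
      apply Rle_trans with (1 := HC x); pose proof (Rle_abs C); nra.
  - exists (Rabs M); split; [apply Rabs_pos|]; intros y x.
    destruct (classic (x = vzero)) as [->|Hx].
    + pose proof (HTif y) as Hy; linpush; rewrite Cmod_zero, vnorm_zero; lra.
    + pose proof (vnorm_pos x Hx) as Hxp.
      assert (Hinvp : 0 < / vnorm x) by (apply Rinv_0_lt_compat, Hxp).
      specialize (HM x y); rewrite Cmod_mul, Cmod_Creal, Rabs_right in HM by lra.
      pose proof (vnorm_nonneg _ y) as Hy.
      apply Rmult_le_reg_l with (1 := Hinvp); apply Rle_trans with (1 := HM).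
      replace (/ vnorm x * (Rabs M * vnorm y * vnorm x)) with (Rabs M * vnorm y)
        by (field; lra).
      apply Rmult_le_compat_r; [exact Hy|apply Rle_abs]. }
destruct HTib as [M [HM0 HM]].
(* Every functional on [X2] is some [T x], and its composition with [S] is [lam] times evaluation at
   [x]. *)
assert (HSb : bounded_op (fun f : dual X1 => S (proj1_sig f))).
{ apply weakly_bounded_bounded.
  - split; [intros [f Hf] [g Hg]; apply HSadd; assumption
           |intros a [f Hf]; apply HSscal; assumption].
  - intros g Hg; destruct (HTonto g Hg) as [x <-].
    replace (fun f : dual X1 => T x (S (proj1_sig f)))
      with (fun f : dual X1 => lam *c proj1_sig f x).
    + apply (is_functional_scal (X := dual X1)); split; [reflexivity|split; [reflexivity|]].
      exists (vnorm x); intros f; rewrite Rmult_comm; apply dual_apply_bound.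
    + apply functional_extensionality; intros [f Hf]; rewrite Hb by exact Hf; reflexivity. }
destruct (bounded_op_bound _ HSb) as [K [HK1 HK]].
assert (HTb : forall x, dual_norm_le (T x) (Cmod lam * M * vnorm x)).
{ intros x y; replace (T x y) with (lam *c Tinv y x) by (unfold Tinv; field; exact Hlam0).
  rewrite Cmod_mul; specialize (HM y x); pose proof (Cmod_nonneg lam); nra. }
split; [|split].
(* Composed with [Tinv], the bidual element becomes a functional on [X2], hence some [T x]; then
   [lam *v x] represents it. *)
- intros F Fadd Fscal [C HC].
  assert (Hgam : is_functional (fun y => F (Tinv y))).
  { split; [|split].
    - intros y y'; rewrite HTiadd; apply Fadd; apply HTif.
    - intros a y; rewrite HTiscal; apply Fscal, HTif.
    - exists (C * M); intros y; rewrite Rmult_assoc; apply HC; [apply HTif|].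
      intros x; apply HM. }
  destruct (HTonto _ Hgam) as [x Ex]; exists (lam *v x); intros f Hf.
  rewrite <- (HTiS f Hf) at 1.
  transitivity (T x (S f)); [rewrite Ex; reflexivity|].
  rewrite Hb by exact Hf; linpush; reflexivity.
(* Composed with [T], the bidual element becomes a functional on [X1], whose image under [S],
   divided by [lam], represents it. *)
- intros F Fadd Fscal [C HC].
  assert (Hphi : is_functional (fun x => F (T x))).
  { split; [|split].
    - intros x x'; rewrite HTadd; apply Fadd; apply HTf.
    - intros a x; rewrite HTscal; apply Fscal, HTf.
    - exists (C * (Cmod lam * M)); intros x; rewrite Rmult_assoc; apply HC; [apply HTf|].
      apply HTb. }
  exists (Cinv lam *v S (fun x => F (T x))); intros g Hg; linpush.
  destruct (HTonto g Hg) as [x <-]; rewrite (Hb x _ Hphi); field; exact Hlam0.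
- exists lam, S, Tinv; split; [exact Hlam|split].
  + split; [exact HSadd|split; [exact HSscal|split]].
    { exists K; intros f N Hf HN.
      assert (HN0 : 0 <= N).
      { specialize (HN x0); pose proof (vnorm_pos x0 Hx0); pose proof (Cmod_nonneg (f x0)); nra. }
      apply Rle_trans with (1 := HK (exist _ f Hf)).
      apply Rmult_le_compat_l; [lra|]; apply dual_norm_le_vnorm; assumption. }
    split; [exact HTif|split; [exact HTiadd|split; [exact HTiscal|split]]].
    { exists M; intros y x; apply HM. }
    split; [exact HSTi|exact HTiS].
  + intros A HA; apply functional_extensionality; intros y.
    pose proof (A1_bounded A HA) as HAb; pose proof (Phi_bounded A HA) as HPb.
    rewrite <- (HSTi y) at 1; pose proof (HTif y) as Hf.
    set (f := Tinv y) in *; clearbody f; clear y.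
    apply functional_sep; intros g Hg; destruct (HTonto g Hg) as [x <-].
    apply Csub_eq0; linpush; clear Hg.
    assert (HSA : forall k, is_functional k -> is_functional (fun x => k (A x)))
      by (intros k Hk; apply is_functional_comp; assumption).
    apply (pairing_vanish (fun x f => T x (Phi A (S f)) -c lam *c T x (S (fun u => f (A u)))));
      try exact Hf.
    * intros u v k Hk; rewrite !HTadd; ring.
    * intros u; pose proof (HTf u) as Hu.
      assert (E0 : S (fun _ => Czero) = vzero).
      { transitivity (S (fun v => Czero *c f0 v));
          [f_equal; apply functional_extensionality; intros; ring|].
        rewrite HSscal by exact Hf0; apply vscal_0l. }
      rewrite E0; linpush; ring.
    * intros u k Hk Hku; pose proof (HTf u) as Hu.
      pose proof (Phi_trace A u k (S k) (T u) HA Hk Hu (Htens u k Hk)) as H.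
      rewrite (Hb u k Hk), Cpow_mul in H; rewrite (Hb u _ (HSA k Hk)).
      replace (T u (Phi A (S k))) with (lam *c (lam *c Cpow lam n) *c T u (Phi A (S k)))
        by (change (lam *c (lam *c Cpow lam n)) with (Cpow lam (Datatypes.S (Datatypes.S n)));
            rewrite Hlam; ring).
      assert (Hkn : Cpow (k u) n <> Czero) by (intros E; exact (Hku (Cpow_eq0 _ _ E))).
      replace (k (A u)) with (T u (Phi A (S k)) *c Cpow lam n); [ring|].
      transitivity (Cinv (Cpow (k u) n) *c (T u (Phi A (S k)) *c (Cpow lam n *c Cpow (k u) n)));
        [field; exact Hkn|rewrite <- H; field; exact Hkn].
Qed.

End Preserver.

(** * Reduction to two operators *)

Lemma count_occ_nat_app (s t : list nat) (j : nat) :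
  count_occ_nat (s ++ t) j = (count_occ_nat s j + count_occ_nat t j)%nat.
Proof. unfold count_occ_nat; rewrite filter_app, length_app; reflexivity. Qed.

Lemma count_occ_nat_In (s : list nat) (j : nat) :
  count_occ_nat s j = 0%nat -> ~ In j s.
Proof.
unfold count_occ_nat; intros H Hj; apply length_zero_iff_nil in H.
assert (Hf : In j (filter (fun i => Nat.eqb i j) s))
  by (apply filter_In; split; [exact Hj|apply Nat.eqb_refl]).
rewrite H in Hf; destruct Hf.
Qed.

(** The word required to be a palindrome in [quasi_semi_jordan]; up to rotation [s] is its letter at
    [p] followed by this word. *)
Definition cyclic_rest (s : list nat) (p : nat) : list nat := skipn (S p) s ++ firstn p s.

Lemma not_In_cyclic_rest (s : list nat) (p : nat) :
  (p < length s)%nat -> count_occ_nat s (nth p s 0%nat) = 1%nat ->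
  ~ In (nth p s 0%nat) (cyclic_rest s p).
Proof.
intros Hp Hc; set (i := nth p s 0%nat) in *; apply count_occ_nat_In.
rewrite (split_at_nth s p Hp) in Hc; fold i in Hc.
unfold cyclic_rest; rewrite count_occ_nat_app.
change (i :: skipn (S p) s) with ((i :: nil) ++ skipn (S p) s) in Hc.
rewrite !count_occ_nat_app in Hc.
assert (E : count_occ_nat (i :: nil) i = 1%nat)
  by (unfold count_occ_nat; simpl; rewrite Nat.eqb_refl; reflexivity).
lia.
Qed.

Lemma In_cyclic_rest (s : list nat) (p j : nat) : In j (cyclic_rest s p) -> In j s.
Proof.
intros H; apply in_app_or in H; destruct H as [H|H].
- rewrite <- (firstn_skipn (S p) s); apply in_or_app; auto.
- rewrite <- (firstn_skipn p s); apply in_or_app; auto.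
Qed.

Lemma In_cyclic_split (s : list nat) (p j : nat) : (p < length s)%nat ->
  In j s -> j = nth p s 0%nat \/ In j (cyclic_rest s p).
Proof.
intros Hp; rewrite (split_at_nth s p Hp) at 1; unfold cyclic_rest.
rewrite !in_app_iff; simpl; intuition congruence.
Qed.

Lemma length_cyclic_rest (s : list nat) (p : nat) :
  (p < length s)%nat -> length s = S (length (cyclic_rest s p)).
Proof.
intros Hp; rewrite (split_at_nth s p Hp) at 1; unfold cyclic_rest.
rewrite !length_app; simpl; lia.
Qed.

Lemma peripheral_gprod_pivot {X : CBanach} (s : list nat) (p : nat) (A : nat -> X -> X)
  (x0 : X) (z : Cplx) :
  (p < length s)%nat -> (forall i, In i s -> bounded_op (A i)) -> x0 <> vzero ->
  peripheral_spectrum (gprod s A) z <->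
  peripheral_spectrum (fun v => A (nth p s 0%nat) (gprod (cyclic_rest s p) A v)) z.
Proof.
intros Hp HA Hx0; rewrite (split_at_nth s p Hp) in HA.
rewrite (split_at_nth s p Hp) at 1.
apply (peripheral_gprod_rotate _ (nth p s 0%nat :: skipn (S p) s) A x0 z HA Hx0).
Qed.

Lemma peripheral_gprod_rev_pivot {X : CBanach} (s : list nat) (p : nat) (A : nat -> X -> X)
  (x0 : X) (z : Cplx) :
  (p < length s)%nat -> (forall i, In i s -> bounded_op (A i)) -> x0 <> vzero ->
  peripheral_spectrum (gprod (rev s) A) z <->
  peripheral_spectrum (fun v => A (nth p s 0%nat) (gprod (rev (cyclic_rest s p)) A v)) z.
Proof.
intros Hp HA Hx0; rewrite (split_at_nth s p Hp) in HA.
rewrite (split_at_nth s p Hp) at 1.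
set (i := nth p s 0%nat) in *; unfold cyclic_rest.
set (l1 := firstn p s) in *; set (l2 := skipn (S p) s) in *.
assert (E : rev (l1 ++ i :: l2) = rev l2 ++ i :: rev l1)
  by (rewrite rev_app_distr; simpl; rewrite <- app_assoc; reflexivity).
rewrite E, rev_app_distr.
apply (peripheral_gprod_rotate (rev l2) (i :: rev l1) A x0 z); [|exact Hx0].
intros j Hj; apply HA, in_rev; rewrite E; exact Hj.
Qed.

Lemma gprod_constant {X : CBanach} (t : list nat) (A : nat -> X -> X) (B : X -> X) :
  (forall j, In j t -> A j = B) -> gprod t A = Nat.iter (length t) B.
Proof.
induction t as [|j t IH]; simpl; intros H; [reflexivity|].
rewrite IH, H by auto; reflexivity.
Qed.

(** The least significant digit comes first, as the leftmost operator of a product acts last. *)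
Definition numeral (K : nat) (t : list nat) : nat :=
  fold_right (fun j a => (j + K * a)%nat) 0%nat t.

Lemma numeral_inj (K : nat) (t t' : list nat) :
  (forall j, In j t -> (j < K)%nat) -> (forall j, In j t' -> (j < K)%nat) ->
  length t = length t' -> numeral K t = numeral K t' -> t = t'.
Proof.
revert t'; induction t as [|j t IH]; intros [|j' t'] H H' Hl E; simpl in *;
  try discriminate; [reflexivity|].
pose proof (H j (or_introl eq_refl)) as Hj; pose proof (H' j' (or_introl eq_refl)) as Hj'.
assert (Ej : j = j').
{ apply (f_equal (fun a => a mod K)%nat) in E.
  rewrite !(Nat.mul_comm K), !Nat.Div0.mod_add, !Nat.mod_small in E by assumption.
  exact E. }
subst j'; f_equal; apply IH; auto.
apply (Nat.mul_cancel_l _ _ K); lia.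
Qed.

(* The operators [u1 |-> K u1, u2 |-> j u1 + u2] act on [u1 + R u2] like the affine maps
   [a |-> j + K a], whose compositions read off base [K] numerals; hence they
   separate the words [t] and [rev t]. *)
Lemma quasi_semi_jordan_of_rev {X : CBanach} (s : list nat) (p : nat) (x0 x1 : X) :
  (p < length s)%nat -> count_occ_nat s (nth p s 0%nat) = 1%nat ->
  x0 <> vzero -> (forall c, x1 <> c *v x0) ->
  (forall A : nat -> X -> X, (forall j, bounded_op (A j) /\ rank_le 2 (A j)) ->
     forall z, peripheral_spectrum (gprod (rev s) A) z <-> peripheral_spectrum (gprod s A) z) ->
  quasi_semi_jordan s.
Proof.
intros Hp Hc Hx0 Hx1 H.
destruct (functional_zero_one x0 x1 Hx1) as [f2 [Hf2 [E20 E21]]].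
destruct (functional_zero_one x1 x0) as [f1 [Hf1 [E11 E10]]].
{ intros c E; destruct (classic (c = Czero)) as [->|Hc0].
  - apply Hx0; rewrite E; vec.
  - apply (Hx1 (Cinv c)); rewrite E; vec_coefs; field; exact Hc0. }
pose proof (not_In_cyclic_rest s p Hp Hc) as Hni.
exists p; split; [exact Hp|split; [exact Hc|]].
change (cyclic_rest s p = rev (cyclic_rest s p)).
set (i := nth p s 0%nat) in *; set (t := cyclic_rest s p) in *.
(* The base exceeds every letter of [s], so letters are digits. *)
pose (K := S (list_max s)).
assert (HK : forall j, In j t -> (j < K)%nat).
{ intros j Hj; apply In_cyclic_rest in Hj.
  pose proof (proj1 (list_max_le s (list_max s)) (le_n _)) as Hm.
  rewrite Forall_forall in Hm; unfold K; specialize (Hm j Hj); lia. }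
(* With [tensor x1 f1] for the distinguished letter the rotated product has rank at most one, and
   its peripheral point is the coefficient of [x0] in the image of [x1] under the remaining word,
   which is the numeral of that word. *)
pose (A := fun j => if Nat.eqb j i then tensor x1 f1 else
  fun v => (Creal (INR K) *c f1 v +c Creal (INR j) *c f2 v) *v x0 +v f2 v *v x1).
assert (HA : forall j, bounded_op (A j) /\ rank_le 2 (A j)).
{ intros j; unfold A; destruct (Nat.eqb j i).
  - split; [apply tensor_bounded, Hf1|apply tensor_rank_le_two].
  - split; [|apply rank_le_two_intro].
    apply bounded_op_add; apply bounded_op_rank1; [|exact Hf2].
    apply is_functional_add; apply is_functional_scal; assumption. }
assert (HAb : forall j, In j s -> bounded_op (A j)) by (intros j _; apply HA).
assert (Hnum : forall t', (forall j, In j t' -> j <> i) ->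
  gprod t' A x1 = Creal (INR (numeral K t')) *v x0 +v x1).
{ induction t' as [|j t' IH]; intros Ht'.
  - simpl; change (Creal 0) with Czero; vec.
  - cbn [gprod fold_right]; fold (gprod t' A); rewrite IH by (intros; apply Ht'; right; assumption).
    unfold A; rewrite (proj2 (Nat.eqb_neq j i) (Ht' j (or_introl eq_refl))).
    linpush; rewrite E10, E11, E20, E21; cbn [numeral fold_right].
    fold (numeral K t'); rewrite plus_INR, mult_INR.
    replace (Creal (INR j + INR K * INR (numeral K t')))
      with (Creal (INR j) +c Creal (INR K) *c Creal (INR (numeral K t')))
      by (apply Cplx_eq; simpl; ring).
    vec. }
assert (Ei : A i = tensor x1 f1) by (unfold A; rewrite Nat.eqb_refl; reflexivity).
assert (Hval : forall t' z, (forall j, In j t' -> j <> i) ->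
  peripheral_spectrum (fun v => A i (gprod t' A v)) z <-> z = Creal (INR (numeral K t'))).
{ intros t' z Ht'; rewrite Ei; unfold tensor.
  assert (HW : bounded_op (gprod t' A)) by (apply gprod_bounded; intros j _; apply HA).
  rewrite (peripheral_rank_one (fun v => f1 (gprod t' A v)) x1 x0)
    by (assumption || apply is_functional_comp; assumption).
  rewrite Hnum by exact Ht'; linpush; rewrite E10, E11.
  replace (Creal (INR (numeral K t')) *c Cone +c Czero) with (Creal (INR (numeral K t')))
    by ring; reflexivity. }
assert (Hti : forall j, In j t -> j <> i) by (intros j Hj ->; exact (Hni Hj)).
assert (Hrti : forall j, In j (rev t) -> j <> i) by (intros j Hj; apply Hti, in_rev, Hj).
pose proof (H A HA (Creal (INR (numeral K t)))) as E.
rewrite (peripheral_gprod_pivot s p A x0), (peripheral_gprod_rev_pivot s p A x0) in E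
  by assumption.
fold i t in E; rewrite !Hval in E by assumption.
apply (numeral_inj K).
- exact HK.
- intros j Hj; apply HK, in_rev, Hj.
- rewrite length_rev; reflexivity.
- apply INR_eq; exact (f_equal fst (proj2 E eq_refl)).
Qed.

Lemma trivial_or_nonzero (X : CBanach) : (forall x : X, x = vzero) \/ exists x : X, x <> vzero.
Proof.
destruct (classic (exists x : X, x <> vzero)) as [|H]; [auto|left].
intros x; apply NNPP; intros Hx; apply H; exists x; exact Hx.
Qed.

(** All operators on the zero space are equal, so [Phi] has only one value on [A1], and the range
    hypothesis forces [X2] to be zero as well. *)
Lemma trivial_domain_similarity {X1 X2 : CBanach} (A1 : (X1 -> X1) -> Prop)
  (Phi : (X1 -> X1) -> X2 -> X2) (m : nat) :
  (forall x : X1, x = vzero) ->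
  (forall F : X2 -> X2, bounded_op F -> rank_le 2 F -> exists A, A1 A /\ Phi A = F) ->
  exists (lam : Cplx) (T : X1 -> X2) (Tinv : X2 -> X1),
    Cpow lam m = Cone /\ invertible_op T Tinv /\
    forall A, A1 A -> Phi A = (fun y => lam *v T (A (Tinv y))).
Proof.
intros H1 Hrange.
assert (H2 : forall y : X2, y = vzero).
{ destruct (trivial_or_nonzero X2) as [|[y Hy]]; [assumption|exfalso].
  destruct (functional_one y Hy) as [g [Hg Eg]].
  destruct (Hrange (tensor y g)) as [A [_ EA]];
    [apply tensor_bounded, Hg|apply tensor_rank_le_two|].
  destruct (Hrange (tensor vzero g)) as [B [_ EB]];
    [apply tensor_bounded, Hg|apply tensor_rank_le_two|].
  assert (E : A = B)
    by (apply functional_extensionality; intros x; rewrite (H1 (A x)); symmetry; apply H1).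
  rewrite E, EB in EA; apply Hy; symmetry; exact (tensor_inj_l _ _ g y Eg EA). }
assert (Hz : forall X Y : CBanach, bounded_op (fun _ : X => @vzero Y)).
{ intros X Y; split; [split; intros; vec|exists 0; intros; rewrite vnorm_zero; lra]. }
exists Cone, (fun _ => vzero), (fun _ => vzero); split; [apply Cpow_one|split].
- repeat split; try apply Hz; intros v; symmetry; [apply H1|apply H2].
- intros A _; apply functional_extensionality; intros y.
  rewrite (H2 (Phi A y)); symmetry; apply H2.
Qed.

Theorem theorem2p1
  (X1 X2 : CBanach)
  (A1 : (X1 -> X1) -> Prop) (A2 : (X2 -> X2) -> Prop)
  (hA1 : standard_operator_algebra A1) (hA2 : standard_operator_algebra A2)
  (k : nat) (hk : (2 <= k)%nat) (s : list nat) (hs : gen_product_seq k s)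
  (Phi : (X1 -> X1) -> (X2 -> X2))
  (hPhi : forall A, A1 A -> A2 (Phi A))
  (hrange : forall F : X2 -> X2, bounded_op F -> rank_le 2 F ->
      exists A, A1 A /\ Phi A = F) :
  (forall As : nat -> X1 -> X1, (forall j, (1 <= j <= k)%nat -> A1 (As j)) ->
     forall z : Cplx,
       peripheral_spectrum (gprod s (fun j => Phi (As j))) z <->
       peripheral_spectrum (gprod s As) z)
  <->
  ((exists (lam : Cplx) (T : X1 -> X2) (Tinv : X2 -> X1),
      Cpow lam (length s) = Cone /\ invertible_op T Tinv /\
      forall A, A1 A -> Phi A = (fun y => vscal lam (T (A (Tinv y)))))
   \/
   (reflexive X1 /\ reflexive X2 /\ quasi_semi_jordan s /\
    exists (lam : Cplx) (T : (X1 -> Cplx) -> X2) (Tinv : X2 -> (X1 -> Cplx)),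
      Cpow lam (length s) = Cone /\ invertible_from_dual T Tinv /\
      forall A, A1 A -> Phi A = (fun y => vscal lam (T (fun x => Tinv y (A x)))))).
Proof.
destruct hA1 as [Hb1 [Hadd1 [Hscal1 [_ Hfin1]]]], hA2 as [Hb2 _].
destruct hs as [Hs1 [Hs2 [p [Hp Hc]]]].
split; [|intros H As HAs z; apply (preservers_preserve A1); auto].
intros Hper; destruct (trivial_or_nonzero X1) as [HX1|[x0 Hx0]].
{ left; apply trivial_domain_similarity; assumption. }
pose proof (not_In_cyclic_rest s p Hp Hc) as Hni.
pose proof (length_cyclic_rest s p Hp) as Hlen.
set (i := nth p s 0%nat) in *; set (t := cyclic_rest s p) in *.
(* Since [k >= 2], some letter other than the distinguished one occurs, so the exponent of [B] is at
   least 1. *)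
assert (Hn : exists n, length t = S n).
{ destruct (length t) as [|n] eqn:E; [|exists n; reflexivity].
  apply length_zero_iff_nil in E.
  assert (H : forall j, (1 <= j <= k)%nat -> j = i).
  { intros j Hj; destruct (In_cyclic_split s p j Hp (Hs2 j Hj)) as [H|H]; [exact H|].
    fold t in H; rewrite E in H; destruct H. }
  pose proof (H 1%nat ltac:(lia)); pose proof (H 2%nat ltac:(lia)); lia. }
destruct Hn as [n Hn]; rewrite Hn in Hlen.
assert (Htwo : forall (X : CBanach) (v : X) (A B : X -> X) (z : Cplx),
  v <> vzero -> bounded_op A -> bounded_op B ->
  peripheral_spectrum (gprod s (fun j => if Nat.eqb j i then A else B)) z <->
  peripheral_spectrum (fun x => A (Nat.iter (S n) B x)) z).
{ intros X v A B z Hv HA HB.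
  rewrite (peripheral_gprod_pivot s p _ v) by
    (assumption || (intros j _; destruct (Nat.eqb j i); assumption)).
  fold i t; rewrite Nat.eqb_refl, (gprod_constant t _ B), Hn; [reflexivity|].
  intros j Hj; destruct (Nat.eqb_spec j i) as [->|]; [destruct (Hni Hj)|reflexivity]. }
assert (Hif : forall A B, (fun j => Phi (if Nat.eqb j i then A else B))
  = fun j => if Nat.eqb j i then Phi A else Phi B).
{ intros A B; apply functional_extensionality; intros j; destruct (Nat.eqb j i); reflexivity. }
assert (Hfin : forall B, bounded_op B -> rank_le 2 B -> A1 B)
  by (intros B HB HB2; apply Hfin1; [exact HB|exists 2%nat; exact HB2]).
destruct (functional_one x0 Hx0) as [f0 [Hf0 Ef0]].
assert (HA0 : A1 (tensor x0 f0))
  by (apply Hfin; [apply tensor_bounded, Hf0|apply tensor_rank_le_two]).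
destruct (trivial_or_nonzero X2) as [HX2|[w0 Hw0]].
(* With [tensor x0 f0] in every slot the product on [X1] has the peripheral point 1, while spectra
   on the zero space are empty. *)
{ exfalso.
  assert (H : peripheral_spectrum (gprod s (fun j => Phi (tensor x0 f0))) Cone).
  { apply (Hper (fun _ => tensor x0 f0)); [auto|].
    assert (E : (fun _ : nat => tensor x0 f0)
              = fun j => if Nat.eqb j i then tensor x0 f0 else tensor x0 f0)
      by (apply functional_extensionality; intros j; destruct (Nat.eqb j i); reflexivity).
    rewrite E, (Htwo X1 x0), (peripheral_tensor_power _ x0 x0 f0) by auto.
    unfold tensor; linpush; rewrite Ef0, Cpow_one; ring. }
  exact (spectrum_trivial _ _ HX2 (proj1 H)). }
assert (Hpow : forall A B z, A1 A -> A1 B ->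
  peripheral_spectrum (fun y => Phi A (Nat.iter (S n) (Phi B) y)) z <->
  peripheral_spectrum (fun x => A (Nat.iter (S n) B x)) z).
{ intros A B z HA HB.
  rewrite <- (Htwo X2 w0), <- (Htwo X1 x0), <- Hif by auto.
  apply (Hper (fun j => if Nat.eqb j i then A else B)).
  intros j _; destruct (Nat.eqb j i); assumption. }
assert (HPb : forall A, A1 A -> bounded_op (Phi A)) by auto.
destruct (Phi_tensor_rank A1 Phi n x0 w0 Hb1 Hfin HPb hrange Hpow Hx0 Hw0 x0 f0 Hf0)
  as [y0 [g0 [Hg0 E0]]].
rewrite Hlen; destruct (structure_dichotomy A1 Phi n x0 w0 Hb1 Hadd1 Hscal1 Hfin HPb hrange
  Hpow Hx0 Hw0 f0 y0 g0 Hf0 Ef0 Hg0 E0) as [[Hrow Hcol]|[[x1 Hx1] [Hrow Hcol]]].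
- left; exact (similarity_form A1 Phi n x0 w0 Hb1 Hadd1 Hscal1 Hfin HPb hrange
    Hpow Hx0 Hw0 f0 y0 g0 Hf0 Ef0 Hg0 E0 Hrow Hcol).
- right.
  destruct (adjoint_form A1 Phi n x0 w0 Hb1 Hadd1 Hscal1 Hfin HPb hrange
    Hpow Hx0 Hw0 f0 y0 g0 Hf0 Ef0 Hg0 E0 Hrow Hcol)
    as [Hr1 [Hr2 [lam [T [Tinv [Hlam [HT HPhi]]]]]]].
  split; [exact Hr1|split; [exact Hr2|split]]; [|exists lam, T, Tinv; auto].
  (* The adjoint form identifies the peripheral spectrum of the product of the [Phi (A j)] with that
     of the reversed product of the [A j], and the hypothesis with that of the product itself. *)
  apply (quasi_semi_jordan_of_rev s p x0 x1 Hp Hc Hx0 Hx1); intros A HA z.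
  rewrite <- (Hper A) by (intros j _; apply Hfin; apply HA).
  symmetry; apply (peripheral_gprod_adjoint T Tinv lam s A _ x0); auto.
  + rewrite Hlen; exact Hlam.
  + intros j _; apply HA.
  + intros j _; apply HPhi, Hfin; apply HA.
Qed.
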